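(* Let $n\ge 1$ be a fixed integer. For an integer $H\ge 1$ let $\mathcal{M}_n(\mathbb{Z};H)$ be the set of $n\times n$ matrices $A=(a_{ij})_{i,j=1}^n$ with integer entries satisfying $|a_{ij}|\le H$ for all $i,j$, and let $S_n(H)$ be the number of $A\in\mathcal{M}_n(\mathbb{Z};H)$ whose determinant $\det A$ is square-free (i.e. not divisible by $p^2$ for any prime $p$). Then \[ S_n(H)=2^{n^2}\mathfrak{S}_n H^{n^2}+O\left(H^{n^2-\gamma_n}\right), \] where \[ \mathfrak{S}_n=\prod_{p\ \text{prime}}\ \prod_{j=2}^{n+1}\left(1-p^{-j}\right),\qquad \gamma_n=\frac12+\frac{n-1}{2(n^3+3n^2-n+1)}, \] and the implied constant depends only on $n$. *)

(* Defs.v *)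
From HB Require Import structures.
From mathcomp Require Import all_boot all_order all_algebra.
From mathcomp Require Import all_classical all_reals all_analysis.
Set Implicit Arguments. Unset Strict Implicit. Unset Printing Implicit Defensive.
Import Order.TTheory GRing.Theory Num.Theory.
Import numFieldNormedType.Exports.
Local Open Scope ring_scope.

(* An integer d is square-free if no p^2 (p prime) divides it.
   Primes p with p^2 | d, d <> 0, satisfy p <= |d|, so bounding p by |d|+2 loses nothing; and 0 is not square-free (4 | 0). *)
Definition squarefree_int (d : int) : bool :=
  [forall p : 'I_(`|d|%N.+3), prime p ==> ~~ (p ^ 2 %| `|d|)%N].

(* Shifted entry: an element of 'I_(2H+1) encodes the integer x - H in [-H, H]. *)
Definition entry_of (H : nat) (x : 'I_(2 * H).+1) : int := (x : nat)%:Z - H%:Z.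

Definition mx_of (n H : nat) (A : 'M['I_(2 * H).+1]_n) : 'M[int]_n :=
  map_mx (@entry_of H) A.

Definition S_count (n H : nat) : nat :=
  #|[set A : 'M['I_(2 * H).+1]_n | squarefree_int (\det (mx_of A))]|.

Definition frakS_partial (R : realType) (n : nat) (N : nat) : R :=
  \prod_(p < N | prime p) \prod_(2 <= j < n.+2) (1 - ((p%:R : R) ^- j)).

Definition frakS (R : realType) (n : nat) : R := limn (frakS_partial R n).

Definition gamma_n (R : realType) (n : nat) : R :=
  2^-1 + (n%:R - 1) / (2 * ((n ^ 3)%:R + 3 * (n ^ 2)%:R - n%:R + 1)).

(* Main.v *)
(** Write N = 2H+1, let N_m be the number of matrices of the box with m | det, and
    rho(m) the density of m | det among residue matrices.  Inclusion-exclusion over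
    square-free d gives the main term, because rho(d^2) is multiplicative and
    1 - rho(p^2) = prod_{2<=j<=n+1} (1 - p^-j).  With Q a little larger than H^(1/2)
    the error splits into three ranges of d.

    For d > Q, the number of matrices of determinant t is O(H^(n^2-n+eps)) for t <> 0:
    if the rows 2..n have cofactor vector g c, c primitive, then those rows and the
    admissible first rows are points of translates of the lattice orthogonal to c, of
    which there are O(H^(n-1)/|c|) in the box, and the sum of |c|^-n is logarithmic.

    For d <= Q, N_m (m = d^2) is compared with its average over all translates of the
    box, which is exactly rho(m) N^(n^2).  Moving one entry of the first row only
    involves the lattice m | z_0 x + z_1 y, where z_0, z_1 are cofactors.  If this
    lattice has covering radius R, the counts of two translates agree up to a factor
    1 + O(R/N).  For small d, R = m suffices.  For d near H^(1/2) the pigeonhole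
    principle gives R = m/L + L, unless the lattice contains a nonzero vector of size
    at most L; the matrices for which it does are counted by peeling off columns. *)

Require Import Defs.
From HB Require Import structures.
From mathcomp Require Import all_boot all_order all_algebra.
From mathcomp Require Import all_classical all_reals all_analysis.
From mathcomp Require Import fingroup perm.
From mathcomp Require Import ring lra zify.
Set Implicit Arguments. Unset Strict Implicit. Unset Printing Implicit Defensive.
Import Order.TTheory GRing.Theory Num.Theory.
Local Open Scope ring_scope.

(** * Linear congruences over boxes *)

(** The range d > Q costs about H^(n^2) / Q, so Q must reach H^(1/2 + gain), with gain = [gamma_n] -
    1/2. But then m = d^2 may exceed the side of the box, where the choice R = m says nothing. Since
    rho(m) is at most H^eps / m, the relative error R/N with R = m costs about H^(n^2 - 1) for each
    d, which is affordable for d <= H^(1/2 - shift) only. The obstacle is the window between these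
    two bounds. There R near m/L improves the cost of each d by a factor 1/L, and L has to beat the
    surplus H^(2 shift) of m over H. The price is the exceptional set: a relation m | u z_0 + v z_1
    together with m | det has density about 1/m^2 instead of 1/m, up to a factor L for the size of u
    and v and powers of 1 + m/N; there are about L^2 such relations. Every loss in the window has
    the form H^(c shift) with c linear in n, so a gain of order 1/n could be afforded. The gain in
    [gamma_n] is of order 1/n^2, and this slack is what permits crude constants and an eps as large
    as 1/(100 n). *)

Ltac nonneg := repeat first [ assumption | exact: ler0n | exact: ler01
  | apply: exprn_ge0 | rewrite invr_ge0 | apply: mulr_ge0 | apply: addr_ge0 ].

Lemma sum_row_mx (S : nmodType) (T : finType) m n1 n2
    (F : 'M[T]_(m, n1 + n2) -> S) :
  \sum_X F X = \sum_A \sum_B F (row_mx A B).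
Proof.
rewrite pair_bigA /=.
rewrite (reindex (fun p : 'M[T]_(m, n1) * 'M[T]_(m, n2) => row_mx p.1 p.2)) //=.
exists (fun X => (lsubmx X, rsubmx X)) => X _ /=; last exact: hsubmxK.
by rewrite row_mxKl row_mxKr -surjective_pairing.
Qed.

Lemma sum_col_mx (S : nmodType) (T : finType) m1 m2 n
    (F : 'M[T]_(m1 + m2, n) -> S) :
  \sum_X F X = \sum_A \sum_B F (col_mx A B).
Proof.
rewrite pair_bigA /=.
rewrite (reindex (fun p : 'M[T]_(m1, n) * 'M[T]_(m2, n) => col_mx p.1 p.2)) //=.
exists (fun X => (usubmx X, dsubmx X)) => X _ /=; last exact: vsubmxK.
by rewrite col_mxKu col_mxKd -surjective_pairing.
Qed.

Lemma sum_mx11 (S : nmodType) (T : finType) (F : 'M[T]_1 -> S) :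
  \sum_X F X = \sum_x F (const_mx x).
Proof.
rewrite (reindex (fun x : T => const_mx x : 'M[T]_1)) //=.
exists (fun X : 'M[T]_1 => X 0 0) => X _; first by rewrite mxE.
by apply/matrixP => i j; rewrite mxE !ord1.
Qed.

Lemma sum_trmx (S : nmodType) (T : finType) m n (F : 'M[T]_(m, n) -> S) :
  \sum_X F X = \sum_(X : 'M[T]_(n, m)) F X^T.
Proof.
by rewrite (reindex (@trmx T n m)) //=; exists (@trmx T m n) => X _; rewrite trmxK.
Qed.

Lemma sum_thin_mx (S : nmodType) (T : finType) m (F : 'M[T]_(m, 0) -> S) X0 :
  \sum_X F X = F X0.
Proof.
rewrite (bigD1 X0) //= big1 ?addr0 // => X /eqP[]; apply/matrixP=> i [].
by [].
Qed.

Lemma dvdn_mul_gcd e w y : (0 < e)%N ->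
  (e %| w * y)%N = (e %/ gcdn w e %| y)%N.
Proof.
move=> e0; set g := gcdn w e.
have g0 : (0 < g)%N by rewrite gcdn_gt0 e0 orbT.
have [ew ee] : (g %| w)%N /\ (g %| e)%N by rewrite dvdn_gcdl dvdn_gcdr.
rewrite -{1}(divnK ee) -{1}(divnK ew) mulnAC dvdn_pmul2r // Gauss_dvdr //.
by rewrite /coprime -(eqn_pmul2r g0) muln_gcdl mul1n !divnK // gcdnC.
Qed.

Lemma dvdz_mul_gcd (e : nat) (w y : int) : (0 < e)%N ->
  (e%:Z %| w * y)%Z = ((e %/ gcdn `|w| e)%N%:Z %| y)%Z.
Proof. by move=> e0; rewrite !dvdzE /= abszM dvdn_mul_gcd. Qed.

(** Solutions are congruent modulo q = e / gcd(w, e), so x -> x / q (integer quotient) is injective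
    on them. *)
Lemma congruence_count (R : realFieldType) N e (w c : int) : (0 < e)%N ->
  \sum_(x < N) ((e%:Z %| c + w * x%:Z)%Z : nat)%:R
    <= N%:R * ((gcdn `|w| e)%:R / e%:R) + 1 :> R.
Proof.
move=> e0; set g := gcdn _ _.
have g0 : (0 < g)%N by rewrite gcdn_gt0 e0 orbT.
have ge : (g %| e)%N by apply: dvdn_gcdr.
set q := (e %/ g)%N.
have q0 : (0 < q)%N by rewrite divn_gt0 // dvdn_leq.
pose P := [pred x : 'I_N | (e%:Z %| c + w * x%:Z)%Z].
have -> : \sum_(x < N) ((e%:Z %| c + w * x%:Z)%Z : nat)%:R = #|P|%:R :> R.
  rewrite -sum1_card natr_sum [in RHS]big_mkcond /=.
  by apply: eq_bigr => x _; rewrite inE; case: (_ %| _)%Z.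
have cardP : (#|P| <= (N %/ q).+1)%N.
  rewrite -[X in (_ <= X)%N](card_ord); apply: (leq_card_in (fun x : 'I_N => inord (x %/ q))).
  move=> x y; rewrite !inE => Px Py /(congr1 val) /=.
  rewrite !inordK ?ltnS ?leq_div2r ?(ltnW (ltn_ord _)) // => xy.
  have : (e%:Z %| w * (x%:Z - y%:Z))%Z.
    have := rpredB Px Py; rewrite opprD addrACA subrr add0r -mulrN -mulrDr.
    by [].
  rewrite dvdz_mul_gcd // -/g -/q -eqz_mod_dvd !modz_nat => /eqP [exy].
  by apply/val_inj/eqP; rewrite /= (divn_eq x q) (divn_eq y q) xy exy.
apply: le_trans (_ : ((N %/ q).+1)%:R <= _); first by rewrite ler_nat.
rewrite -natr1 lerD2r -ler_pdivrMr ?divr_gt0 ?ltr0n // invf_div.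
rewrite -[e](divnK ge) -/q natrM mulfK ?pnatr_eq0 -?lt0n //.
by rewrite -natrM ler_nat leq_divM.
Qed.

(* With [e = 0] this is the gcd of the entries of [w]. *)
Definition gcdv k (w : 'I_k -> int) (e : nat) : nat := \big[gcdn/e]_i `|w i|%N.

Lemma gcdv_dvdl k (w : 'I_k -> int) e i : (gcdv w e %| `|w i|)%N.
Proof.
rewrite /gcdv; elim: k w i => [|k IHk] w i; first by case: i.
rewrite big_ord_recl; case: (unliftP ord0 i) => [j ->|->]; last exact: dvdn_gcdl.
exact: dvdn_trans (dvdn_gcdr _ _) (IHk _ j).
Qed.

Lemma gcdv_dvdr k (w : 'I_k -> int) e : (gcdv w e %| e)%N.
Proof.
rewrite /gcdv; elim: k w => [|k IHk] w; first by rewrite big_ord0.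
by rewrite big_ord_recl; exact: dvdn_trans (dvdn_gcdr _ _) (IHk _).
Qed.

Lemma dvdn_gcdv k (w : 'I_k -> int) e d :
  (forall i, (d %| `|w i|)%N) -> (d %| e)%N -> (d %| gcdv w e)%N.
Proof. by move=> dw de; rewrite /gcdv; elim/big_ind: _ => // x y dx dy; rewrite dvdn_gcd dx. Qed.

Lemma gcdv_gt0 k (w : 'I_k -> int) e : (0 < e)%N -> (0 < gcdv w e)%N.
Proof. by move=> e0; apply: dvdn_gt0 e0 (gcdv_dvdr w e). Qed.

Lemma row_mx_const0 (T : Type) k (x : T) (B : 'rV[T]_k) :
  (row_mx (const_mx x : 'rV_1) B : 'rV_(k.+1)) 0 ord0 = x.
Proof. by rewrite mxE; case: splitP => j //= _; rewrite mxE. Qed.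

Lemma row_mx_constS (T : Type) k (x : T) (B : 'rV[T]_k) i :
  (row_mx (const_mx x : 'rV_1) B : 'rV_(k.+1)) 0 (lift ord0 i) = B 0 i.
Proof.
rewrite mxE; case: splitP => j /=; first by rewrite ord1.
by rewrite /bump /= !add1n => -[/ord_inj ->].
Qed.

(** Induction on the variables: solvability in the last k of them forces g' = [gcdv w' e] to divide
    c + w_0 x_0, which [congruence_count] handles modulo g'. The error constants obey C -> 2 C + 1,
    hence 2^k - 1. *)
Lemma linear_congruence_count (R : realFieldType) N e k (w : 'I_k -> int) (c : int) :
  (0 < e)%N -> (0 < N)%N ->
  \sum_(x : 'rV['I_N]_k) ((e%:Z %| c + \sum_j w j * (x 0 j)%:Z)%Z : nat)%:R
    <= N%:R ^+ k * ((gcdv w e)%:R / e%:R + (2 ^+ k - 1) / N%:R) :> R.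
Proof.
move=> e0 N0; elim: k w c => [|k IHk] w c.
  rewrite (sum_thin_mx _ (\row_i Ordinal N0)) big_ord0 addr0 !expr0 subrr mul0r addr0 mul1r.
  rewrite /gcdv big_ord0 divff ?pnatr_eq0 -?lt0n //.
  by case: (_ %| _)%Z; rewrite ?lexx ?ler01.
pose w' (j : 'I_k) := w (lift ord0 j).
set g' := gcdv w' e; have g'0 : (0 < g')%N by apply: gcdv_gt0.
have -> : gcdv w e = gcdn `|w ord0| g' by rewrite /gcdv big_ord_recl.
set g := gcdn _ _.
rewrite (@sum_row_mx _ _ 1 1 k) sum_mx11.
set A := N%:R ^+ k * (g'%:R / e%:R + (2 ^+ k - 1) / N%:R) : R.
have A0 : 0 <= A.
  by rewrite mulr_ge0 ?exprn_ge0 ?addr_ge0 ?divr_ge0 ?ler0n // subr_ge0 exprn_ege1 // ler1n.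
apply: le_trans (_ : \sum_(x < N) ((g'%:Z %| c + w ord0 * x%:Z)%Z : nat)%:R * A <= _).
  apply: ler_sum => x _.
  under eq_bigr => B _.
    rewrite big_ord_recl.
    rewrite row_mx_const0.
    have -> : \sum_(i < k) w (lift ord0 i) * ((row_mx (const_mx x : 'rV_1) B : 'rV_k.+1) 0 (lift ord0 i))%:Z
            = \sum_(i < k) w' i * (B 0 i)%:Z.
      by apply: eq_bigr => i _; rewrite row_mx_constS.
    rewrite addrA.
    over.
  case: (boolP (g'%:Z %| c + w ord0 * x%:Z)%Z) => [_|ndv] /=.
    by rewrite mul1r; apply: IHk.
  rewrite mul0r big1 // => B _.
  case: (boolP (e%:Z %| _)%Z) => //= dv; case/negP: ndv.
  have : (g'%:Z %| \sum_(i < k) w' i * (B 0 i)%:Z)%Z.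
    by apply: rpred_sum => i _; apply: dvdz_mulr; rewrite dvdzE /= gcdv_dvdl.
  move=> dv'; have := dvdz_trans (_ : (g'%:Z %| e%:Z)%Z) dv.
  by rewrite dvdzE /= gcdv_dvdr rpredDr //; apply.
rewrite -mulr_suml.
apply: le_trans (ler_wpM2r A0 (congruence_count R N (w ord0) c g'0)) _.
rewrite -/g /A.
have N0' : (0 : R) < N%:R by rewrite ltr0n.
have e0' : (0 : R) < e%:R by rewrite ltr0n.
have g0' : (0 : R) < g'%:R by rewrite ltr0n.
have gg : (g <= g')%N by rewrite dvdn_leq // dvdn_gcdr.
have ge : (g' <= e)%N by rewrite dvdn_leq // gcdv_dvdr.
have u1 : g%:R / g'%:R <= 1 :> R by rewrite ler_pdivrMr // mul1r ler_nat.
have u2 : g'%:R / e%:R <= 1 :> R by rewrite ler_pdivrMr // mul1r ler_nat.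
have u3 : N%:R^-1 <= 1 :> R by rewrite invf_le1 // ler1n.
have C0 : 0 <= 2 ^+ k - 1 :> R by rewrite subr_ge0 exprn_ege1 // ler1n.
set C := 2 ^+ k - 1 in C0 *.
have -> : 2 ^+ k.+1 - 1 = 2 * C + 1 :> R by rewrite /C exprS; ring.
have -> : (N%:R * (g%:R / g'%:R) + 1) * (N%:R ^+ k * (g'%:R / e%:R + C / N%:R))
  = N%:R ^+ k.+1 * (g%:R / e%:R + (C * (g%:R / g'%:R) + g'%:R / e%:R + C * N%:R^-1) / N%:R) :> R.
  rewrite exprS; field.
  by rewrite !gt_eqF.
rewrite ler_wpM2l ?exprn_ge0 ?ler0n // lerD2l ler_wpM2r ?invr_ge0 ?ler0n //.
have := ler_wpM2l C0 u1; have := ler_wpM2l C0 u3; lra.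
Qed.

(** * Maximal minors *)

(* Boxes carry an arbitrary integer offset [T]: the family of boxes is then closed under
   row and column permutations, and counts can be averaged over offsets modulo [m]. *)
Definition shift_mx N a b (T : 'M[int]_(a, b)) (X : 'M['I_N]_(a, b)) : 'M[int]_(a, b) :=
  map_mx (fun x : 'I_N => (x : nat)%:Z) X + T.

Lemma shift_mxE N a b (T : 'M[int]_(a, b)) (X : 'M['I_N]_(a, b)) i j :
  shift_mx T X i j = (X i j : nat)%:Z + T i j.
Proof. by rewrite !mxE. Qed.

Lemma shift_row_mx N a b1 b2 (T : 'M[int]_(a, b1 + b2)) (A : 'M['I_N]_(a, b1)) (B : 'M['I_N]_(a, b2)) :
  shift_mx T (row_mx A B) = row_mx (shift_mx (lsubmx T) A) (shift_mx (rsubmx T) B).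
Proof. by rewrite /shift_mx map_row_mx -{1}[T]hsubmxK add_row_mx. Qed.

Lemma shift_col_mx N a1 a2 b (T : 'M[int]_(a1 + a2, b)) (A : 'M['I_N]_(a1, b)) (B : 'M['I_N]_(a2, b)) :
  shift_mx T (col_mx A B) = col_mx (shift_mx (usubmx T) A) (shift_mx (dsubmx T) B).
Proof. by rewrite /shift_mx map_col_mx -{1}[T]vsubmxK add_col_mx. Qed.

Lemma shift_trmx N a b (T : 'M[int]_(a, b)) (X : 'M['I_N]_(a, b)) :
  (shift_mx T X)^T = shift_mx T^T X^T.
Proof. by apply/matrixP => i j; rewrite mxE !shift_mxE !mxE. Qed.

(** The generalised cross product of the rows of [Y]. *)
Definition minors k (Y : 'M[int]_(k, k.+1)) (j : 'I_k.+1) : int :=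
  (-1) ^+ j * \det (col' j Y).

Lemma det_col_mx_minors k (a : 'rV[int]_k.+1) (Y : 'M[int]_(k, k.+1)) :
  \det (col_mx a Y : 'M[_]_(k.+1)) = \sum_j minors Y j * a 0 j.
Proof.
rewrite (expand_det_row _ 0); apply: eq_bigr => j _.
rewrite mulrC; congr (_ * _).
  rewrite /cofactor /minors add0n; congr (_ * \det _).
  apply/matrixP => i l; rewrite !mxE; case: splitP => i' /=.
    by rewrite ord1 /bump.
  by rewrite /bump /= !add1n => -[/ord_inj ->].
by rewrite mxE; case: splitP => i' //= _; rewrite ord1.
Qed.

Lemma det_row_mx_minors k (y : 'cV[int]_k.+1) (U : 'M[int]_(k.+1, k)) :
  \det (row_mx y U : 'M[_]_(k.+1)) = \sum_i minors U^T i * y i 0.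
Proof.
rewrite -det_tr; have -> : (row_mx y U : 'M[_]_(k.+1))^T = col_mx y^T U^T.
  exact: (@tr_row_mx _ k.+1 1 k).
by rewrite det_col_mx_minors; apply: eq_bigr => i _; rewrite mxE.
Qed.

Section TwoColumns.
Variables (k : nat) (y0 y1 : 'cV[int]_k.+1) (U : 'M[int]_(k.+1, k)).
Let Y : 'M[int]_(k.+1, k.+2) := row_mx y0 (row_mx y1 U : 'M[_]_(k.+1, k.+1)).

Lemma minors_two0 : minors Y ord0 = \sum_i minors U^T i * y1 i 0.
Proof.
rewrite -det_row_mx_minors /minors expr0 mul1r; congr (\det _).
apply/matrixP => i j; rewrite mxE mxE; case: splitP => j' /=.
  by rewrite ord1 /bump.
by rewrite /bump /= !add1n => -[/ord_inj ->].
Qed.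

Lemma minors_two1 : minors Y (lift ord0 ord0) = - \sum_i minors U^T i * y0 i 0.
Proof.
rewrite -det_row_mx_minors /minors /= expr1 mulN1r; congr (- \det _).
apply/matrixP => i j; rewrite mxE mxE; case: splitP => j' /=.
  rewrite ord1 /bump /=; case: j => -[|j] //= hj _.
  by rewrite mxE; case: splitP => j'' //= _; rewrite ord1.
case: j => -[|j] //= hj; rewrite /bump /= !add1n => -[ejj'].
rewrite !mxE; case: splitP => j'' /=; rewrite -ejj' ?ord1 //= add1n => -[ejj''].
case: splitP => l /=; first by rewrite ord1.
by rewrite ejj'' add1n => -[/ord_inj ->].
Qed.
End TwoColumns.

Lemma sum_two_columns (S : nmodType) (T : finType) k (F : 'M[T]_(k.+1, k.+2) -> S) :
  \sum_Y F Y = \sum_(U : 'M[_]_(k.+1, k)) \sum_(y1 : 'cV_k.+1) \sum_(y0 : 'cV_k.+1)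
     F (row_mx y0 (row_mx y1 U : 'M[_]_(k.+1, k.+1))).
Proof.
rewrite (@sum_row_mx _ _ k.+1 1 k.+1) exchange_big /=.
by rewrite (@sum_row_mx _ _ k.+1 1 k) exchange_big.
Qed.

(** Since the gcd is at least 1 and e <= m, the additive error 1/N is at most (m/N)(gcd/e). The
    bound becomes purely multiplicative, as required for combining several congruences. *)
Lemma congruence_count_theta (R : realFieldType) N m e k (w : 'I_k -> int) (c : int) (t : 'cV[int]_k) :
  (0 < N)%N -> (0 < e)%N -> (e <= m)%N ->
  \sum_(y : 'cV['I_N]_k) ((e%:Z %| c + \sum_j w j * (shift_mx t y) j 0)%Z : nat)%:R
    <= (2 ^+ k * (1 + m%:R / N%:R)) * (N%:R ^+ k * ((gcdv w e)%:R / e%:R)) :> R.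
Proof.
move=> N0 e0 em; rewrite sum_trmx.
have := linear_congruence_count R w (c + \sum_j w j * t j 0) e0 N0.
under eq_bigr => x _.
  have -> : c + \sum_j w j * t j 0 + \sum_j w j * (x 0 j : nat)%:Z
    = c + \sum_j w j * (shift_mx t x^T) j 0.
    rewrite -addrA -big_split /=; congr (_ + _); apply: eq_bigr => j _.
    by rewrite shift_mxE mxE -mulrDr addrC.
  over.
move=> /le_trans; apply.
set g := gcdv w e; have g0 : (0 < g)%N by apply: gcdv_gt0.
have N0' : (0 : R) < N%:R by rewrite ltr0n.
have e0' : (0 : R) < e%:R by rewrite ltr0n.
have g1 : (1 : R) <= g%:R by rewrite ler1n.
have K1 : (1 : R) <= 2 ^+ k by rewrite exprn_ege1 // ler1n.
rewrite mulrCA ler_wpM2l ?exprn_ge0 ?ler0n //.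
have h1 : (N%:R)^-1 <= (m%:R / N%:R) * (g%:R / e%:R) :> R.
  rewrite mulrAC ler_peMl ?invr_ge0 ?ler0n // mulrA ler_pdivlMr // mul1r.
  by rewrite -natrM ler_nat (leq_trans em) // leq_pmulr.
have h2 : 0 <= g%:R / e%:R :> R by rewrite divr_ge0 ?ler0n.
have := ler_wpM2l (_ : 0 <= 2 ^+ k - 1) h1; rewrite subr_ge0 => /(_ K1).
have := mulr_ge0 (_ : 0 <= 2 ^+ k - 1) h2; rewrite subr_ge0 => /(_ K1).
have := mulr_ge0 (_ : 0 <= m%:R / N%:R :> R) h2; rewrite divr_ge0 ?ler0n // => /(_ isT).
set x := g%:R / e%:R; set y := m%:R / N%:R; set n := N%:R^-1; set K := 2 ^+ k.
nra.
Qed.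

Lemma gcdv_scale_le k (w : 'I_k -> int) (q : int) f m : q != 0 -> (0 < m)%N -> (f %| m)%N ->
  (gcdv (fun j => (q * w j)%R) f <= `|q| * gcdv w m)%N.
Proof.
move=> q0 m0 fm; apply: dvdn_leq; first by rewrite muln_gt0 absz_gt0 q0 gcdv_gt0.
have scale e : (`|q| * gcdv w e = \big[gcdn/`|q| * e]_j (`|q| * `|w j|))%N.
  by rewrite /gcdv; elim/big_rec2: _ => // i x y _ <-; rewrite muln_gcdr.
rewrite scale; elim/big_ind: _ => [|x y dx dy|j _].
- by apply: dvdn_trans (gcdv_dvdr _ _) _; rewrite dvdn_mull.
- by rewrite dvdn_gcd dx.
- by have := gcdv_dvdl (fun j => q * w j) f j; rewrite abszM.
Qed.

Lemma gcdv_le k (w : 'I_k -> int) f m : (0 < m)%N -> (f %| m)%N -> (gcdv w f <= gcdv w m)%N.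
Proof.
move=> m0 fm; apply: dvdn_leq; first exact: gcdv_gt0.
by apply: dvdn_gcdv => [i|]; [exact: gcdv_dvdl | exact: dvdn_trans (gcdv_dvdr _ _) fm].
Qed.

(** The congruence modulo e restricts y; for fixed y the other one is a congruence in x with
    coefficients q w_j, whose gcd with f is at most |q| times that of w with m. *)
Lemma two_congruences (R : realFieldType) N m e f (p q : int) k (w : 'I_k -> int) (t s : 'cV[int]_k) :
  (0 < N)%N -> (0 < m)%N -> (e %| m)%N -> (f %| m)%N -> q != 0 ->
  \sum_(y : 'cV['I_N]_k) \sum_(x : 'cV['I_N]_k)
    ((f%:Z %| p * (\sum_j w j * shift_mx t y j 0) + q * (\sum_j w j * shift_mx s x j 0))%Z
     && (e%:Z %| \sum_j w j * shift_mx t y j 0)%Z : nat)%:R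
  <= (2 ^+ k * (1 + m%:R / N%:R) * N%:R ^+ k) ^+ 2
      * (`|q|%N%:R * (gcdv w m)%:R ^+ 2 / (e%:R * f%:R)) :> R.
Proof.
move=> N0 m0 em fm q0.
have e0 : (0 < e)%N := dvdn_gt0 m0 em.
have f0 : (0 < f)%N := dvdn_gt0 m0 fm.
set C := _ * N%:R ^+ k.
have C0 : 0 <= C by rewrite !mulr_ge0 ?exprn_ge0 ?addr_ge0 ?divr_ge0 ?ler0n.
set G := (gcdv w m)%:R : R.
have G0 : 0 <= G by rewrite ler0n.
have inner y : \sum_(x : 'cV['I_N]_k)
    ((f%:Z %| p * (\sum_j w j * shift_mx t y j 0) + q * (\sum_j w j * shift_mx s x j 0))%Z : nat)%:R
    <= C * (`|q|%N%:R * G / f%:R) :> R.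
  set c := p * _.
  under eq_bigr => x _ do rewrite mulr_sumr.
  under eq_bigr => x _ do under eq_bigr => j _ do rewrite mulrA.
  apply: le_trans (congruence_count_theta R (fun j => q * w j) _ s N0 f0 (dvdn_leq m0 fm)) _.
  rewrite [_ * (N%:R ^+ k * _)]mulrA -/C ler_wpM2l // ler_wpM2r ?invr_ge0 ?ler0n //.
  by rewrite -natrM ler_nat gcdv_scale_le.
apply: le_trans (_ : \sum_(y : 'cV['I_N]_k) ((e%:Z %| 0 + \sum_j w j * shift_mx t y j 0)%Z : nat)%:R
    * (C * (`|q|%N%:R * G / f%:R)) <= _).
  apply: ler_sum => y _; rewrite add0r; case: (e%:Z %| _)%Z; last first.
    by rewrite mul0r big1 // => x _; rewrite andbF.
  by rewrite mul1r; under eq_bigr => x _ do rewrite andbT.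
rewrite -mulr_suml.
have D0 : 0 <= C * (`|q|%N%:R * G / f%:R) by rewrite mulr_ge0 // divr_ge0 ?mulr_ge0 ?ler0n.
apply: le_trans (ler_wpM2r D0 (congruence_count_theta R w 0 t N0 e0 (dvdn_leq m0 em))) _.
rewrite [_ * (N%:R ^+ k * _)]mulrA -/C.
apply: le_trans (_ : C * (G / e%:R) * (C * (`|q|%N%:R * G / f%:R)) <= _).
  rewrite ler_wpM2r // ler_wpM2l // ler_wpM2r ?invr_ge0 ?ler0n //.
  by rewrite ler_nat gcdv_le.
rewrite le_eqVlt; apply/orP; left; apply/eqP; field.
by rewrite !pnatr_eq0 -!lt0n e0 f0.
Qed.

Section PairCount.
Variables (R : realFieldType) (N m e f k : nat) (u v : int) (T : 'M[int]_(k.+1, k.+2)).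
Hypotheses (N0 : (0 < N)%N) (m0 : (0 < m)%N) (em : (e %| m)%N) (fm : (f %| m)%N).

Let TU : 'M[int]_(k.+1, k) := @rsubmx _ k.+1 1 k (@rsubmx _ k.+1 1 k.+1 T).
Let bound (q : int) : R :=
  (2 ^+ k.+1 * (1 + m%:R / N%:R) * N%:R ^+ k.+1) ^+ 2 * (`|q|%N%:R / (e%:R * f%:R))
  * \sum_(U : 'M['I_N]_(k.+1, k)) (gcdv (minors (shift_mx TU U)^T) m)%:R ^+ 2.

(** Once U is fixed, the first minor is a form in y1 alone and the second a form in y0 alone. As v
    is nonzero, the relation modulo f is a genuine condition on y0 after y1 has been chosen.
    [pair_countr] is the mirror image, solving for y1. *)
Lemma pair_countl : v != 0 ->
  \sum_(Y : 'M['I_N]_(k.+1, k.+2))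
    ((f%:Z %| u * minors (shift_mx T Y) ord0 + v * minors (shift_mx T Y) (lift ord0 ord0))%Z
     && (e%:Z %| minors (shift_mx T Y) ord0)%Z : nat)%:R <= bound v.
Proof.
move=> v0; rewrite sum_two_columns /bound mulr_sumr; apply: ler_sum => U _.
have vN0 : - v != 0 by rewrite oppr_eq0.
have := two_congruences R u (minors (shift_mx TU U)^T)
  (@lsubmx _ k.+1 1 k (@rsubmx _ k.+1 1 k.+1 T)) (@lsubmx _ k.+1 1 k.+1 T) N0 m0 em fm vN0.
rewrite abszN => h; apply: le_trans (le_trans _ h) _.
  apply: ler_sum => y1 _; apply: ler_sum => y0 _.
  rewrite (@shift_row_mx _ k.+1 1 k.+1) (@shift_row_mx _ k.+1 1 k) -/TU.
  by rewrite minors_two0 minors_two1 mulrN mulNr.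
by rewrite le_eqVlt; apply/orP; left; apply/eqP; ring.
Qed.

Lemma pair_countr : u != 0 ->
  \sum_(Y : 'M['I_N]_(k.+1, k.+2))
    ((f%:Z %| u * minors (shift_mx T Y) ord0 + v * minors (shift_mx T Y) (lift ord0 ord0))%Z
     && (e%:Z %| minors (shift_mx T Y) (lift ord0 ord0))%Z : nat)%:R <= bound u.
Proof.
move=> u0; rewrite sum_two_columns /bound mulr_sumr; apply: ler_sum => U _.
rewrite exchange_big /=.
have := two_congruences R (- v) (minors (shift_mx TU U)^T)
  (@lsubmx _ k.+1 1 k.+1 T) (@lsubmx _ k.+1 1 k (@rsubmx _ k.+1 1 k.+1 T)) N0 m0 em fm u0.
move=> h; apply: le_trans (le_trans _ h) _.
  apply: ler_sum => y1 _; apply: ler_sum => y0 _.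
  rewrite (@shift_row_mx _ k.+1 1 k.+1) (@shift_row_mx _ k.+1 1 k) -/TU.
  by rewrite minors_two0 minors_two1 mulrN mulNr rpredN addrC.
by rewrite le_eqVlt; apply/orP; left; apply/eqP; ring.
Qed.
End PairCount.

(** * Matrices with a short relation *)

(** The loss for each pair of peeled columns: the number of divisors that the gcd may equal, and the
    square of the factor 2^k (1 + m/N) of [congruence_count_theta]. *)
Definition peel_cost (R : realFieldType) (N m n : nat) : R :=
  (size (divisors m))%:R * 4 ^+ n * (1 + m%:R / N%:R) ^+ 2.

(** Removes an unknown gcd from a sum: all divisors sharing a property of the gcd are allowed
    instead. *)
Lemma le_sum_divisors (R : realFieldType) m g j (P : pred nat) : (0 < m)%N ->
  (g %| m)%N -> P g -> g%:R ^+ j <= \sum_(f <- divisors m) f%:R ^+ j * (P f : nat)%:R :> R.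
Proof.
move=> m0 gm Pg; rewrite (big_rem g) -?dvdn_divisors //= Pg mulr1 lerDl.
by apply: sumr_ge0 => f _; rewrite mulr_ge0 ?exprn_ge0 ?ler0n.
Qed.

(* The first two minors of [(y0 | y1 | U)] are, up to sign, the linear forms [u.y1] and
   [u.y0] with the same coefficients [u], the minors of [U]; whence a recursion on [k]. *)
Lemma minors_gcd_sum (R : realFieldType) N m n k (T : 'M[int]_(k, k.+1)) :
  (0 < N)%N -> (0 < m)%N -> (k <= n)%N ->
  \sum_(Y : 'M['I_N]_(k, k.+1)) (gcdv (minors (shift_mx T Y)) m)%:R ^+ 2
    <= peel_cost R N m n ^+ k * N%:R ^+ (k * k.+1) :> R.
Proof.
move=> N0 m0; have N0' : (0 : R) < N%:R by rewrite ltr0n.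
elim: k T => [|k IHk] T kn.
  rewrite mul0n !expr0 mulr1 sum_trmx (sum_thin_mx _ (\matrix_(i, j) Ordinal N0)).
  rewrite expr_le1 ?ler0n // (ler_nat _ _ 1%N) dvdn_leq //.
  apply: dvdn_trans (gcdv_dvdl _ _ ord0) _.
  by rewrite /minors det_mx00 mulr1 expr0.
set th := (1 + m%:R / N%:R) : R.
have th0 : 0 <= th by rewrite addr_ge0 ?divr_ge0 ?ler0n.
(* The coefficients 0 and 1 turn the relation of [pair_countl] into divisibility of the second minor
   by f. The weight f^2 then cancels the density 1 / (f f), so all divisors contribute the same
   bound. *)
pose P (Y : 'M['I_N]_(k.+1, k.+2)) f :=
  ((f%:Z %| 0 * minors (shift_mx T Y) ord0 + 1 * minors (shift_mx T Y) (lift ord0 ord0))%Z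
     && (f%:Z %| minors (shift_mx T Y) ord0)%Z).
apply: le_trans (_ : \sum_(Y : 'M['I_N]_(k.+1, k.+2)) \sum_(f <- divisors m)
    f%:R ^+ 2 * (P Y f : nat)%:R <= _).
  apply: ler_sum => Y _; apply: le_sum_divisors => //; first exact: gcdv_dvdr.
  by rewrite /P mul0r add0r mul1r !dvdzE /= !gcdv_dvdl.
rewrite exchange_big /=.
apply: le_trans (_ : \sum_(f <- divisors m)
   (4 ^+ n * th ^+ 2) * (peel_cost R N m n ^+ k * N%:R ^+ (k.+1 * k.+2)) <= _); last first.
  rewrite big_const_seq count_predT iter_addr addr0 -[X in X <= _]mulr_natl.
  by rewrite [peel_cost _ _ _ _ ^+ _.+1]exprS {2}/peel_cost -/th !mulrA.
rewrite !big_seq; apply: ler_sum => f; rewrite -dvdn_divisors // => fm.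
have f0 : (0 : R) < f%:R by rewrite ltr0n (dvdn_gt0 m0 fm).
rewrite -mulr_sumr.
have h := pair_countl R 0 T N0 m0 fm fm (oner_neq0 int).
apply: le_trans (ler_wpM2l (exprn_ge0 _ (ltW f0)) h) _.
rewrite sum_trmx.
under eq_bigr => U _ do rewrite shift_trmx trmxK.
set TU := (rsubmx _)^T.
set S := \sum_U _.
have hS : S <= peel_cost R N m n ^+ k * N%:R ^+ (k * k.+1) by apply: IHk; apply: ltnW.
rewrite -/th.
have -> : f%:R ^+ 2 * ((2 ^+ k.+1 * th * N%:R ^+ k.+1) ^+ 2 * (`|1|%N%:R / (f%:R * f%:R)) * S)
  = (4 ^+ k.+1 * th ^+ 2 * N%:R ^+ (k.+1 * 2)) * S.
  have -> : (4 : R) ^+ k.+1 = (2 ^+ k.+1) ^+ 2 by rewrite -exprM mulnC exprM; congr (_ ^+ _); ring.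
  rewrite (_ : `|1|%N = 1%N) // exprM; field.
  by rewrite gt_eqF.
have -> : (k.+1 * k.+2 = k.+1 * 2 + k * k.+1)%N by ring.
rewrite exprD.
have c0 : 0 <= 4 ^+ k.+1 * th ^+ 2 * N%:R ^+ (k.+1 * 2) :> R.
  by nonneg.
apply: le_trans (ler_wpM2l c0 hS) _.
have h4 : (4 : R) ^+ k.+1 <= 4 ^+ n by rewrite ler_eXn2l ?ltr1n.
have q0 : 0 <= peel_cost R N m n by rewrite /peel_cost; nonneg.
have D0 : 0 <= th ^+ 2 * N%:R ^+ (k.+1 * 2) * (peel_cost R N m n ^+ k * N%:R ^+ (k * k.+1)).
  by nonneg.
have := ler_wpM2r D0 h4; nra.
Qed.

Lemma congruence_count_row (R : realFieldType) N m k (w : 'I_k -> int) (t : 'rV[int]_k) :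
  (0 < N)%N -> (0 < m)%N ->
  \sum_(a : 'rV['I_N]_k) ((m%:Z %| \sum_j w j * (shift_mx t a) 0 j)%Z : nat)%:R
    <= (2 ^+ k * (1 + m%:R / N%:R)) * (N%:R ^+ k * ((gcdv w m)%:R / m%:R)) :> R.
Proof.
move=> N0 m0; apply: le_trans (congruence_count_theta R w 0 t^T N0 m0 (leqnn m)).
rewrite sum_trmx; apply: ler_sum => y _; rewrite add0r.
rewrite (eq_bigr (fun j => w j * shift_mx t^T y j 0)) // => j _.
by rewrite !shift_mxE !mxE.
Qed.

(** The top row a contributes gcd(minors, m) / m. The gcd is traded for divisors e of one chosen
    minor, and the relation together with that divisibility has density |q| / (e m), up to the costs
    of peeling. The e cancels, leaving L / m^2. *)
Lemma short_relation_count (R : realFieldType) N m L k (u v : int)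
    (t : 'rV[int]_k.+2) (T : 'M[int]_(k.+1, k.+2)) :
  (0 < N)%N -> (0 < m)%N -> (u != 0) || (v != 0) ->
  (`|u| <= L)%N -> (`|v| <= L)%N ->
  \sum_(B : 'M['I_N]_(k.+1, k.+2)) \sum_(a : 'rV['I_N]_k.+2)
    ((m%:Z %| u * minors (shift_mx T B) ord0 + v * minors (shift_mx T B) (lift ord0 ord0))%Z
     && (m%:Z %| \det (col_mx (shift_mx t a) (shift_mx T B) : 'M[_]_(k.+2)))%Z : nat)%:R
  <= 2 ^+ k.+2 * (1 + m%:R / N%:R) * peel_cost R N m k.+2 ^+ k.+1 * L%:R
      / m%:R ^+ 2 * N%:R ^+ (k.+2 ^ 2) :> R.
Proof.
move=> N0 m0 uv uL vL.
have N0' : (0 : R) < N%:R by rewrite ltr0n.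
have m0' : (0 : R) < m%:R by rewrite ltr0n.
set th := (1 + m%:R / N%:R) : R.
have th0 : 0 <= th by rewrite addr_ge0 ?divr_ge0 ?ler0n.
have q0 : 0 <= peel_cost R N m k.+2 by rewrite /peel_cost; nonneg.
pose E (B : 'M['I_N]_(k.+1, k.+2)) :=
  (m%:Z %| u * minors (shift_mx T B) ord0 + v * minors (shift_mx T B) (lift ord0 ord0))%Z.
(* The relation is solved for the minor with a nonzero coefficient; the divisor e is imposed on the
   other one. *)
pose i : 'I_k.+2 := if v != 0 then ord0 else lift ord0 ord0.
pose C := 2 ^+ k.+2 * th * N%:R ^+ k.+2 / m%:R : R.
have C0 : 0 <= C by nonneg.
pose X := C * (\sum_(e <- divisors m) 4 ^+ k.+2 * th ^+ 2 * N%:R ^+ (k.+1 * 2)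
    * (L%:R / m%:R) * (peel_cost R N m k.+2 ^+ k * N%:R ^+ (k * k.+1))) : R.
apply: (@le_trans _ _ X); last first.
  rewrite /X /C big_const_seq count_predT iter_addr addr0 -[X in _ * X <= _]mulr_natl.
  have -> : (k.+2 ^ 2 = k.+2 + k.+1 * 2 + k * k.+1)%N by ring.
  rewrite !exprD [peel_cost _ _ _ _ ^+ _.+1]exprS {2}/peel_cost -/th le_eqVlt; apply/orP; left; apply/eqP; field.
  by rewrite gt_eqF.
apply: le_trans (_ : \sum_B \sum_(e <- divisors m) C * (e%:R ^+ 1 *
    (E B && (e%:Z %| minors (shift_mx T B) i)%Z : nat)%:R) <= _).
  apply: ler_sum => B _; rewrite -/(E B).
  under eq_bigr => a _ do rewrite det_col_mx_minors.
  case: (E B); last first.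
    rewrite big1 // ; apply: sumr_ge0 => e _.
    by rewrite andFb mulr0 mulr0.
  under eq_bigr => a _ do rewrite andTb.
  apply: le_trans (congruence_count_row R (minors (shift_mx T B)) t N0 m0) _.
  set g := gcdv _ _.
  rewrite -mulr_sumr.
  apply: le_trans (_ : C * g%:R ^+ 1 <= _).
    by rewrite /C -/th expr1 le_eqVlt; apply/orP; left; apply/eqP; ring.
  rewrite ler_wpM2l //.
  apply: (@le_sum_divisors R m g 1 (fun e => true && (e%:Z %| minors (shift_mx T B) i)%Z)) => //.
    exact: gcdv_dvdr.
  by rewrite andTb dvdzE /= gcdv_dvdl.
rewrite exchange_big /X mulr_sumr /= !big_seq; apply: ler_sum => e.
rewrite -dvdn_divisors // => em.
have e0 : (0 : R) < e%:R by rewrite ltr0n (dvdn_gt0 m0 em).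
rewrite -mulr_sumr ler_wpM2l // -mulr_sumr expr1.
set Q := peel_cost R N m k.+2.
pose bound (q : int) : R :=
  (2 ^+ k.+1 * (1 + m%:R / N%:R) * N%:R ^+ k.+1) ^+ 2 * (`|q|%N%:R / (e%:R * m%:R))
  * \sum_(U : 'M['I_N]_(k.+1, k))
    (gcdv (minors (shift_mx (@rsubmx _ k.+1 1 k (@rsubmx _ k.+1 1 k.+1 T)) U)^T) m)%:R ^+ 2.
have [q qL hq] : exists2 q : int, (`|q| <= L)%N &
    \sum_B (E B && (e%:Z %| minors (shift_mx T B) i)%Z : nat)%:R <= bound q.
  rewrite /i; case: ifPn => [v0|]; first by exists v => //; apply: pair_countl.
  rewrite negbK => /eqP v0; move: uv; rewrite v0 eqxx orbF => u0.
  by exists u => //; apply: pair_countr.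
apply: le_trans (ler_wpM2l (ltW e0) hq) _.
rewrite /bound sum_trmx -/th.
under eq_bigr => U _ do rewrite shift_trmx trmxK.
set TU := (rsubmx _)^T.
set S := \sum_U _.
have hS : S <= Q ^+ k * N%:R ^+ (k * k.+1).
  by apply: minors_gcd_sum => //; apply: leqW; apply: leqW.
have -> : e%:R * ((2 ^+ k.+1 * th * N%:R ^+ k.+1) ^+ 2 * (`|q|%N%:R / (e%:R * m%:R)) * S)
  = (4 ^+ k.+1 * th ^+ 2 * N%:R ^+ (k.+1 * 2)) * (`|q|%N%:R / m%:R) * S.
  have -> : (4 : R) ^+ k.+1 = (2 ^+ k.+1) ^+ 2 by rewrite -exprM mulnC exprM; congr (_ ^+ _); ring.
  rewrite exprM; field.
  by rewrite !gt_eqF.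
have qL' : `|q|%N%:R / m%:R <= L%:R / m%:R :> R by rewrite ler_wpM2r ?invr_ge0 ?ler0n // ler_nat.
apply: ler_pM; [by nonneg | by apply: sumr_ge0 => U _; rewrite exprn_ge0 ?ler0n | | exact: hS].
apply: ler_pM; [by nonneg | by nonneg | | exact: qL'].
apply: ler_wpM2r; first by nonneg.
apply: ler_wpM2r; first by nonneg.
by rewrite ler_eXn2l ?ltr1n.
Qed.

(** * Plane lattices *)

(* The lattice [m | al p + be q] has covering radius at most [R] in the sup norm. *)
Definition plane_cover (al be : int) (m R : nat) : Prop :=
  forall x y : int, exists p q : int,
    [/\ (m%:Z %| al * p + be * q)%Z, (`|x - p| <= R)%N & (`|y - q| <= R)%N].

Lemma plane_cover_mod al be m : (0 < m)%N -> plane_cover al be m m.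
Proof.
move=> m0 x y; exists ((x %/ m%:Z)%Z * m%:Z), ((y %/ m%:Z)%Z * m%:Z).
have m0' : (m%:Z != 0) by rewrite -lt0n.
split; first by rewrite !mulrA -mulrDl dvdz_mull.
  have := divz_eq x m%:Z; have := modz_ge0 x m0'; have := ltz_mod x m0'.
  by move: (x %% m)%Z (x %/ m)%Z => r a; lia.
have := divz_eq y m%:Z; have := modz_ge0 y m0'; have := ltz_mod y m0'.
by move: (y %% m)%Z (y %/ m)%Z => r a; lia.
Qed.

Lemma thue_pigeonhole (al be : int) m M L : (0 < m)%N -> (m < M.+1 * L.+1)%N ->
  exists u v : int, [/\ (u != 0) || (v != 0), (`|u| <= M)%N, (`|v| <= L)%N
                      & (m%:Z %| u * al + v * be)%Z].
Proof.
case: m => // m _ mML.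
pose g (p : 'I_M.+1 * 'I_L.+1) : int := p.1%:Z * al + p.2%:Z * be.
pose f (p : 'I_M.+1 * 'I_L.+1) : 'I_m.+1 := inord `|(g p %% m.+1%:Z)%Z|%N.
have ninj : ~ injective f.
  by move=> /leq_card; rewrite card_prod !card_ord leqNgt mML.
have /injectivePn[p [q pq fpq]] : ~~ injectiveb f by apply/injectiveP.
have m0 : m.+1%:Z != 0 :> int by [].
have : (m.+1%:Z %| g p - g q)%Z.
  rewrite -eqz_mod_dvd; apply/eqP; move/(congr1 val): fpq => /=.
  have gl (r : 'I_M.+1 * 'I_L.+1) : (`|(g r %% m.+1%:Z)%Z| < m.+1)%N.
    by have := modz_ge0 (g r) m0; have := ltz_mod (g r) m0; lia.
  rewrite !inordK // => h.
  by have := modz_ge0 (g p) m0; have := modz_ge0 (g q) m0; lia.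
move=> dv; exists (p.1%:Z - q.1%:Z), (p.2%:Z - q.2%:Z); split.
- rewrite !subr_eq0 !eqz_nat -negb_and; apply: contra pq => /andP[/eqP e1 /eqP e2].
  by apply/eqP; case: p q e1 e2 {fpq dv} => p1 p2 [q1 q2] /= /val_inj-> /val_inj->.
- by have := ltn_ord p.1; have := ltn_ord q.1; lia.
- by have := ltn_ord p.2; have := ltn_ord q.2; lia.
- by move: dv; rewrite /g; congr (_ %| _)%Z; ring.
Qed.

(* Two boxes of sides [M, L] and [L, M] give lattice vectors [(k, l)] and [(k', l')];
   without short vectors [|k| > L >= |l|] and [|l'| > L >= |k'|], so they are independent. *)
Lemma plane_cover_short al be m L M : (0 < m)%N -> (m < M.+1 * L.+1)%N ->
  (forall u v : int, (u != 0) || (v != 0) -> (`|u| <= L)%N -> (`|v| <= L)%N ->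
     ~~ (m%:Z %| u * al + v * be)%Z) ->
  plane_cover al be m (M + L).
Proof.
move=> m0 mML noshort x y.
have [k [l [kl kM lL dkl]]] := thue_pigeonhole al be m0 mML.
have mLM : (m < L.+1 * M.+1)%N by rewrite mulnC.
have [k' [l' [kl' kL' lM' dkl']]] := thue_pigeonhole al be m0 mLM.
have kL : (L < `|k|)%N.
  by rewrite ltnNge; apply/negP => kL; have := noshort _ _ kl kL lL; rewrite dkl.
have lL' : (L < `|l'|)%N.
  by rewrite ltnNge; apply/negP => h; have := noshort _ _ kl' kL' h; rewrite dkl'.
pose D := k * l' - l * k'.
have D0 : D != 0.
  rewrite subr_eq0; apply/eqP => /(congr1 absz); rewrite !abszM => e.
  have : (`|l| * `|k'| <= L * L)%N by rewrite leq_mul.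
  have : (L * L < `|k| * `|l'|)%N by rewrite ltn_mul.
  by rewrite e; lia.
(* Cramer's rule with rounding: the integer parts of the coordinates of (x, y) in the basis (k, l),
   (k', l'). The remainders lie in [0, |D|), so the error is at most |k| + |k'|, respectively |l| +
   |l'|, hence at most M + L. *)
pose a := ((x * l' - y * k') %/ D)%Z; pose b := ((k * y - l * x) %/ D)%Z.
have ea := divz_eq (x * l' - y * k') D; have eb := divz_eq (k * y - l * x) D.
have r1 := modz_ge0 (x * l' - y * k') D0; have r1' := ltz_mod (x * l' - y * k') D0.
have r2 := modz_ge0 (k * y - l * x) D0; have r2' := ltz_mod (k * y - l * x) D0.
rewrite -/a -/b in ea eb.
set s1 := ((x * l' - y * k') %% D)%Z in ea r1 r1'.
set s2 := ((k * y - l * x) %% D)%Z in eb r2 r2'.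
exists (a * k + b * k'), (a * l + b * l'); split.
- have -> : al * (a * k + b * k') + be * (a * l + b * l')
    = a * (k * al + l * be) + b * (k' * al + l' * be) by ring.
  by rewrite rpredD // dvdz_mull.
- have e : D * (x - (a * k + b * k')) = s1 * k + s2 * k'.
    have -> : s1 = (x * l' - y * k') - a * D by rewrite ea; ring.
    have -> : s2 = (k * y - l * x) - b * D by rewrite eb; ring.
    by rewrite /D; ring.
  rewrite -lez_nat -(ler_pM2l (_ : 0 < `|D|)) ?normr_gt0 // abszE -normrM e.
  apply: le_trans (ler_normD _ _) _; rewrite !normrM (ger0_norm r1) (ger0_norm r2).
  rewrite PoszD mulrDr; apply: lerD; apply: ler_pM => //; try exact: ltW.
- have e : D * (y - (a * l + b * l')) = s1 * l + s2 * l'.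
    have -> : s1 = (x * l' - y * k') - a * D by rewrite ea; ring.
    have -> : s2 = (k * y - l * x) - b * D by rewrite eb; ring.
    by rewrite /D; ring.
  rewrite -lez_nat -(ler_pM2l (_ : 0 < `|D|)) ?normr_gt0 // abszE -normrM e.
  apply: le_trans (ler_normD _ _) _; rewrite !normrM (ger0_norm r1) (ger0_norm r2).
  rewrite addnC PoszD mulrDr; apply: lerD; apply: ler_pM => //; try exact: ltW.
Qed.

Definition plane_count (N m : nat) (al be ga t0 t1 : int) : nat :=
  (\sum_(x < N) \sum_(y < N) (m%:Z %| (al * (x%:Z + t0) + be * (y%:Z + t1) + ga)%R)%Z)%N.

Lemma leq_sum_shift (F : nat -> nat) N d K : (N + d <= K)%N ->
  (\sum_(x < N) F (x + d) <= \sum_(x < K) F x)%N.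
Proof.
move=> NdK; rewrite -(big_mkord xpredT F) (@big_cat_nat _ _ _ (N + d)%N) //=.
rewrite (@big_cat_nat _ _ _ d 0%N (N + d)%N) ?leq_addl //= -(big_mkord xpredT (fun x => F (x + d)%N)).
have := big_addn 0 (N + d) d xpredT F; rewrite add0n addnK => ->.
by rewrite -addnA addnCA leq_addr.
Qed.

Lemma plane_count_cover N m al be ga R s0 s1 t0 t1 : plane_cover al be m R ->
  (plane_count N m al be ga t0 t1 <= plane_count (N + 2 * R) m al be ga s0 s1)%N.
Proof.
(* The extra R places the displacements p + t0 - s0 and q + t1 - s1 in [0, 2R]: translating by the
   lattice vector (p, q) carries one box into the other, enlarged by 2R. *)
move=> cov; have [p [q [dpq hp hq]]] := cov (s0 - t0 + R%:Z) (s1 - t1 + R%:Z).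
pose d0 := absz (p + t0 - s0)%R; pose d1 := absz (q + t1 - s1)%R.
have e0 : p + t0 - s0 = d0%:Z by rewrite /d0; lia.
have e1 : q + t1 - s1 = d1%:Z by rewrite /d1; lia.
have d0R : (d0 <= 2 * R)%N by lia.
have d1R : (d1 <= 2 * R)%N by lia.
pose F x y : nat := (m%:Z %| al * (x%:Z + s0) + be * (y%:Z + s1) + ga)%Z.
have -> : plane_count N m al be ga t0 t1 = (\sum_(x < N) \sum_(y < N) F (x + d0) (y + d1))%N.
  apply: eq_bigr => x _; apply: eq_bigr => y _; rewrite /F; congr (nat_of_bool _).
  have -> : al * ((x + d0)%N%:Z + s0) + be * ((y + d1)%N%:Z + s1) + ga
    = (al * p + be * q) + (al * (x%:Z + t0) + be * (y%:Z + t1) + ga).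
    by rewrite !PoszD -e0 -e1; ring.
  by rewrite [in RHS]rpredDl.
apply: leq_trans (leq_sum_shift (fun x => \sum_(y < N + 2 * R) F x y)%N (_ : N + d0 <= _)%N).
  by apply: leq_sum => x _; apply: leq_sum_shift; rewrite leq_add2l.
by rewrite leq_add2l.
Qed.

Lemma sum_periodic (F : nat -> nat) m x : (forall s, F (s + m)%N = F s) ->
  (\sum_(s < m) F (s + x) = \sum_(s < m) F s)%N.
Proof.
move=> per; elim: x => [|x IHx]; first by apply: eq_bigr => s _; rewrite addn0.
rewrite -IHx; case: m per {IHx} => [|m] per; first by rewrite !big_ord0.
rewrite big_ord_recr [in RHS]big_ord_recl /= addnC add0n; congr (_ + _)%N.
  by rewrite addnS -addSn addnC per.
by apply: eq_bigr => s _; rewrite /bump /= add1n addSnnS.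
Qed.

(** For each fixed (x, y), the offsets modulo m run once through a full period, so each of the N^2
    points sees the same count. *)
Lemma plane_count_average N m al be ga :
  (\sum_(s0 < m) \sum_(s1 < m) plane_count N m al be ga s0 s1
    = N ^ 2 * plane_count m m al be ga 0 0)%N.
Proof.
pose F x y : nat := (m%:Z %| al * x%:Z + be * y%:Z + ga)%Z.
have perx y s : F (s + m)%N y = F s y.
  rewrite /F; congr (nat_of_bool _).
  have -> : al * (s + m)%N%:Z + be * y%:Z + ga = al * m%:Z + (al * s%:Z + be * y%:Z + ga).
    by rewrite PoszD; ring.
  by rewrite rpredDl // dvdz_mull.
have pery x s : F x (s + m)%N = F x s.
  rewrite /F; congr (nat_of_bool _).
  have -> : al * x%:Z + be * (s + m)%N%:Z + ga = be * m%:Z + (al * x%:Z + be * s%:Z + ga).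
    by rewrite PoszD; ring.
  by rewrite rpredDl // dvdz_mull.
have -> : plane_count m m al be ga 0 0 = (\sum_(x < m) \sum_(y < m) F x y)%N.
  by apply: eq_bigr => x _; apply: eq_bigr => y _; rewrite /F !addr0.
transitivity (\sum_(x < N) \sum_(y < N) \sum_(s0 < m) \sum_(s1 < m) F (s0 + x) (s1 + y))%N.
  under eq_bigr => s0 _ do rewrite exchange_big /=.
  rewrite exchange_big /=; apply: eq_bigr => x _.
  under eq_bigr => s0 _ do rewrite exchange_big /=.
  rewrite exchange_big /=; apply: eq_bigr => y _.
  apply: eq_bigr => s0 _; apply: eq_bigr => s1 _.
  by rewrite /F !PoszD [s0%:Z + _]addrC [s1%:Z + _]addrC.
have cst x y : (\sum_(s0 < m) \sum_(s1 < m) F (s0 + x) (s1 + y)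
    = \sum_(s0 < m) \sum_(s1 < m) F s0 s1)%N.
  under eq_bigr => s0 _ do rewrite (sum_periodic y (pery _)).
  by rewrite (@sum_periodic (fun s => \sum_(s1 < m) F s s1)%N m x) // => s; apply: eq_bigr.
under eq_bigr => x _ do under eq_bigr => y _ do rewrite cst.
by rewrite !big_const_ord !iter_addn_0 -mulnA mulnC -mulnn.
Qed.

(* Both sides are compared with the total over all offsets modulo [m]. *)
Lemma plane_count_compare N m al be ga R s0 s1 t0 t1 : (0 < m)%N ->
  plane_cover al be m R -> (2 * R <= N)%N ->
  ((N - 2 * R) ^ 2 * plane_count N m al be ga t0 t1
    <= (N + 2 * R) ^ 2 * plane_count N m al be ga s0 s1)%N.
Proof.
move=> m0 cov RN; set D := plane_count m m al be ga 0 0.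
have cst c : (m * c = \sum_(i < m) c)%N by rewrite sum_nat_const card_ord.
have h1 : (m ^ 2 * plane_count N m al be ga t0 t1 <= (N + 2 * R) ^ 2 * D)%N.
  rewrite -plane_count_average -mulnn -mulnA.
  rewrite [leqLHS]cst; apply: leq_sum => i _.
  rewrite [leqLHS]cst; apply: leq_sum => j _.
  exact: plane_count_cover.
have h2 : ((N - 2 * R) ^ 2 * D <= m ^ 2 * plane_count N m al be ga s0 s1)%N.
  rewrite -plane_count_average -mulnn -mulnA.
  rewrite [leqRHS]cst; apply: leq_sum => i _.
  rewrite [leqRHS]cst; apply: leq_sum => j _.
  have := @plane_count_cover (N - 2 * R)%N m al be ga R s0 s1 i j cov.
  by rewrite subnK.
rewrite -(@leq_pmul2l (m ^ 2)) ?expn_gt0 ?m0 //.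
rewrite mulnCA (leq_trans (leq_mul (leqnn _) h1)) //.
by rewrite [leqRHS]mulnCA mulnCA leq_mul.
Qed.

(** * Comparing translated boxes *)

Definition det_count (N m n : nat) (T : 'M[int]_n) : nat :=
  (\sum_(X : 'M['I_N]_n) (m%:Z %| \det (shift_mx T X))%Z)%N.

Definition row_count (N m n : nat) (t : 'rV[int]_n.+1) (Y : 'M[int]_(n, n.+1)) : nat :=
  (\sum_(a : 'rV['I_N]_n.+1) (m%:Z %| \det (col_mx (shift_mx t a) Y : 'M[_]_(n.+1)))%Z)%N.

Lemma det_count_rows N m n (T : 'M[int]_n.+1) :
  det_count N m T = (\sum_(B : 'M['I_N]_(n, n.+1))
    row_count N m (@usubmx _ 1 n n.+1 T) (shift_mx (@dsubmx _ 1 n n.+1 T) B))%N.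
Proof.
rewrite /det_count (@sum_col_mx _ _ 1 n n.+1) exchange_big /=.
apply: eq_bigr => B _; apply: eq_bigr => a _.
by rewrite (@shift_col_mx _ 1 n n.+1).
Qed.

Lemma row_count_planes N m k (t : 'rV[int]_k.+2) (Y : 'M[int]_(k.+1, k.+2)) :
  row_count N m t Y = (\sum_(a : 'rV['I_N]_k)
    plane_count N m (minors Y ord0) (minors Y (lift ord0 ord0))
      (\sum_(j < k) minors Y (lift ord0 (lift ord0 j))
         * ((a 0%R j : nat)%:Z + t 0%R (lift ord0 (lift ord0 j))))%R
      (t 0%R ord0) (t 0%R (lift ord0 ord0)))%N.
Proof.
rewrite /row_count (@sum_row_mx _ _ 1 1 k.+1) sum_mx11.
under eq_bigr => x _ do rewrite (@sum_row_mx _ _ 1 1 k) sum_mx11.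
rewrite [RHS]exchange_big; apply: eq_bigr => x _ /=.
rewrite [RHS]exchange_big; apply: eq_bigr => y _ /=.
apply: eq_bigr => a _; rewrite det_col_mx_minors; congr (nat_of_bool (_ %| _)%Z).
rewrite !big_ord_recl addrA !shift_mxE row_mx_constS !row_mx_const0; congr (_ + _).
by apply: eq_bigr => j _; rewrite shift_mxE !row_mx_constS.
Qed.

Lemma row_count_compare N m k R (t t' : 'rV[int]_k.+2) (Y : 'M[int]_(k.+1, k.+2)) :
  (0 < m)%N -> (2 * R <= N)%N ->
  plane_cover (minors Y ord0) (minors Y (lift ord0 ord0)) m R ->
  (forall j, j != ord0 -> t 0 j = t' 0 j) ->
  ((N - 2 * R) ^ 2 * row_count N m t Y <= (N + 2 * R) ^ 2 * row_count N m t' Y)%N.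
Proof.
move=> m0 RN cov tt'; rewrite !row_count_planes !big_distrr /=.
apply: leq_sum => a _; apply: leq_trans (plane_count_compare _ _ _ _ _ m0 cov RN) _.
rewrite leq_mul2l; apply/orP; right; apply: eq_leq.
by congr plane_count; apply: eq_bigr => j _; rewrite tt'.
Qed.

Lemma dvdz_det_row_col_perm (m : nat) n (s u : 'S_n) (A : 'M[int]_n) :
  (m%:Z %| \det (row_perm s (col_perm u A)))%Z = (m%:Z %| \det A)%Z.
Proof.
rewrite row_permE col_permE !det_mulmx !det_perm.
by rewrite !dvdzE abszMsign mulrC abszMsign.
Qed.

Lemma det_count_perm N m n (s u : 'S_n) (T : 'M[int]_n) :
  det_count N m (row_perm s (col_perm u T)) = det_count N m T.
Proof.
rewrite /det_count (reindex (fun X : 'M['I_N]_n => row_perm s (col_perm u X))) /=.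
  apply: eq_bigr => X _; rewrite -(dvdz_det_row_col_perm m s u (shift_mx T X)).
  congr (nat_of_bool (_ %| \det _)%Z).
  by apply/matrixP => i j; rewrite !mxE.
exists (fun X => row_perm s^-1 (col_perm u^-1 X)) => X _;
  by apply/matrixP => i j; rewrite !mxE ?permK ?permKV.
Qed.

Section Step.
Variables (F : realFieldType) (N m R k : nat) (bad : pred 'M[int]_(k.+1, k.+2)) (beta : F).
Hypotheses (m0 : (0 < m)%N) (RN : (2 * R < N)%N) (beta0 : 0 <= beta).
Hypothesis good_cover : forall Y, ~~ bad Y ->
  plane_cover (minors Y ord0) (minors Y (lift ord0 ord0)) m R.
Hypothesis bad_count : forall (t : 'rV[int]_k.+2) (T : 'M[int]_(k.+1, k.+2)),
  \sum_(B : 'M['I_N]_(k.+1, k.+2)) \sum_(a : 'rV['I_N]_k.+2)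
    (bad (shift_mx T B)
     && (m%:Z %| \det (col_mx (shift_mx t a) (shift_mx T B) : 'M[_]_(k.+2)))%Z : nat)%:R <= beta.

Let kappa : F := ((N + 2 * R)%:R / (N - 2 * R)%:R) ^+ 2.

(** Only the corner offset changes, so both counts run over the same lower blocks B. Good blocks are
    compared row by row; bad ones cost at most [beta] altogether. *)
Lemma det_count_step00 (T T' : 'M[int]_k.+2) :
  (forall i j, (i, j) != (ord0, ord0) -> T i j = T' i j) ->
  (det_count N m T)%:R <= kappa * (det_count N m T')%:R + beta :> F.
Proof.
move=> TT'; rewrite !det_count_rows.
set t := @usubmx _ 1 k.+1 k.+2 T; set t' := @usubmx _ 1 k.+1 k.+2 T'.
set TB := @dsubmx _ 1 k.+1 k.+2 T.
have -> : @dsubmx _ 1 k.+1 k.+2 T' = TB.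
  by apply/matrixP => i j; rewrite !mxE TT'.
have tt' j : j != ord0 -> t 0 j = t' 0 j.
  by move=> j0; rewrite !mxE TT' //; apply: contra j0 => /eqP[_ ->].
rewrite !natr_sum mulr_sumr.
apply: le_trans (_ : \sum_(B : 'M['I_N]_(k.+1, k.+2))
   (kappa * (row_count N m t' (shift_mx TB B))%:R + \sum_(a : 'rV['I_N]_k.+2)
    (bad (shift_mx TB B)
     && (m%:Z %| \det (col_mx (shift_mx t a) (shift_mx TB B) : 'M[_]_(k.+2)))%Z : nat)%:R) <= _).
  apply: ler_sum => B _; set Y := shift_mx TB B.
  have [bY|gY] := boolP (bad Y).
    rewrite -[leLHS]add0r lerD //.
      by rewrite mulr_ge0 ?ler0n // exprn_ge0 // divr_ge0 ?ler0n.
    by rewrite /row_count natr_sum; apply: ler_sum => a _.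
  rewrite big1 // addr0 /kappa expr_div_n mulrAC ler_pdivlMr ?exprn_gt0 ?ltr0n ?subn_gt0 //.
  rewrite mulrC -!natrX -!natrM ler_nat.
  by apply: row_count_compare => //; [exact: ltnW | exact: good_cover].
by rewrite big_split /= lerD2l; apply: bad_count.
Qed.

Lemma det_count_step (i0 j0 : 'I_k.+2) (T T' : 'M[int]_k.+2) :
  (forall i j, (i, j) != (i0, j0) -> T i j = T' i j) ->
  (det_count N m T)%:R <= kappa * (det_count N m T')%:R + beta :> F.
Proof.
move=> TT'; pose s := tperm i0 ord0; pose u := tperm j0 ord0.
rewrite -(det_count_perm N m s u T) -(det_count_perm N m s u T').
apply: det_count_step00 => i j ij; rewrite !mxE; apply: TT'.
apply: contra ij => /eqP[/(canRL (permK _)) + /(canRL (permK _))].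
by rewrite !tpermV !tpermL => -> ->.
Qed.

(* [T] is turned into [T'] one entry at a time, each entry being moved to the corner by
   row and column permutations. *)
Lemma det_count_compare (T T' : 'M[int]_k.+2) :
  (det_count N m T)%:R <= kappa ^+ (k.+2 ^ 2) * ((det_count N m T')%:R + (k.+2 ^ 2)%:R * beta) :> F.
Proof.
have k1 : 1 <= kappa.
  rewrite exprn_ege1 // ler_pdivlMr ?mul1r ?ltr0n ?subn_gt0 // ler_nat.
  by rewrite leq_subLR addnCA leq_addr.
pose upd (s : seq ('I_k.+2 * 'I_k.+2)) T0 : 'M[int]_k.+2 :=
  \matrix_(i, j) if (i, j) \in s then T' i j else T0 i j.
suff main s T0 : (det_count N m T0)%:R
    <= kappa ^+ (size s) * ((det_count N m (upd s T0))%:R + (size s)%:R * beta) :> F.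
  have := main (enum [set: 'I_k.+2 * 'I_k.+2]) T.
  rewrite -cardE cardsT card_prod !card_ord mulnn.
  congr (_ <= _ * ((det_count _ _ _)%:R + _)).
  by apply/matrixP => i j; rewrite !mxE mem_enum inE.
elim: s T0 => [|[i0 j0] s IHs] T0 /=.
  rewrite expr0 mul1r mul0r addr0 (_ : upd _ _ = T0) //.
  by apply/matrixP => i j; rewrite !mxE.
pose T1 := upd [:: (i0, j0)] T0.
have -> : upd ((i0, j0) :: s) T0 = upd s T1.
  apply/matrixP => i j; rewrite !mxE !inE.
  by case: ((i, j) == _); case: (_ \in s).
have h01 : (det_count N m T0)%:R <= kappa * (det_count N m T1)%:R + beta :> F.
  apply: (det_count_step (i0 := i0) (j0 := j0)) => i j ij.
  by rewrite !mxE inE (negPf ij).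
apply: le_trans h01 _; have h := IHs T1.
set D := (det_count N m (upd s T1))%:R in h *.
have ks : 1 <= kappa ^+ (size s).+1 by rewrite exprn_ege1.
apply: le_trans (_ : kappa * (kappa ^+ size s * (D + (size s)%:R * beta)) + kappa ^+ (size s).+1 * beta <= _).
  by apply: lerD; [rewrite ler_wpM2l // (le_trans ler01) | rewrite ler_peMl].
by rewrite -natr1 exprS le_eqVlt; apply/orP; left; apply/eqP; ring.
Qed.
End Step.

Lemma dvdz_det_congr (m : int) n (A B : 'M[int]_n) :
  (forall i j, (m %| A i j - B i j)%Z) -> (m %| \det A - \det B)%Z.
Proof.
move=> AB; rewrite /determinant -sumrB; apply: rpred_sum => s _.
rewrite -mulrBr; apply: dvdz_mull.
elim/big_rec2: _ => [|i x y _ IH]; first by rewrite subrr dvdz0.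
have -> : A i (s i) * y - B i (s i) * x
  = A i (s i) * (y - x) + (A i (s i) - B i (s i)) * x by ring.
by apply: rpredD; [apply: dvdz_mull | apply: dvdz_mulr; apply: AB].
Qed.

Definition nat_mx (m a b : nat) (T : 'M['I_m]_(a, b)) : 'M[int]_(a, b) :=
  map_mx (fun x : 'I_m => (x : nat)%:Z) T.

Definition residue_det_count (m n : nat) : nat :=
  (\sum_(T : 'M['I_m]_n) (m%:Z %| \det (nat_mx T))%Z)%N.

(** For fixed X, adding X modulo m permutes the residue matrices, and divisibility of the
    determinant depends only on residues. *)
Lemma det_count_average N m n : (0 < m)%N ->
  (\sum_(T : 'M['I_m]_n) det_count N m (nat_mx T) = N ^ (n ^ 2) * residue_det_count m n)%N.
Proof.
case: m => // m _.
rewrite exchange_big /=.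
have card_mx : (\sum_(X : 'M['I_N]_n) 1 = N ^ (n ^ 2))%N.
  by rewrite sum1_card card_mx card_ord mulnn.
rewrite -card_mx big_distrl /=; apply: eq_bigr => X _; rewrite mul1n.
pose tr (T : 'M['I_m.+1]_n) : 'M['I_m.+1]_n := \matrix_(i, j) inord ((X i j + T i j) %% m.+1).
have tr_inj : injective tr.
  move=> T T' /matrixP h; apply/matrixP => i j; move: (h i j); rewrite !mxE => /(congr1 val).
  rewrite /= !inordK ?ltn_pmod // => /eqP; rewrite eqn_modDl !modn_small // => /eqP.
  exact: val_inj.
rewrite /residue_det_count [RHS](reindex_inj tr_inj) /=; apply: eq_bigr => T _; congr nat_of_bool.
have : (m.+1%:Z %| \det (shift_mx (nat_mx T) X) - \det (nat_mx (tr T)))%Z.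
  apply: dvdz_det_congr => i j; rewrite !mxE inordK ?ltn_pmod //.
  by rewrite -eqz_mod_dvd -modz_nat -PoszD modz_mod.
by move=> dv; have := rpredDl (\det (nat_mx (tr T))) dv; rewrite subrK.
Qed.

(** * Local densities *)

(** The Chinese remainder theorem, applied to each entry. *)
Lemma residue_det_countM a b n : (0 < a)%N -> (0 < b)%N -> coprime a b ->
  residue_det_count (a * b) n = (residue_det_count a n * residue_det_count b n)%N.
Proof.
case: a => // a _; case: b => // b _ cab.
pose f (T : 'M['I_(a.+1 * b.+1)]_n) : 'M['I_a.+1]_n * 'M['I_b.+1]_n :=
  (\matrix_(i, j) inord (T i j %% a.+1), \matrix_(i, j) inord (T i j %% b.+1)).
have f_inj : injective f.
  move=> T T' [/matrixP h1 /matrixP h2]; apply/matrixP => i j.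
  move: (h1 i j) (h2 i j); rewrite !mxE => /(congr1 val) /= + /(congr1 val) /=.
  rewrite !inordK ?ltn_pmod // => /eqP e1 /eqP e2; apply: val_inj => /=.
  rewrite -(modn_small (ltn_ord (T i j))) -(modn_small (ltn_ord (T' i j))).
  by apply/eqP; rewrite chinese_remainder // e1.
have f_bij : bijective f.
  apply: inj_card_bij f_inj _; rewrite card_prod !card_mx !card_ord.
  by rewrite expnMn.
rewrite /residue_det_count big_distrl /=.
under [in RHS]eq_bigr => T _ do rewrite big_distrr /=.
rewrite pair_bigA (reindex f); last exact: onW_bij.
apply: eq_bigr => T _.
have reduce c (g : 'M['I_c.+1]_n) : (forall i j, (g i j : nat) = (T i j %% c.+1)%N) ->
    (c.+1%:Z %| \det (nat_mx g))%Z = (c.+1%:Z %| \det (nat_mx T))%Z.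
  move=> hg; have dv : (c.+1%:Z %| \det (nat_mx g) - \det (nat_mx T))%Z.
    apply: dvdz_det_congr => i j; rewrite !mxE hg.
    by rewrite -eqz_mod_dvd -!modz_nat modz_mod.
  by have := rpredDl (\det (nat_mx T)) dv; rewrite subrK.
rewrite (reduce a (f T).1) => [|i j]; last by rewrite mxE inordK ?ltn_pmod.
rewrite (reduce b (f T).2) => [|i j]; last by rewrite mxE inordK ?ltn_pmod.
by rewrite mulnb !dvdzE !absz_nat Gauss_dvd.
Qed.

(** * Determinants over a finite ring resembling Z/p^2 *)

Section LocalRing.
Variables (A : finComUnitRingType).

Lemma sum_matrix_translate n1 n2 (S : nmodType) (M : 'M[A]_(n1, n2)) (F : 'M[A]_(n1, n2) -> S) :
  \sum_X F (X - M) = \sum_X F X.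
Proof. by rewrite [RHS](reindex_inj (addIr (- M))). Qed.

(** A row swap brings the unit to the top. Elimination then replaces B by its Schur complement, a
    translate of B for each fixed top row, so all #|A|^n top rows give the same count. *)
Lemma unimodular_column_count (E : pred A) n (v : 'cV[A]_n.+1) i :
  (forall c x, c \is a GRing.unit -> E (c * x) = E x) -> v i 0 \is a GRing.unit ->
  (\sum_(B : 'M[A]_(n.+1, n)) E (\det (row_mx v B : 'M[_]_(n.+1)))
    = #|A| ^ n * \sum_(B : 'M[A]_n) E (\det B))%N.
Proof.
move=> Einv vi.
wlog i0 : i v vi / i = ord0.
  move=> wl; pose s := tperm i ord0.
  rewrite -(wl ord0 (row_perm s v)) //; last by rewrite mxE tpermR.
  rewrite (reindex (row_perm s)) /=; last first.
    by exists (row_perm s) => B _; rewrite -row_permM tperm2 row_perm1.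
  apply: eq_bigr => B _.
  have -> : row_mx v (row_perm s B) = row_perm s (row_mx (row_perm s v) B : 'M[_]_(n.+1)).
    apply/matrixP => k l; rewrite !mxE; case: splitP => l' _; rewrite !mxE //.
    by rewrite tpermK.
  by rewrite row_permE det_mulmx det_perm Einv // unitrX // unitrN1.
rewrite {}i0 {i} in vi.
rewrite (@sum_col_mx _ _ 1 n n) /=.
have -> : (#|A| ^ n = \sum_(a : 'rV[A]_n) 1)%N by rewrite sum1_card card_mx mul1n.
rewrite big_distrl /=; apply: eq_bigr => a _; rewrite mul1n.
pose v0 := v ord0 0; pose w := @dsubmx _ 1 n 1 v.
rewrite -[RHS](sum_matrix_translate (w *m (v0^-1 *: a))).
apply: eq_bigr => B _; congr nat_of_bool.
set D := (X in E X = _).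
have -> : D = \det (block_mx (v0%:M : 'M[_]_1) a w B).
  have vE : v = col_mx (v0%:M : 'M[_]_1) w :> 'M[_]_(1 + n, 1).
    rewrite -[LHS](@vsubmxK _ 1 n 1 v) -/w; congr col_mx.
    apply/matrixP => k l; rewrite !mxE !ord1 eqxx mulr1n /v0; congr (v _ _).
    exact: val_inj.
  by rewrite /D block_mxEh; congr (\det (@row_mx _ n.+1 1 n _ _)).
have -> : block_mx (v0%:M : 'M[_]_1) a w B =
    block_mx (1%:M : 'M[_]_1) 0 (v0^-1 *: w) 1%:M *m block_mx (v0%:M : 'M[_]_1) a 0 (B - w *m (v0^-1 *: a)).
  rewrite mulmx_block !mul1mx !mul0mx !addr0 !mul_mx_scalar scalerA divrr // scale1r.
  by rewrite -scalemxAl -scalemxAr addrCA subrr addr0.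
by rewrite det_mulmx det_lblock det_ublock !det1 !mul1r det_scalar1 Einv.
Qed.

(** These hypotheses abstract Z/p^2, with [pi] in the role of p: the annihilator of [pi] is the
    ideal it generates, which consists of the nonunits. *)
Variables (pi : A).
Hypothesis pi_nonunit : pi \isn't a GRing.unit.
Hypothesis unitE : forall x : A, (x \is a GRing.unit) = (pi * x != 0).
Hypothesis nonunit_mul : forall x : A, x \isn't a GRing.unit -> exists y, x = pi * y.

Definition nonunit_col n : pred 'cV[A]_n := fun v => [forall i, v i 0 \isn't a GRing.unit].
Definition nonunit_cols n : nat := #|@nonunit_col n|.

Lemma nonunit_colE n (v : 'cV[A]_n) : nonunit_col v = (pi *: v == 0).
Proof.
apply/forallP/eqP => [h|/matrixP h i].
  by apply/matrixP => i j; rewrite !mxE ord1; apply/eqP; rewrite -[_ == _]negbK -unitE h.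
by rewrite unitE negbK; move: (h i 0); rewrite !mxE => ->.
Qed.

(* The map [u |-> pi u] has image the columns of nonunits, and its kernel is the same set. *)
Lemma sum_nonunit_col n (G : 'cV[A]_n -> nat) :
  (nonunit_cols n * \sum_(v | nonunit_col v) G v = \sum_u G (pi *: u))%N.
Proof.
have pipi x : pi * x \isn't a GRing.unit.
  by rewrite unitrM negb_and pi_nonunit.
rewrite [RHS](partition_big (fun u => pi *: u) (@nonunit_col n)) /=; last first.
  by move=> u _; apply/forallP => i; rewrite mxE.
rewrite big_distrr /=; apply: eq_bigr => v /forallP vn.
have [u0 u0v] : exists u0, v = pi *: u0.
  have /fin_all_exists[g hg] : forall i, exists y, v i 0 = pi * y by move=> i; apply: nonunit_mul.
  by exists (\col_i g i); apply/matrixP => i j; rewrite !mxE ord1.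
transitivity (\sum_(u : 'cV[A]_n | pi *: u == v) G v)%N; last by apply: eq_bigr => u /eqP ->.
rewrite sum_nat_const; congr (_ * _)%N.
rewrite /nonunit_cols -[in LHS](card_imset _ (addIr u0)); apply: eq_card => u.
rewrite [RHS](_ : _ = (pi *: u == v)) //.
rewrite u0v; apply/idP/eqP => [/imsetP[x xn ->]|h].
  have : nonunit_col x by exact: xn.
  by rewrite scalerDr nonunit_colE => /eqP ->; rewrite add0r.
have un : nonunit_col (u - u0) by rewrite nonunit_colE scalerBr h subrr.
by apply/imsetP; exists (u - u0); [exact: un | rewrite subrK].
Qed.

Definition unit_det_count n : nat :=
  (\sum_(M : 'M[A]_n) (\det M \is a GRing.unit))%N.
Definition nonzero_det_count n : nat := (\sum_(M : 'M[A]_n) (\det M != 0%R))%N.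

Lemma nonunit_cols_sqr n : (nonunit_cols n * nonunit_cols n = #|A| ^ n)%N.
Proof.
have := @sum_nonunit_col n (fun=> 1%N).
by rewrite !sum1_card card_mx muln1.
Qed.

Lemma card_unimodular n : (\sum_(v : 'cV[A]_n | ~~ nonunit_col v) 1 = #|A| ^ n - nonunit_cols n)%N.
Proof.
have := cardC (@nonunit_col n); rewrite card_mx muln1 => <-.
by rewrite addKn sum1_card; apply: eq_card.
Qed.

Lemma sum_first_column (S : nmodType) n (F : 'M[A]_n.+1 -> S) :
  \sum_M F M = \sum_(v | nonunit_col v) \sum_(B : 'M[A]_(n.+1, n)) F (row_mx v B)
    + \sum_(v | ~~ nonunit_col v) \sum_(B : 'M[A]_(n.+1, n)) F (row_mx v B).
Proof. by rewrite (@sum_row_mx _ _ n.+1 1 n) (bigID (@nonunit_col n.+1)). Qed.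

Lemma sum_unimodular (E : pred A) n :
  (forall c x, c \is a GRing.unit -> E (c * x) = E x) ->
  (\sum_(v | ~~ nonunit_col v) \sum_(B : 'M[A]_(n.+1, n)) E (\det (row_mx v B : 'M[_]_(n.+1)))
    = (#|A| ^ n.+1 - nonunit_cols n.+1) * (#|A| ^ n * \sum_(B : 'M[A]_n) E (\det B)))%N.
Proof.
move=> Einv; rewrite -card_unimodular big_distrl /=; apply: eq_bigr => v.
rewrite negb_forall => /existsP[i]; rewrite negbK => vi.
by rewrite mul1n (unimodular_column_count Einv vi).
Qed.

Lemma det_row_mx_scale n (u : 'cV[A]_n.+1) (B : 'M[A]_(n.+1, n)) :
  \det (row_mx (pi *: u) B : 'M[_]_(n.+1)) = pi * \det (row_mx u B : 'M[_]_(n.+1)).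
Proof.
have -> : row_mx (pi *: u) B = row_mx u B *m block_mx (pi%:M : 'M[_]_1) 0 0 1%:M.
  by rewrite mul_row_block !mulmx0 addr0 add0r mulmx1 mul_mx_scalar.
by rewrite (det_mulmx (row_mx u B : 'M[_]_(n.+1))) (@det_ublock _ 1 n) det1 mulr1 det_scalar1 mulrC.
Qed.

(** A first column of nonunits is a multiple of [pi], and so is the determinant; only unimodular
    first columns contribute. *)
Lemma unit_det_countS n :
  unit_det_count n.+1 = ((#|A| ^ n.+1 - nonunit_cols n.+1) * (#|A| ^ n * unit_det_count n))%N.
Proof.
rewrite /unit_det_count (sum_first_column (fun M => \det M \is a GRing.unit : nat)).
rewrite (sum_unimodular (E := fun x => x \is a GRing.unit)) => [|c x cu]; last first.
  by rewrite unitrM cu.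
rewrite -[RHS]add0n; congr (_ + _)%N; apply: big1 => v vn; apply: big1 => B _.
have /fin_all_exists[g hg] : forall i, exists y, v i 0 = pi * y.
  by move=> i; apply: nonunit_mul; move/forallP: vn.
have -> : v = pi *: \col_i g i by apply/matrixP => i j; rewrite !mxE ord1.
by rewrite det_row_mx_scale unitrM (negPf pi_nonunit).
Qed.

(** A first column of nonunits is pi u, and pi det(u | B) is nonzero exactly when det(u | B) is a
    unit. Each such column comes from [nonunit_cols n.+1] vectors u, whence this factor on both
    sides. *)
Lemma nonzero_det_countS n :
  (nonunit_cols n.+1 * nonzero_det_count n.+1 =
   nonunit_cols n.+1 * ((#|A| ^ n.+1 - nonunit_cols n.+1) * (#|A| ^ n * nonzero_det_count n))
   + unit_det_count n.+1)%N.
Proof.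
rewrite /nonzero_det_count (sum_first_column (fun M => \det M != 0 : nat)).
rewrite (sum_unimodular (E := fun x => x != 0)) => [|c x cu]; last first.
  by rewrite (mulrI_eq0 _ (mulrI cu)).
rewrite [LHS]mulnDr addnC; congr (_ + _)%N.
rewrite sum_nonunit_col /unit_det_count (@sum_row_mx _ _ n.+1 1 n).
apply: eq_bigr => u _; apply: eq_bigr => B _.
by rewrite det_row_mx_scale unitE.
Qed.

Lemma nonzero_det_density (R : realFieldType) (p n : nat) : (0 < p)%N -> #|A| = (p ^ 2)%N ->
  (nonzero_det_count n)%:R / (p%:R ^+ 2) ^+ (n ^ 2)
    = \prod_(2 <= j < n.+2) (1 - p%:R ^- j) :> R.
Proof.
move=> p0 cA; have p0' : p%:R != 0 :> R by rewrite pnatr_eq0 -lt0n.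
have Kn k : nonunit_cols k = (p ^ k)%N.
  apply/eqP; rewrite -(@eqn_exp2r _ _ 2) // -mulnn nonunit_cols_sqr cA -!expnM mulnC.
  by [].
(* The recursion for nonzero determinants involves those that are units, so both densities are
   carried along. With x = 1/p its step is (1 - x^(n+1)) + x^(n+1) (1 - x) = 1 - x^(n+2). *)
suff [] : (nonzero_det_count n)%:R / (p%:R ^+ 2) ^+ (n ^ 2)
      = \prod_(2 <= j < n.+2) (1 - p%:R ^- j) :> R
  /\ (unit_det_count n.+1)%:R / (p%:R ^+ 2) ^+ (n.+1 ^ 2)
      = (1 - p%:R^-1) * \prod_(2 <= j < n.+2) (1 - p%:R ^- j) :> R by [].
set X := p%:R : R in p0' *.
have X20 : X ^+ 2 != 0 by rewrite expf_neq0.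
have cardP k : (#|A| ^ k.+1 - nonunit_cols k.+1)%:R = (X ^+ 2) ^+ k.+1 * (1 - X ^- k.+1) :> R.
  rewrite Kn cA natrB ?leq_exp2r -?expnM ?leq_pexp2l ?leq_pmull // !natrX -/X mulrBr mulr1.
  by rewrite exprM; congr (_ - _); rewrite -exprM mulnC exprM expr2 mulfK // expf_neq0.
have sq k : (k.+1 ^ 2 = k.+1 + k + k ^ 2)%N by ring.
have hU k : (unit_det_count k.+1)%:R / (X ^+ 2) ^+ (k.+1 ^ 2)
    = (1 - X ^- k.+1) * ((unit_det_count k)%:R / (X ^+ 2) ^+ (k ^ 2)) :> R.
  rewrite unit_det_countS 2!natrM cardP cA natrX natrX -/X sq !exprD -!exprM.
  by field; rewrite !expf_neq0.
have hV k : (nonzero_det_count k.+1)%:R / (X ^+ 2) ^+ (k.+1 ^ 2)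
    = (1 - X ^- k.+1) * ((nonzero_det_count k)%:R / (X ^+ 2) ^+ (k ^ 2))
      + X ^- k.+1 * ((unit_det_count k.+1)%:R / (X ^+ 2) ^+ (k.+1 ^ 2)) :> R.
  have /(congr1 (fun x => x%:R : R)) := nonzero_det_countS k.
  rewrite natrD !natrM cardP Kn cA !natrX -/X => h.
  have Xk : X ^+ k.+1 != 0 by rewrite expf_neq0.
  apply: (mulfI Xk); rewrite [LHS]mulrA h sq !exprD -!exprM.
  by field; rewrite !expf_neq0.
have h0 : (nonzero_det_count 0)%:R = 1 :> R.
  rewrite /nonzero_det_count (sum_thin_mx _ 0) det_mx00.
  by rewrite oner_neq0.
have h0' : (unit_det_count 0)%:R = 1 :> R.
  by rewrite /unit_det_count (sum_thin_mx _ 0) det_mx00 unitr1.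
elim: n => [|n [IHv IHu]].
  by rewrite hU h0 h0' big_geq // !expr0 divr1 expr1.
have step : (nonzero_det_count n.+1)%:R / (X ^+ 2) ^+ (n.+1 ^ 2)
      = \prod_(2 <= j < n.+3) (1 - X ^- j).
  rewrite hV IHv IHu [in RHS]big_nat_recr //=.
  set Pr := \prod_(2 <= j < n.+2) _.
  rewrite [X in _ = _ * (1 - X)](_ : _ = X ^- n.+1 * X^-1); last by rewrite -invfM -exprSr.
  ring.
split=> //; rewrite hU IHu [in RHS]big_nat_recr //=; ring.
Qed.

End LocalRing.

Lemma dvdz_det_nat_mx m n (T : 'M['I_m.+2]_n) :
  (m.+2%:Z %| \det (nat_mx T))%Z = (\det T == 0).
Proof.
have -> : \det T = (\det (nat_mx T))%:~R.
  rewrite -det_map_mx; congr (\det _); apply/matrixP => i j; rewrite !mxE.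
  exact/esym/(natr_Zp (T i j : 'Z_m.+2)).
have natE k : (k%:R == 0 :> 'I_m.+2) = (m.+2 %| k)%N.
  by rewrite -(inj_eq val_inj) /= (@val_Zp_nat m.+2).
case: (\det _) => k.
  by rewrite -pmulrn natE.
by rewrite NegzE rpredN mulrNz oppr_eq0 -pmulrn natE.
Qed.

Lemma residue_density_prime (R : realFieldType) n p : prime p ->
  (residue_det_count (p ^ 2) n)%:R / (p%:R ^+ 2) ^+ (n ^ 2)
    = 1 - \prod_(2 <= j < n.+2) (1 - p%:R ^- j) :> R.
Proof.
move=> pp; have p1 := prime_gt1 pp; have p0 := prime_gt0 pp.
have [m pm] : exists m, (p ^ 2 = m.+2)%N.
  by exists (p ^ 2).-2; case: p {pp} p1 p0 => [|[|p]].
pose A : finComUnitRingType := 'I_m.+2.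
have cA : #|A| = (p ^ 2)%N by rewrite card_ord pm.
have natE k : (k%:R == 0 :> A) = (p ^ 2 %| k)%N.
  by rewrite pm -(inj_eq val_inj) /= (@val_Zp_nat m.+2).
have unatE k : ((k%:R : A) \is a GRing.unit) = ~~ (p %| k)%N.
  have -> : ((k%:R : A) \is a GRing.unit) = coprime m.+2 k by exact: (@unitZpE m.+2).
  by rewrite -pm coprime_pexpl // prime_coprime.
pose pi : A := p%:R.
have natA (x : A) : x = (x : nat)%:R by rewrite -[LHS](natr_Zp (x : 'Z_m.+2)).
have pi_nonunit : pi \isn't a GRing.unit by rewrite unatE dvdnn.
have unitE (x : A) : (x \is a GRing.unit) = (pi * x != 0).
  by rewrite [x]natA unatE /pi -natrM natE -mulnn dvdn_pmul2l.
have nonunit_mul (x : A) : x \isn't a GRing.unit -> exists y, x = pi * y.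
  rewrite {1}[x]natA unatE negbK => /dvdnP[k xk]; exists k%:R.
  by rewrite [LHS]natA xk mulnC natrM.
rewrite -(nonzero_det_density pi_nonunit unitE nonunit_mul R n p0 cA).
have p0' : p%:R != 0 :> R by rewrite pnatr_eq0 -lt0n.
have D0 : (p%:R ^+ 2) ^+ (n ^ 2) != 0 :> R by rewrite !expf_neq0.
apply: (canLR (mulfK D0)); rewrite mulrBl mul1r divfK //.
apply/eqP; rewrite eq_sym subr_eq -!natrX -natrD eqr_nat pm; apply/eqP.
rewrite /residue_det_count /nonzero_det_count -big_split /=.
under eq_bigr => T _ do rewrite dvdz_det_nat_mx addnC addn_negb.
by rewrite sum1_card card_mx card_ord mulnn.
Qed.

(** * Matrices of given determinant *)

(* An equation is a congruence to a modulus too large to matter. *)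
Lemma linear_equation_count (R : realFieldType) N k (w : 'I_k -> int) (t : 'cV[int]_k) i :
  (0 < N)%N -> w i != 0 ->
  \sum_(y : 'cV['I_N]_k) ((\sum_j w j * (shift_mx t y) j 0 == 0) : nat)%:R
    <= 2 ^+ k * N%:R ^+ k / N%:R :> R.
Proof.
(* The gcd divides w_i, so for this modulus gcd / e is at most 1/N, the size of the error term. *)
move=> N0 wi; pose e := (N * `|w i|)%N.
have e0 : (0 < e)%N by rewrite muln_gt0 N0 absz_gt0.
rewrite sum_trmx.
have := linear_congruence_count R w (\sum_j w j * t j 0) e0 N0.
under eq_bigr => x _.
  have -> : \sum_j w j * t j 0 + \sum_j w j * (x 0 j : nat)%:Z
    = \sum_j w j * (shift_mx t x^T) j 0.
    rewrite -big_split /=; apply: eq_bigr => j _.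
    by rewrite shift_mxE mxE -mulrDr addrC.
  over.
move=> h; apply: le_trans (_ : N%:R ^+ k * (N%:R^-1 + (2 ^+ k - 1) / N%:R) <= _); last first.
  by rewrite le_eqVlt; apply/orP; left; apply/eqP; ring.
apply: le_trans (le_trans _ h) _.
  apply: ler_sum => x _; rewrite ler_nat.
  by case: eqP => // ->; rewrite dvdz0.
rewrite ler_wpM2l ?exprn_ge0 ?ler0n // lerD2r ler_pdivrMr ?ltr0n // /e natrM mulKf ?pnatr_eq0 -?lt0n //.
by rewrite ler_nat dvdn_leq ?absz_gt0 // gcdv_dvdl.
Qed.

(** Codimension two: if the last k columns U have a nonzero minor, the vanishing of the first two
    minors imposes one linear equation on y1 and one on y0, each saving a factor N. Otherwise U
    itself is degenerate and the induction applies. *)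
Lemma zero_minors_count (R : realFieldType) N k (T : 'M[int]_(k, k.+1)) : (0 < N)%N ->
  \sum_(Y : 'M['I_N]_(k, k.+1)) ([forall j, minors (shift_mx T Y) j == 0] : nat)%:R
    <= k%:R * 4 ^+ k * N%:R ^+ (k * k.+1) / N%:R ^+ 2 :> R.
Proof.
move=> N0; have N0' : (0 : R) < N%:R by rewrite ltr0n.
elim: k T => [|k IHk] T.
  rewrite !mul0r big1 // => Y _; case: forallP => // /(_ ord0).
  by rewrite /minors det_mx00 mulr1 expr0.
rewrite sum_two_columns.
pose TU : 'M[int]_(k.+1, k) := @rsubmx _ k.+1 1 k (@rsubmx _ k.+1 1 k.+1 T).
pose w (U : 'M['I_N]_(k.+1, k)) := minors (shift_mx TU U)^T.
pose C := 4 ^+ k.+1 * N%:R ^+ (k.+1 * 2) / N%:R ^+ 2 : R.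
apply: le_trans (_ : \sum_(U : 'M['I_N]_(k.+1, k))
   (C + N%:R ^+ (k.+1 * 2) * ([forall j, w U j == 0] : nat)%:R) <= _).
  apply: ler_sum => U _; case: (boolP [forall j, w U j == 0]) => [_|].
    rewrite mulr1; apply: le_trans (_ : N%:R ^+ (k.+1 * 2) <= _); last first.
      by rewrite lerDr /C; nonneg.
    apply: le_trans (_ : \sum_(y1 : 'cV['I_N]_k.+1) \sum_(y0 : 'cV['I_N]_k.+1) 1 <= _).
      by apply: ler_sum => y1 _; apply: ler_sum => y0 _; rewrite lern1; case: [forall _, _].
    rewrite !sumr_const card_mx card_ord muln1 -[_ *+ _]mulr_natl -natrM -expnD.
    by rewrite addnn -muln2 natrX.
  rewrite negb_forall mulr0 addr0 => /existsP[i wi].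
  apply: le_trans (_ : (2 ^+ k.+1 * N%:R ^+ k.+1 / N%:R) ^+ 2 <= _); last first.
    rewrite /C -[(4 : R)]/(2 * 2)%:R natrM -expr2 -exprM mulnC exprM [N%:R ^+ (_ * 2)]exprM.
    by rewrite expr_div_n exprMn.
  rewrite expr2; pose c1 := @lsubmx _ k.+1 1 k (@rsubmx _ k.+1 1 k.+1 T).
  pose c0 := @lsubmx _ k.+1 1 k.+1 T.
  have b1 := linear_equation_count R c1 N0 wi.
  have b0 := linear_equation_count R c0 N0 wi.
  apply: le_trans (ler_pM _ _ b1 b0); try by apply: sumr_ge0 => y _; rewrite ler0n.
  rewrite big_distrlr /=; apply: ler_sum => y1 _; apply: ler_sum => y0 _.
  rewrite -natrM ler_nat mulnb; case: forallP => // h.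
  have := h ord0; have := h (lift ord0 ord0).
  rewrite (@shift_row_mx _ k.+1 1 k.+1) (@shift_row_mx _ k.+1 1 k) -/TU.
  by rewrite minors_two0 minors_two1 oppr_eq0 => -> ->.
rewrite big_split /= sumr_const card_mx card_ord -[C *+ _]mulr_natl natrX -mulr_sumr.
have h : \sum_(U : 'M['I_N]_(k.+1, k)) ([forall j, w U j == 0] : nat)%:R
    <= k%:R * 4 ^+ k * N%:R ^+ (k * k.+1) / N%:R ^+ 2 :> R.
  rewrite sum_trmx /w; under eq_bigr => U _ do rewrite shift_trmx trmxK.
  exact: IHk.
have c0 : 0 <= N%:R ^+ (k.+1 * 2) :> R by nonneg.
apply: le_trans (lerD (lexx _) (ler_wpM2l c0 h)) _.
have -> : (k.+1 * k.+2 = k.+1 * 2 + k * k.+1)%N by ring.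
rewrite exprD /C [(k.+1 * k)%N]mulnC -[k.+1%:R]natr1 [4 ^+ k.+1]exprS.
have p0 : 0 <= N%:R ^+ (k.+1 * 2) * N%:R ^+ (k * k.+1) / N%:R ^+ 2 * (3 * k%:R * 4 ^+ k) :> R.
  by nonneg.
rewrite -subr_ge0; apply: le_trans p0 _; rewrite le_eqVlt; apply/orP; left; apply/eqP; ring.
Qed.

Lemma gcdv_bezout k (w : 'I_k -> int) : exists x : 'I_k -> int, \sum_j w j * x j = (gcdv w 0)%:Z.
Proof.
elim: k w => [|k IHk] w; first by exists (fun=> 0); rewrite /gcdv !big_ord0.
have [x hx] := IHk (fun j => w (lift ord0 j)).
rewrite /gcdv big_ord_recl -/(gcdv (fun j => w (lift ord0 j)) 0).
set g := gcdv _ _ in hx *.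
have [u [v huv]] := Bezoutz (w ord0) g.
exists (fun j => if unlift ord0 j is Some i then v * x i else u).
rewrite big_ord_recl unlift_none; under eq_bigr => j _ do rewrite liftK mulrCA.
by rewrite -mulr_sumr hx mulrC huv /gcdz.
Qed.

(** * Points of a box on a hyperplane *)

Section RowLattice.
Variables (k H : nat) (B : 'M[int]_(k, k.+1)) (c : 'I_k.+1 -> int) (g : int) (i0 : 'I_k.+1).
Hypothesis BH : forall i j, `|B i j| <= H%:Z.
Hypotheses (g0 : g != 0) (Bc : forall j, minors B j = g * c j).
Hypotheses (ci0 : c i0 != 0) (c1 : exists x : 'I_k.+1 -> int, \sum_j c j * x j = 1).

(** This is the determinant of [B] with its row i repeated on top. *)
Lemma minors_orthogonal i : \sum_j minors B j * B i j = 0.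
Proof.
transitivity (\sum_j minors B j * (row i B) 0 j).
  by apply: eq_bigr => j _; rewrite mxE.
rewrite -det_col_mx_minors; apply: (@determinant_alternate _ _ _ ord0 (lift ord0 i)) => //.
move=> j; rewrite !mxE; case: splitP => l /=; last by [].
move=> _; case: splitP => l' /=; first by rewrite ord1 /bump.
by rewrite /bump /= !add1n => -[/ord_inj <-]; rewrite mxE.
Qed.

(* A Bezout solution is reduced by subtracting a rounded combination of the rows of [B];
   Cramer's rule keeps the rounding in the integers. *)
Lemma short_representative (s : int) : `|s| <= `|c i0| * H%:Z ->
  exists x : 'rV[int]_k.+1, \sum_j c j * x 0 j = s /\ forall j, `|x 0 j| <= (k.+1 * H)%:Z.
Proof.
move=> sH; have [x1 hx1] := c1.
pose x0 : 'rV[int]_k.+1 := \row_j (s * x1 j).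
pose M : 'M[int]_(k.+1) := col_mx (delta_mx 0 i0 : 'rV_k.+1) B.
have detM : \det M = g * c i0.
  rewrite /M det_col_mx_minors (bigD1 i0) //= mxE !eqxx mulr1 Bc big1 ?addr0 // => j jn.
  by rewrite mxE (negPf jn) andbF mulr0.
have D0 : \det M != 0 by rewrite detM mulf_neq0.
pose u := x0 *m \adj M.
have uM : u *m M = \det M *: x0 by rewrite -mulmxA mul_adj_mx mul_mx_scalar.
have u0 : u 0 ord0 = g * s.
  rewrite mxE; have := det_col_mx_minors x0 B.
  transitivity (\sum_j x0 0 j * minors B j); last first.
    rewrite -[RHS]mulr1 -hx1 mulr_sumr; apply: eq_bigr => j _.
    by rewrite Bc mxE; ring.
  apply: eq_bigr => j _; congr (_ * _); rewrite mxE /cofactor /minors add0n.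
  congr (_ * \det _); apply/matrixP => i l; rewrite !mxE; case: splitP => i' /=.
    by rewrite ord1 /bump.
  by rewrite /bump /= !add1n => -[/ord_inj ->].
pose q : 'rV[int]_k := \row_i (u 0%R (lift ord0 i) %/ \det M)%Z.
pose r (i : 'I_k) := (u 0%R (lift ord0 i) %% \det M)%Z.
have uE i : u 0 (lift ord0 i) = q 0 i * \det M + r i by rewrite [q _ _]mxE -divz_eq.
have xE j : (x0 - q *m B) 0 j = x0 0 j - \sum_i q 0 i * B i j.
  by rewrite mxE [(- (q *m B)) _ _]mxE [(q *m B) _ _]mxE.
exists (x0 - q *m B); split.
  under eq_bigr => j _ do rewrite mxE mulrDr mxE mulrCA.
  rewrite big_split /= -mulr_sumr hx1 mulr1 -[RHS]addr0; congr (_ + _).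
  apply: (mulfI g0); rewrite mulr0 mulr_sumr.
  under eq_bigr => j _ do rewrite mulrA -Bc !mxE mulrN mulr_sumr.
  rewrite sumrN exchange_big /= big1 ?oppr0 // => i _.
  under eq_bigr => j _ do rewrite mulrCA.
  by rewrite -mulr_sumr minors_orthogonal mulr0.
move=> j; rewrite -(ler_pM2l (_ : 0 < `|\det M|)) ?normr_gt0 // -normrM.
have -> : \det M * (x0 - q *m B) 0 j = g * s * (i0 == j)%:R + \sum_i r i * B i j.
  have /matrixP/(_ 0 j) := uM; rewrite [RHS]mxE mxE big_ord_recl u0 => e.
  rewrite xE mulrBr -e -addrA; congr (_ + _).
    congr (_ * _); rewrite mxE; case: splitP => l //= _.
    by rewrite mxE !ord1 eqxx eq_sym.
  rewrite mulr_sumr -sumrB; apply: eq_bigr => i _.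
  rewrite uE; have -> : M (lift ord0 i) j = B i j.
    rewrite mxE; case: splitP => l /=; first by rewrite ord1 /bump.
    by rewrite /bump /= !add1n => -[/ord_inj ->].
  ring.
apply: le_trans (ler_normD _ _) _.
have -> : (k.+1 * H)%:Z = H%:Z + (k * H)%:Z by rewrite mulSn PoszD.
rewrite mulrDr; apply: lerD.
  apply: le_trans (_ : `|g * s| <= _).
    by case: eqP => _; rewrite ?mulr1 // mulr0 normr0.
  by rewrite detM !normrM -mulrA ler_wpM2l.
apply: le_trans (ler_norm_sum _ _ _) _.
apply: le_trans (_ : \sum_(i < k) `|\det M| * H%:Z <= _).
  apply: ler_sum => i _; rewrite normrM ler_pM //.
  by rewrite ger0_norm ?modz_ge0 // ltW // ltz_mod.
by rewrite sumr_const card_ord -mulr_natl PoszM mulrCA natz.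
Qed.
End RowLattice.

Definition sym_box (H a b : nat) (X : 'M['I_(2 * H).+1]_(a, b)) : 'M[int]_(a, b) :=
  shift_mx (const_mx (- H%:Z)) X.

Lemma sym_boxE H a b (X : 'M['I_(2 * H).+1]_(a, b)) i j :
  sym_box X i j = (X i j : nat)%:Z - H%:Z.
Proof. by rewrite shift_mxE mxE. Qed.

Lemma sym_box_le H a b (X : 'M['I_(2 * H).+1]_(a, b)) i j : `|sym_box X i j| <= H%:Z.
Proof. by rewrite sym_boxE; have := ltn_ord (X i j); lia. Qed.

Lemma sym_box_surj H a b (M : 'M[int]_(a, b)) : (forall i j, `|M i j| <= H%:Z) ->
  exists X : 'M['I_(2 * H).+1]_(a, b), sym_box X = M.
Proof.
move=> MH; exists (\matrix_(i, j) inord (absz (M i j + H%:Z))).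
apply/matrixP => i j; rewrite sym_boxE mxE.
by have := MH i j => h; rewrite inordK; lia.
Qed.

Lemma sum_row_prod (R : realFieldType) (T : finType) n (f : T -> R) :
  \sum_(a : 'rV[T]_n) \prod_j f (a 0 j) = (\sum_x f x) ^+ n.
Proof.
elim: n => [|n IHn].
  case: (pickP (fun x : 'rV[T]_0 => true)) => [x0 _|no].
    by rewrite (sum_thin_mx _ x0) big_ord0 expr0.
  have := card_mx T 1 0; rewrite muln0 expn0 => c1.
  by have := eq_card0 no; rewrite c1.
rewrite (@sum_row_mx _ _ 1 1 n) sum_mx11 exprS big_distrl /=; apply: eq_bigr => x _.
rewrite -IHn mulr_sumr; apply: eq_bigr => a _.
rewrite big_ord_recl row_mx_const0; congr (_ * _); apply: eq_bigr => j _.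
by rewrite row_mx_constS.
Qed.

Lemma sum_rows_prod (R : realFieldType) (T : finType) m n (f : 'rV[T]_n -> R) :
  \sum_(B : 'M[T]_(m, n)) \prod_i f (row i B) = (\sum_a f a) ^+ m.
Proof.
elim: m => [|m IHm].
  have [B0 _|no] := pickP (fun x : 'M[T]_(0, n) => true).
    rewrite sum_trmx (sum_thin_mx _ B0^T) big_ord0 expr0 //.
  have := card_mx T 0 n; rewrite mul0n expn0 => c1.
  by have := eq_card0 no; rewrite c1.
rewrite (@sum_col_mx _ _ 1 m n) exprS big_distrl /=; apply: eq_bigr => a _.
rewrite -IHm mulr_sumr; apply: eq_bigr => B _.
rewrite big_ord_recl; congr (f _ * _).
  apply/rowP => j; rewrite !mxE; case: splitP => l //= _; by rewrite ord1.
apply: eq_bigr => i _; congr f; apply/rowP => j; rewrite !mxE; case: splitP => l /=.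
  by rewrite ord1 /bump.
by rewrite /bump /= !add1n => -[/ord_inj ->].
Qed.

Lemma det_norm_le n (A : 'M[int]_n) H : (forall i j, `|A i j| <= H%:Z) ->
  `|\det A| <= (n`! * H ^ n)%N%:Z.
Proof.
move=> AH; apply: le_trans (ler_norm_sum _ _ _) _.
apply: le_trans (_ : \sum_(s : 'S_n) (H ^ n)%N%:Z <= _).
  apply: ler_sum => s _; rewrite normrM normrX normrN1 expr1n mul1r normr_prod.
  have -> : (H ^ n)%N%:Z = \prod_(i < n) H%:Z by rewrite prodr_const card_ord -[LHS]natz natrX natz.
  by apply: ler_prod => i _; rewrite normr_ge0 AH.
by rewrite sumr_const card_Sn -mulr_natl PoszM natz.
Qed.

Section Hyperplane.
Variables (R : realFieldType) (k H : nat) (B : 'M[int]_(k, k.+1)) (c : 'I_k.+1 -> int) (g : int) (i0 : 'I_k.+1).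
Hypotheses (H0 : (0 < H)%N) (BH : forall i j, `|B i j| <= H%:Z).
Hypotheses (g0 : g != 0) (Bc : forall j, minors B j = g * c j).
Hypotheses (ci0 : c i0 != 0) (c1 : exists x : 'I_k.+1 -> int, \sum_j c j * x j = 1).

(* Translating the solutions by representatives of all [|s| <= |c_i0| H] yields pairwise
   disjoint subsets of a box of size [(k+2) H]. *)
Lemma hyperplane_card (t : int) :
  (#|[pred a : 'rV['I_(2 * H).+1]_k.+1 | (\sum_j c j * sym_box a 0 j == t)%R]|
    * (2 * (`|c i0| * H)).+1 <= ((2 * (k.+2 * H)).+1) ^ k.+1)%N.
Proof.
set D := (`|c i0| * H)%N.
have /fin_all_exists[x hx] : forall s : 'I_(2 * D).+1, exists x : 'rV[int]_k.+1,
    \sum_j c j * x 0 j = (s : nat)%:Z - D%:Z /\ forall j, `|x 0 j| <= (k.+1 * H)%:Z.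
  move=> s; apply: (short_representative BH g0 Bc ci0 c1).
  by rewrite -abszE -PoszM -/D; have := ltn_ord s; lia.
have /fin_all_exists[y hy] : forall p : 'rV['I_(2 * H).+1]_k.+1 * 'I_(2 * D).+1,
    exists y : 'rV['I_(2 * (k.+2 * H)).+1]_k.+1, sym_box y = sym_box p.1 + x p.2.
  move=> [a s]; apply: sym_box_surj => i j; rewrite ord1 mxE /=.
  apply: le_trans (ler_normD _ _) _; rewrite mulSn PoszD.
  by apply: lerD; [exact: sym_box_le | exact: (hx s).2].
pose A := [pred p : 'rV['I_(2 * H).+1]_k.+1 * 'I_(2 * D).+1 | \sum_j c j * sym_box p.1 0 j == t].
have -> : (#|[pred a : 'rV['I_(2 * H).+1]_k.+1 | (\sum_j c j * sym_box a 0 j == t)%R]|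
    * (2 * D).+1 = #|A|)%N.
  have := cardX [pred a : 'rV['I_(2 * H).+1]_k.+1 | (\sum_j c j * sym_box a 0 j == t)%R]
    (mem 'I_(2 * D).+1).
  rewrite card_ord => <-; apply: eq_card => p.
  by rewrite !inE andbT.
apply: leq_trans (_ : #|{: 'rV['I_(2 * (k.+2 * H)).+1]_k.+1}| <= _)%N; last first.
  by rewrite card_mx card_ord mul1n.
apply: (leq_card_in y) => -[a s] [a' s']; rewrite !inE /= => /eqP ha /eqP ha' eyy.
have e : sym_box a + x s = sym_box a' + x s' by rewrite -(hy (a, s)) -(hy (a', s')) eyy.
have ess : s = s'.
  have : \sum_j c j * (sym_box a + x s) 0 j = \sum_j c j * (sym_box a' + x s') 0 j by rewrite e.
  have expand (b : 'rV['I_(2 * H).+1]_k.+1) r : \sum_j c j * (sym_box b + x r) 0 j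
      = \sum_j c j * sym_box b 0 j + ((r : nat)%:Z - D%:Z).
    by rewrite -(hx r).1 -big_split /=; apply: eq_bigr => j _; rewrite mxE mulrDr.
  by rewrite !expand ha ha' => h; apply: val_inj => /=; lia.
rewrite -ess in e *; congr (_, _); move: e => /addIr e.
apply/matrixP => i j; move/matrixP: e => /(_ i j); rewrite !sym_boxE => h.
by apply: val_inj => /=; lia.
Qed.

Lemma hyperplane_count (t : int) :
  \sum_(a : 'rV['I_(2 * H).+1]_k.+1) ((\sum_j c j * sym_box a 0 j == t) : nat)%:R
    <= (2 * k + 5)%:R ^+ k.+1 * H%:R ^+ k / `|c i0|%N%:R :> R.
Proof.
have c0 : (0 < `|c i0|)%N by rewrite absz_gt0.
rewrite ler_pdivlMr ?ltr0n // -(ler_pM2r (_ : 0 < H%:R :> R)) ?ltr0n //.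
rewrite -[X in _ <= X]mulrA -exprSr -exprMn.
have -> : \sum_(a : 'rV['I_(2 * H).+1]_k.+1) ((\sum_j c j * sym_box a 0 j == t) : nat)%:R
  = #|[pred a : 'rV['I_(2 * H).+1]_k.+1 | (\sum_j c j * sym_box a 0 j == t)%R]|%:R :> R.
  rewrite -sum1_card natr_sum [RHS]big_mkcond /=.
  by apply: eq_bigr => a _; rewrite inE; case: eqP.
rewrite -!natrM -natrX ler_nat.
apply: leq_trans (leq_trans _ (hyperplane_card t)) _.
  by rewrite -mulnA leq_mul2l; apply/orP; right; lia.
(* Origin of the constant: 2 (k+2) H + 1 <= (2k+5) H. *)
by rewrite leq_exp2r //; lia.
Qed.
End Hyperplane.

(** The sum of 1 / max(1, |y|) over |y| <= Y. The maximum gives zero coordinates of a direction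
    weight 1. *)
Definition reciprocal_sum (R : realFieldType) (Y : nat) : R :=
  \sum_(x < (2 * Y).+1) (maxn 1 (absz ((x : nat)%:Z - Y%:Z)))%:R^-1.

Lemma gcdv0_gt0 k (w : 'I_k -> int) j : w j != 0 -> (0 < gcdv w 0)%N.
Proof.
by move=> wj; apply: dvdn_gt0 (gcdv_dvdl w 0 j); rewrite absz_gt0.
Qed.

Section PrimitiveDirection.
Variables (R : realFieldType) (k H : nat) (c : 'I_k.+1 -> int) (i0 : 'I_k.+1).
Hypotheses (H0 : (0 < H)%N) (ci0 : c i0 != 0).
Hypothesis cmax : forall j, (`|c j| <= `|c i0|)%N.
Hypothesis c1 : exists x : 'I_k.+1 -> int, \sum_j c j * x j = 1.

Let dir (B : 'M['I_(2 * H).+1]_(k, k.+1)) : bool :=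
  [exists j, minors (sym_box B) j != 0]
  && [forall j, minors (sym_box B) j == (gcdv (minors (sym_box B)) 0)%:Z * c j].

(* The exponent of [|c|] is [-(k+1)], bounded by a product over coordinates so that the sum
   over [c] factors. *)
Lemma direction_count (t : int) :
  \sum_(B : 'M['I_(2 * H).+1]_(k, k.+1)) \sum_(a : 'rV['I_(2 * H).+1]_k.+1)
     (dir B && (\sum_j minors (sym_box B) j * sym_box a 0 j == t) : nat)%:R
  <= ((2 * k + 5)%:R ^+ k.+1 * H%:R ^+ k) ^+ k.+1 * \prod_j (maxn 1 `|c j|)%:R^-1 :> R.
Proof.
set K := _ * H%:R ^+ k.
have K0 : 0 <= K by rewrite /K; nonneg.
(* The hyperplane bound needs at least one matrix with direction c, whose rows supply the short
   representatives; without one the sum is empty. *)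
have [B0 dB0|nodir] := pickP dir; last first.
  rewrite big1; first by apply: mulr_ge0; [exact: exprn_ge0 | apply: prodr_ge0 => j _; rewrite invr_ge0].
  by move=> B _; rewrite big1 // => a _; rewrite nodir.
pose F := K / `|c i0|%N%:R.
have F0 : 0 <= F by rewrite /F; nonneg.
have gdir B : dir B -> (gcdv (minors (sym_box B)) 0)%:Z != 0 :> int.
  by move=> /andP[/existsP[j /gcdv0_gt0 g0] _]; rewrite -lt0n.
have hyp t' : \sum_(a : 'rV['I_(2 * H).+1]_k.+1) ((\sum_j c j * sym_box a 0 j == t') : nat)%:R <= F.
  have /andP[_ /forallP hB0] := dB0.
  apply: (hyperplane_count R H0 (@sym_box_le _ _ _ B0) (gdir _ dB0) _ ci0 c1) => j.
  exact/eqP.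
apply: le_trans (_ : \sum_(B : 'M['I_(2 * H).+1]_(k, k.+1)) (dir B : nat)%:R * F <= _).
  apply: ler_sum => B _; case: (boolP (dir B)) => dB; last by rewrite mul0r big1.
  rewrite mul1r; have g0 := gdir _ dB; set g := Posz _ in g0.
  apply: le_trans (hyp (t %/ g)%Z); apply: ler_sum => a _; rewrite ler_nat /=.
  have /andP[_ /forallP hB] := dB.
  have -> : \sum_j minors (sym_box B) j * sym_box a 0 j = (\sum_j c j * sym_box a 0 j) * g.
    rewrite mulr_suml; apply: eq_bigr => j _.
    by rewrite (eqP (hB j)) -/g -mulrA mulrC.
  by case: eqP => // <-; rewrite mulzK // eqxx.
rewrite -mulr_suml.
(* Each of the k rows of B lies on the hyperplane c.x = 0, and the first row on some translate of
   it: k + 1 factors F. *)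
apply: le_trans (_ : F ^+ k * F <= _).
  rewrite ler_wpM2r //.
  apply: le_trans (_ : (\sum_(a : 'rV['I_(2 * H).+1]_k.+1)
      ((\sum_j c j * sym_box a 0 j == 0) : nat)%:R) ^+ k <= _); last first.
    by rewrite lerXn2r // ?nnegrE // sumr_ge0.
  rewrite -sum_rows_prod; apply: ler_sum => B _.
  case: (boolP (dir B)) => dB; last by apply: prodr_ge0 => i _; rewrite ler0n.
  rewrite big1 // => i _.
  suff -> : (\sum_j c j * sym_box (row i B) 0 j == 0) = true by [].
  apply/eqP/(mulfI (gdir _ dB)); rewrite mulr0 mulr_sumr.
  have /andP[_ /forallP hB] := dB.
  apply: etrans (minors_orthogonal (sym_box B) i); apply: eq_bigr => j _.
  by rewrite mulrA -(eqP (hB j)) !sym_boxE mxE.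
rewrite -exprSr /F expr_div_n ler_wpM2l ?exprn_ge0 //.
have -> : `|c i0|%N%:R ^- k.+1 = \prod_(j < k.+1) `|c i0|%N%:R^-1 :> R.
  by rewrite prodr_const card_ord exprVn.
apply: ler_prod => j _; rewrite invr_ge0 ler0n /= lef_pV2 ?posrE ?ltr0n ?absz_gt0 ?leq_max //.
by rewrite ler_nat geq_max absz_gt0 ci0 cmax.
Qed.
End PrimitiveDirection.

Lemma primitive_quotient k (w : 'I_k -> int) i : w i != 0 ->
  exists c : 'I_k -> int, [/\ forall j, w j = (gcdv w 0)%:Z * c j,
    exists x : 'I_k -> int, \sum_j c j * x j = 1 & forall j, (`|c j| <= `|w j|)%N].
Proof.
move=> wi; have g0 := gcdv0_gt0 wi.
have g0' : (gcdv w 0)%:Z != 0 by rewrite -lt0n.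
exists (fun j => (w j %/ (gcdv w 0)%:Z)%Z).
have cE j : w j = (gcdv w 0)%:Z * (w j %/ (gcdv w 0)%:Z)%Z.
  by rewrite mulrC divzK // dvdzE /= gcdv_dvdl.
split => //.
  have [x hx] := gcdv_bezout w; exists x; apply: (mulfI g0').
  rewrite mulr1 mulr_sumr -[RHS]hx; apply: eq_bigr => j _; by rewrite mulrA -cE.
by move=> j; rewrite [in leqRHS]cE abszM leq_pmull.
Qed.

(** Matrices are sorted by the primitive direction of their cofactor vector. Its entries are no
    larger than the minors, hence at most k! H^k, and the product bound of [direction_count] lets
    the sum over directions factor. *)
Lemma det_value_count (R : realFieldType) k H Y (t : int) : (0 < H)%N -> (k`! * H ^ k <= Y)%N ->
  \sum_(B : 'M['I_(2 * H).+1]_(k, k.+1)) \sum_(a : 'rV['I_(2 * H).+1]_k.+1)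
     ([exists j, minors (sym_box B) j != 0]
      && (\det (col_mx (sym_box a) (sym_box B) : 'M[_]_(k.+1)) == t) : nat)%:R
  <= ((2 * k + 5)%:R ^+ k.+1 * H%:R ^+ k) ^+ k.+1 * reciprocal_sum R Y ^+ k.+1 :> R.
Proof.
move=> H0 HY.
set K := (_ * _) ^+ k.+1.
have K0 : 0 <= K by rewrite /K; nonneg.
pose cc (C : 'rV['I_(2 * Y).+1]_k.+1) j := sym_box C 0 j.
pose dir C (B : 'M['I_(2 * H).+1]_(k, k.+1)) : bool :=
  [exists j, minors (sym_box B) j != 0]
  && [forall j, minors (sym_box B) j == (gcdv (minors (sym_box B)) 0)%:Z * cc C j].
apply: le_trans (_ : \sum_(C : 'rV['I_(2 * Y).+1]_k.+1) K * \prod_j (maxn 1 `|cc C j|)%:R^-1 <= _); last first.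
  rewrite -mulr_sumr ler_wpM2l //.
  rewrite /reciprocal_sum -sum_row_prod; apply: ler_sum => C _.
  by rewrite /cc; under eq_bigr => j _ do rewrite sym_boxE.
apply: le_trans (_ : \sum_(C : 'rV['I_(2 * Y).+1]_k.+1)
  \sum_(B : 'M['I_(2 * H).+1]_(k, k.+1)) \sum_(a : 'rV['I_(2 * H).+1]_k.+1)
     (dir C B && (\sum_j minors (sym_box B) j * sym_box a 0 j == t) : nat)%:R <= _).
  rewrite [leRHS]exchange_big; apply: ler_sum => B _; rewrite [leRHS]exchange_big.
  apply: ler_sum => a _; rewrite det_col_mx_minors.
  case: (boolP [exists j, _]) => [/existsP[j zj]|_] /=; last by rewrite sumr_ge0.
  have [c [hc c1 cle]] := primitive_quotient zj.
  have [C hC] : exists C : 'rV['I_(2 * Y).+1]_k.+1, sym_box C = \row_l c l.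
    apply: sym_box_surj => i l; rewrite mxE -abszE lez_nat.
    apply: leq_trans (cle l) (leq_trans _ HY).
    rewrite -lez_nat abszE /minors normrM normrX normrN1 expr1n mul1r.
    by apply: det_norm_le => i' j'; rewrite mxE sym_box_le.
  rewrite (bigD1 C) //= -[leLHS]addr0; apply: lerD; last by rewrite sumr_ge0.
  rewrite ler_nat; case: (_ == t); rewrite ?andbF ?andbT //.
  suff -> : dir C B = true by [].
  apply/andP; split; first by apply/existsP; exists j.
  by apply/forallP => l; rewrite /cc hC mxE -hc.
apply: ler_sum => C _.
have [B0 dB0|nodir] := pickP (dir C); last first.
  rewrite big1; first by apply: mulr_ge0 => //; apply: prodr_ge0 => j _; rewrite invr_ge0.
  by move=> B _; rewrite big1 // => a _; rewrite nodir.
have /andP[/existsP[j zj] /forallP hB0] := dB0.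
have [i0 _ hmax] := arg_maxnP (fun l => absz (cc C l)) (isT : xpredT j).
have gz : (gcdv (minors (sym_box B0)) 0)%:Z != 0 by rewrite -lt0n (gcdv0_gt0 zj).
have cj : cc C j != 0.
  by apply: contraNneq zj => cj0; rewrite (eqP (hB0 j)) cj0 mulr0.
apply: (@direction_count R k H (cc C) i0 H0).
- by rewrite -absz_gt0; apply: leq_trans (hmax j isT); rewrite absz_gt0.
- by move=> l; apply: hmax.
- have [x hx] := gcdv_bezout (minors (sym_box B0)); exists x; apply: (mulfI gz).
  rewrite mulr1 mulr_sumr -[RHS]hx; apply: eq_bigr => l _.
  by rewrite mulrA -(eqP (hB0 l)).
Qed.

(** * Sets of primes *)

(* Square-free numbers are encoded by finite sets of primes. *)
Definition prime_set P (J : {set 'I_P}) : bool := [forall p in J, prime p].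
Definition set_prod P (J : {set 'I_P}) : nat := (\prod_(p in J) p)%N.

Lemma prod_one_sub (R : realFieldType) P (x : nat -> R) :
  \prod_(p < P | prime p) (1 - x p)
    = \sum_(J : {set 'I_P} | prime_set J) (-1) ^+ #|J| * \prod_(p in J) x p.
Proof.
rewrite big_mkcond /=.
rewrite (eq_bigr (fun p : 'I_P => (if prime p then - x p else 0) + 1)); last first.
  by move=> p _; case: ifP => _; rewrite ?add0r // addrC.
rewrite bigA_distr [RHS]big_mkcond /=; apply: eq_bigr => J _.
rewrite -big_mkcond /=; case: (boolP (prime_set J)) => [/forall_inP pJ|].
  rewrite -prodrN; apply: eq_bigr => p pJ'; by rewrite pJ.
rewrite negb_forall => /existsP[p]; rewrite negb_imply => /andP[pJ np].
by rewrite (bigD1 p) //= (negPf np) mul0r.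
Qed.

Section PrimeSeq.
Implicit Type s : seq nat.

Lemma coprime_prime_seq p s : prime p -> all prime s -> p \notin s ->
  coprime p (\prod_(q <- s) q).
Proof.
move=> pp; elim: s => [|q s IHs] /=; first by rewrite big_nil coprimen1.
rewrite big_cons inE negb_or => /andP[pq ps] /andP[npq nps].
by rewrite coprimeMr IHs // andbT prime_coprime // dvdn_prime2.
Qed.

Lemma sqr_prime_seq_dvd s m : all prime s -> uniq s ->
  ((\prod_(q <- s) q) ^ 2 %| m)%N = all (fun p => p ^ 2 %| m)%N s.
Proof.
elim: s => [|p s IHs] /=; first by rewrite big_nil dvd1n.
move=> /andP[pp ps] /andP[nps us]; rewrite big_cons expnMn Gauss_dvd ?IHs //.
by rewrite coprimeXl // coprimeXr // coprime_prime_seq.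
Qed.

Definition local_density (R : realFieldType) n m : R :=
  (residue_det_count m n)%:R / m%:R ^+ (n ^ 2).

Lemma residue_det_count1 n : residue_det_count 1 n = 1%N.
Proof.
rewrite /residue_det_count; under eq_bigr => T _ do rewrite dvd1z.
by rewrite sum1_card card_mx card_ord exp1n.
Qed.

Lemma local_density_prime_seq (R : realFieldType) n s : all prime s -> uniq s ->
  local_density R n ((\prod_(q <- s) q) ^ 2) = \prod_(q <- s) local_density R n (q ^ 2).
Proof.
rewrite /local_density; elim: s => [|p s IHs] /=.
  by rewrite !big_nil residue_det_count1 expr1n divr1.
move=> /andP[pp ps] /andP[nps us]; rewrite !big_cons -IHs // expnMn.
have s0 : (0 < \prod_(q <- s) q)%N.
  by rewrite big_seq prodn_cond_gt0 // => q /(allP ps)/prime_gt0.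
rewrite residue_det_countM ?expn_gt0 ?s0 ?prime_gt0 //.
  by rewrite !natrM exprMn invfM mulrACA.
by rewrite coprimeXl // coprimeXr // coprime_prime_seq.
Qed.

Lemma size_divisorsM a b : (0 < a)%N -> (0 < b)%N ->
  (size (divisors (a * b)) <= size (divisors a) * size (divisors b))%N.
Proof.
move=> a0 b0; rewrite -[X in (_ <= X)%N](size_allpairs (fun x y => (x * y)%N)).
apply: uniq_leq_size; first exact: divisors_uniq.
move=> f; rewrite -dvdn_divisors ?muln_gt0 ?a0 // => fab.
have g0 : (0 < gcdn f a)%N by rewrite gcdn_gt0 a0 orbT.
have ff : (f = gcdn f a * (f %/ gcdn f a))%N by rewrite mulnC divnK // dvdn_gcdl.
rewrite {1}ff; apply/allpairsP; exists (gcdn f a, (f %/ gcdn f a)%N); split => //=.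
  by rewrite -dvdn_divisors // dvdn_gcdr.
rewrite -dvdn_divisors //.
have cop : coprime (f %/ gcdn f a) (a %/ gcdn f a).
  by rewrite /coprime -(eqn_pmul2r g0) muln_gcdl mul1n !divnK ?dvdn_gcdl ?dvdn_gcdr.
have : (gcdn f a * (f %/ gcdn f a) %| gcdn f a * (a %/ gcdn f a * b))%N.
  by rewrite -ff mulnA [(gcdn f a * _)%N]mulnC divnK ?dvdn_gcdr.
by rewrite dvdn_pmul2l // Gauss_dvdr.
Qed.

Lemma size_divisors_prime_sqr p : prime p -> size (divisors (p ^ 2)) = 3.
Proof.
move=> pp; have p1 := prime_gt1 pp; have p0 := prime_gt0 pp.
have -> : divisors (p ^ 2) = [:: 1; p; p ^ 2]%N; last by [].
apply: (irr_sorted_eq ltn_trans ltnn); first exact: sorted_divisors_ltn.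
  by rewrite /= p1 -{1}(expn1 p) ltn_exp2l.
move=> f; rewrite -dvdn_divisors ?expn_gt0 ?p0 // !inE.
apply/idP/idP => [/dvdn_pfactor|]; last first.
  by case/or3P => /eqP ->; rewrite ?dvd1n ?dvdnn // -{1}(expn1 p) dvdn_exp2l.
move=> /(_ pp)[[|[|[|m]]] // _ ->]; rewrite ?expn0 ?expn1 ?eqxx ?orbT //.
Qed.

Lemma size_divisors_prime_seq s : all prime s ->
  (size (divisors ((\prod_(q <- s) q) ^ 2)) <= 3 ^ size s)%N.
Proof.
elim: s => [|p s IHs] /=; first by rewrite big_nil.
move=> /andP[pp ps]; rewrite big_cons expnMn [(3 ^ _.+1)%N]expnS.
have s0 : (0 < \prod_(q <- s) q)%N.
  by rewrite big_seq prodn_cond_gt0 // => q /(allP ps)/prime_gt0.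
apply: leq_trans (size_divisorsM _ _) _; rewrite ?expn_gt0 ?s0 ?prime_gt0 //.
by rewrite size_divisors_prime_sqr // leq_mul2l IHs.
Qed.
End PrimeSeq.

Section PrimeSets.
Variables (P : nat).
Implicit Type J : {set 'I_P}.

Let sq J := [seq val p | p <- enum J].

Lemma set_prodE (R : Type) (idx : R) (op : Monoid.com_law idx) (f : nat -> R) J :
  \big[op/idx]_(p in J) f p = \big[op/idx]_(p <- sq J) f p.
Proof. by rewrite big_map big_enum. Qed.

Lemma prime_set_seq J : prime_set J -> all prime (sq J) && uniq (sq J).
Proof.
move=> /forall_inP pJ; rewrite map_inj_uniq ?enum_uniq ?andbT; last exact: val_inj.
by apply/allP => _ /mapP[p + ->]; rewrite mem_enum => /pJ.
Qed.

Lemma set_prod_gt0 J : prime_set J -> (0 < set_prod J)%N.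
Proof. by move=> /forall_inP pJ; rewrite prodn_cond_gt0 // => p /pJ/prime_gt0. Qed.

Lemma set_prod_sqr_dvd J m : prime_set J ->
  (set_prod J ^ 2 %| m)%N = [forall p in J, p ^ 2 %| m]%N.
Proof.
move=> /prime_set_seq/andP[pJ uJ].
rewrite /set_prod (set_prodE _ id) sqr_prime_seq_dvd //.
apply/allP/forall_inP => [h p pJ'|h _ /mapP[p + ->]]; last by rewrite mem_enum; apply: h.
by apply: h; apply/mapP; exists p; rewrite ?mem_enum.
Qed.

Lemma local_density_set (R : realFieldType) n J : prime_set J ->
  local_density R n (set_prod J ^ 2) = \prod_(p in J) local_density R n (p ^ 2).
Proof.
move=> /prime_set_seq/andP[pJ uJ].
rewrite /set_prod (set_prodE _ id) local_density_prime_seq //.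
by rewrite (set_prodE _ (fun p => local_density R n (p ^ 2))).
Qed.

Lemma size_divisors_set J : prime_set J ->
  (size (divisors (set_prod J ^ 2)) <= 3 ^ #|J|)%N.
Proof.
move=> /prime_set_seq/andP[pJ uJ].
by rewrite /set_prod (set_prodE _ id) cardE -(size_map val) size_divisors_prime_seq.
Qed.

Lemma mem_prime_set J (p : 'I_P) : prime_set J -> (p \in J) = prime p && (p %| set_prod J)%N.
Proof.
move=> pJ; apply/idP/andP => [pJ'|[pp]].
  by split; [exact: (forall_inP pJ) | rewrite /set_prod (bigD1 p) //= dvdn_mulr].
rewrite /set_prod; elim/big_rec: _ => [|q x qJ IH].
  by rewrite dvdn1 => /eqP p1; rewrite p1 in pp.
rewrite Euclid_dvdM // => /orP[|/IH //].
by rewrite dvdn_prime2 ?(forall_inP pJ q qJ) // => /eqP/val_inj ->.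
Qed.

Lemma set_prod_inj J J' : prime_set J -> prime_set J' -> set_prod J = set_prod J' -> J = J'.
Proof. by move=> pJ pJ' e; apply/setP => p; rewrite !mem_prime_set // e. Qed.

(** Unique factorisation: each d is the product of at most one set of primes. *)
Lemma sum_prime_sets_le (R : realFieldType) (g : nat -> R) D :
  (forall d, 0 <= g d) -> (forall J, prime_set J -> (set_prod J < D)%N) ->
  \sum_(J : {set 'I_P} | prime_set J) g (set_prod J) <= \sum_(d < D | (0 < d)%N) g d.
Proof.
move=> g0 JD.
have D0 : (0 < D)%N.
  by apply: leq_trans (JD finset.set0 _) => //; apply/forall_inP => p; rewrite inE.
case: D => // D in JD D0 *.
rewrite (partition_big (fun J => inord (set_prod J) : 'I_D.+1) (fun d => 0 < d)%N) /=; last first.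
  by move=> J pJ; rewrite inordK ?JD ?set_prod_gt0.
apply: ler_sum => d d0.
have [J0 /andP[pJ0 /eqP dJ0]|none] := pickP (fun J => prime_set J && (inord (set_prod J) == d)).
  rewrite (bigD1 J0) /= ?pJ0 ?dJ0 ?eqxx // big1 ?addr0.
    by rewrite -dJ0 inordK ?JD.
  move=> J /andP[/andP[pJ /eqP dJ] /eqP[]]; apply: set_prod_inj => //.
  by rewrite -[LHS](inordK (JD _ pJ)) -[RHS](inordK (JD _ pJ0)) dJ dJ0.
by rewrite big_pred0.
Qed.
End PrimeSets.

(** * Deviation from the local density *)

(** An upper counterpart of Bernoulli's inequality; the factor x in front is what makes the
    deviation proportional to R/N. *)
Lemma expr1D_le (F : realFieldType) (x : F) e : 0 <= x ->
  (1 + x) ^+ e <= 1 + e%:R * x * (1 + x) ^+ e.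
Proof.
move=> x0; elim: e => [|e IHe]; first by rewrite !expr0 !mul0r addr0.
have X1 : 1 <= (1 + x) ^+ e by rewrite exprn_ege1 // lerDl.
rewrite exprS -natr1; set X := (1 + x) ^+ e in IHe X1 *; set E := e%:R in IHe *.
have E0 : 0 <= E by rewrite ler0n.
have := ler_wpM2l (_ : 0 <= 1 + x) IHe; rewrite addr_ge0 // => /(_ isT) h.
nra.
Qed.

Lemma local_density_ge0 (F : realFieldType) n m : 0 <= local_density F n m.
Proof. by rewrite /local_density; nonneg. Qed.

(** For 4R <= N one has 1 + 32 R/N <= 9. The square 81 appears because the lower estimate uses the
    comparison twice, and 40 = 32 + 8 dominates both kinds of error. *)
Definition dev_const (F : realFieldType) (e : nat) : F := 40 * e%:R ^+ 2 * 81 ^+ e.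

Section Deviation.
Variables (F : realFieldType) (N m R k : nat) (bad : pred 'M[int]_(k.+1, k.+2)) (beta : F).
Hypotheses (m0 : (0 < m)%N) (N0 : (0 < N)%N) (RN : (4 * R <= N)%N) (beta0 : 0 <= beta).
Hypothesis good_cover : forall Y, ~~ bad Y ->
  plane_cover (minors Y ord0) (minors Y (lift ord0 ord0)) m R.
Hypothesis bad_count : forall (t : 'rV[int]_k.+2) (T : 'M[int]_(k.+1, k.+2)),
  \sum_(B : 'M['I_N]_(k.+1, k.+2)) \sum_(a : 'rV['I_N]_k.+2)
    (bad (shift_mx T B)
     && (m%:Z %| \det (col_mx (shift_mx t a) (shift_mx T B) : 'M[_]_(k.+2)))%Z : nat)%:R <= beta.

Lemma det_count_deviation (T : 'M[int]_k.+2) :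
  `|(det_count N m T)%:R - local_density F k.+2 m * N%:R ^+ (k.+2 ^ 2)|
  <= dev_const F (k.+2 ^ 2) * (R%:R / N%:R) * (local_density F k.+2 m * N%:R ^+ (k.+2 ^ 2))
     + dev_const F (k.+2 ^ 2) * beta.
Proof.
have RN' : (2 * R < N)%N by lia.
have cmp := det_count_compare m0 RN' beta0 good_cover bad_count.
set kap := (_ / _) ^+ 2 in cmp.
set e := (k.+2 ^ 2)%N in cmp *.
have e1 : (1 : F) <= e%:R by rewrite ler1n expn_gt0.
set rP := local_density _ _ _ * _.
have rP0 : 0 <= rP by rewrite mulr_ge0 ?local_density_ge0 ?exprn_ge0.
have m0' : (0 : F) < m%:R by rewrite ltr0n.
have N0' : (0 : F) < N%:R by rewrite ltr0n.
have me0 : (0 : F) < m%:R ^+ e by rewrite exprn_gt0.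
have avg : \sum_(S : 'M['I_m]_k.+2) (det_count N m (nat_mx S))%:R = m%:R ^+ e * rP.
  rewrite -natr_sum det_count_average // natrM natrX -/e /rP /local_density -/e.
  by field; rewrite gt_eqF.
have cst (x : F) : \sum_(S : 'M['I_m]_k.+2) x = m%:R ^+ e * x.
  by rewrite sumr_const card_mx card_ord mulnn -/e -[x *+ _]mulr_natl natrX.
have k1 : 1 <= kap.
  rewrite exprn_ege1 // ler_pdivlMr ?mul1r ?ltr0n ?subn_gt0 // ler_nat; lia.
have ke0 : 0 <= kap ^+ e by rewrite exprn_ge0 // (le_trans ler01).
set D := (det_count N m T)%:R.
have up : D <= kap ^+ e * (rP + e%:R * beta).
  rewrite -(ler_pM2l me0) mulrCA mulrDr -avg -!cst -big_split /= mulr_sumr.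
  by apply: ler_sum => S _; apply: cmp.
have lo : rP <= kap ^+ e * (D + e%:R * beta).
  rewrite -(ler_pM2l me0) -avg -cst; apply: ler_sum => S _; exact: cmp.
set r := R%:R / N%:R.
have r0 : 0 <= r by rewrite /r; nonneg.
have r4 : 4 * r <= 1 by rewrite /r mulrA ler_pdivrMr // mul1r -natrM ler_nat.
have kr : kap <= 1 + 32 * r.
  have -> : kap = ((1 + 2 * r) / (1 - 2 * r)) ^+ 2.
    rewrite /kap natrB; last exact: ltnW.
    rewrite natrD !natrM /r; congr (_ ^+ 2); field.
    rewrite gt_eqF //= subr_eq0 gt_eqF // -natrM ltr_nat //.
  have d0 : 0 < 1 - 2 * r by lra.
  rewrite expr_div_n ler_pdivrMr ?exprn_gt0 //.
  (* The identity is (1 + 32 r)(1 - 2 r)^2 - (1 + 2 r)^2 = 8 r (1 - 4 r)(3 - 4 r). *)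
  have := mulr_ge0 (mulr_ge0 r0 (_ : 0 <= 1 - 4 * r)) (_ : 0 <= 3 - 4 * r).
  rewrite !subr_ge0 r4 => /(_ isT); rewrite (_ : 4 * r <= 3); last by lra.
  by move=> /(_ isT) h; rewrite -subr_ge0; apply: le_trans (mulr_ge0 (ler0n _ 8) h) _;
     rewrite le_eqVlt; apply/orP; left; apply/eqP; ring.
have h1 : kap ^+ e <= (1 + 32 * r) ^+ e by rewrite lerXn2r // nnegrE; lra.
have h9 : (1 + 32 * r) ^+ e <= 9 ^+ e by rewrite lerXn2r // ?nnegrE; lra.
have h2 := expr1D_le e (_ : 0 <= 32 * r); rewrite mulr_ge0 // in h2; move/(_ isT) in h2.
have n9 : 1 <= (9 : F) ^+ e by rewrite exprn_ege1 // ler1n.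
have E81 : (81 : F) ^+ e = 9 ^+ e * 9 ^+ e by rewrite -exprMn -natrM.
set X := kap ^+ e in up lo h1 ke0 *; set Z := (1 + 32 * r) ^+ e in h1 h9 h2.
rewrite /dev_const E81; set Y := (9 : F) ^+ e in n9 h9 *; set E := e%:R in e1 up lo h2 *.
have D0 : 0 <= D by rewrite /D.
have XY : X <= Y := le_trans h1 h9.
have E0 : 0 <= E by apply: le_trans e1.
have Xs : X - 1 <= 32 * E * r * Y.
  have c0 : 0 <= E * (32 * r) by nonneg.
  have := ler_wpM2l c0 h9; lra.
have Y0 : 0 <= Y by apply: le_trans n9.
have Eb : 0 <= E * beta by rewrite mulr_ge0.
have up1 : D - rP <= 32 * E * r * Y * rP + Y * (E * beta).
  have := ler_wpM2r rP0 Xs; have := ler_wpM2r Eb XY; lra.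
(* In the lower estimate the error is proportional to D itself, so the upper estimate is fed back
   into it. *)
have DY : D <= Y * (rP + E * beta).
  by apply: le_trans up _; rewrite ler_wpM2r // addr_ge0.
have lo1 : rP - D <= 32 * E * r * Y * (Y * (rP + E * beta)) + Y * (E * beta).
  have c0 : 0 <= 32 * E * r * Y by nonneg.
  have := ler_wpM2r D0 Xs; have := ler_wpM2l c0 DY; have := ler_wpM2r Eb XY; lra.
have YY : Y <= Y * Y by rewrite ler_peMr.
have EE : E <= E ^+ 2 by rewrite expr2 ler_peMr.
have a1 : E * Y * (r * rP) <= E ^+ 2 * (Y * Y) * (r * rP).
  by apply: ler_wpM2r; [nonneg | apply: ler_pM].
have a2 : E * (Y * Y) * (r * rP) <= E ^+ 2 * (Y * Y) * (r * rP).
  by apply: ler_wpM2r; [nonneg | apply: ler_wpM2r; [nonneg | ]].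
have a3 : E * Y * beta <= E ^+ 2 * (Y * Y) * beta.
  by apply: ler_wpM2r; [nonneg | apply: ler_pM].
have a4 : (4 * r) * (E ^+ 2 * (Y * Y) * beta) <= 1 * (E ^+ 2 * (Y * Y) * beta).
  by rewrite ler_wpM2r //; nonneg.
have a0 : 0 <= E ^+ 2 * (Y * Y) * (r * rP) by nonneg.
have a5 : 0 <= E ^+ 2 * (Y * Y) * beta by nonneg.
have eqB : 32 * E * r * Y * (Y * (rP + E * beta)) = 32 * (E * (Y * Y) * (r * rP))
   + 8 * ((4 * r) * (E ^+ 2 * (Y * Y) * beta)) by ring.
rewrite eqB in lo1.
have eqA : 32 * E * r * Y * rP = 32 * (E * Y * (r * rP)) by ring.
rewrite eqA in up1.
have -> : 40 * E ^+ 2 * (Y * Y) * r * rP + 40 * E ^+ 2 * (Y * Y) * beta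
  = 40 * (E ^+ 2 * (Y * Y) * (r * rP)) + 40 * (E ^+ 2 * (Y * Y) * beta) by ring.
have eqC : Y * (E * beta) = E * Y * beta by ring.
rewrite eqC in lo1 up1.
move: a0 a1 a2 a3 a4 a5 lo1 up1.
set A1 := E ^+ 2 * (Y * Y) * (r * rP); set A2 := E ^+ 2 * (Y * Y) * beta.
move=> *; rewrite ler_norml; apply/andP; split; lra.
Qed.
End Deviation.

Lemma det_count_small (F : realFieldType) N m k (T : 'M[int]_k.+2) :
  (0 < m)%N -> (4 * m <= N)%N ->
  `|(det_count N m T)%:R - local_density F k.+2 m * N%:R ^+ (k.+2 ^ 2)|
  <= dev_const F (k.+2 ^ 2) * (m%:R / N%:R) * (local_density F k.+2 m * N%:R ^+ (k.+2 ^ 2)).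
Proof.
move=> m0 mN; have N0 : (0 < N)%N by lia.
have := @det_count_deviation F N m m k pred0 0 m0 N0 mN (lexx 0).
rewrite mulr0 addr0; apply=> [Y _|t T']; first exact: plane_cover_mod.
by rewrite big1 // => B _; rewrite big1.
Qed.

(** At most 9 L^2 pairs (u, v) are tried, and [short_relation_count] contributes one more L. *)
Definition short_relation_const (F : realFieldType) (N m n L : nat) : F :=
  9 * L%:R ^+ 3 * 2 ^+ n * (1 + m%:R / N%:R) * peel_cost F N m n ^+ n.-1 / m%:R ^+ 2.

Lemma det_count_medium (F : realFieldType) N m L M k (T : 'M[int]_k.+2) :
  (0 < m)%N -> (0 < L)%N -> (m < M.+1 * L.+1)%N -> (0 < N)%N -> (4 * (M + L) <= N)%N ->
  `|(det_count N m T)%:R - local_density F k.+2 m * N%:R ^+ (k.+2 ^ 2)|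
  <= dev_const F (k.+2 ^ 2) * ((M + L)%:R / N%:R) * (local_density F k.+2 m * N%:R ^+ (k.+2 ^ 2))
     + dev_const F (k.+2 ^ 2) * (short_relation_const F N m k.+2 L * N%:R ^+ (k.+2 ^ 2)).
Proof.
move=> m0 L0 mML N0 MLN.
pose c (u : 'I_(2 * L).+1) : int := (u : nat)%:Z - L%:Z.
have cL u : (`|c u| <= L)%N by rewrite /c; have := ltn_ord u; lia.
pose rel (u v : 'I_(2 * L).+1) (Y : 'M[int]_(k.+1, k.+2)) : bool :=
  ((c u != 0) || (c v != 0)) && (m%:Z %| c u * minors Y ord0 + c v * minors Y (lift ord0 ord0))%Z.
(* Badness is a finite disjunction over the pairs (u, v) in [-L, L]^2, so its count is estimated by
   a union bound. *)
pose bad (Y : 'M[int]_(k.+1, k.+2)) : bool := [exists u, exists v, rel u v Y].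
apply: (@det_count_deviation F N m (M + L) k bad) => //.
- by rewrite /short_relation_const /peel_cost; nonneg.
- move=> Y; rewrite negb_exists => /forallP gY; apply: plane_cover_short => // u v uv uL vL.
  have [eu cu] : exists eu, c eu = u by exists (inord (absz (u + L%:Z))); rewrite /c inordK; lia.
  have [ev cv] : exists ev, c ev = v by exists (inord (absz (v + L%:Z))); rewrite /c inordK; lia.
  have := gY eu; rewrite negb_exists => /forallP/(_ ev); rewrite /rel cu cv uv.
  by [].
move=> t T'.
apply: le_trans (_ : \sum_u \sum_v (2 ^+ k.+2 * (1 + m%:R / N%:R) * peel_cost F N m k.+2 ^+ k.+1 * L%:R
      / m%:R ^+ 2 * N%:R ^+ (k.+2 ^ 2)) <= _).
  apply: le_trans (_ : \sum_u \sum_v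
    \sum_(B : 'M['I_N]_(k.+1, k.+2)) \sum_(a : 'rV['I_N]_k.+2) (rel u v (shift_mx T' B)
     && (m%:Z %| \det (col_mx (shift_mx t a) (shift_mx T' B) : 'M[_]_(k.+2)))%Z : nat)%:R <= _).
    under [leRHS]eq_bigr => u _ do rewrite exchange_big /=.
    rewrite [leRHS]exchange_big /=; apply: ler_sum => B _.
    under [leRHS]eq_bigr => u _ do rewrite exchange_big /=.
    rewrite [leRHS]exchange_big /=; apply: ler_sum => a _.
    case: (boolP (bad _)) => [/existsP[u /existsP[v ruv]]|_] /=; last first.
      by apply: sumr_ge0 => u _; apply: sumr_ge0 => v _; rewrite ler0n.
    rewrite (bigD1 u) //= (bigD1 v) //= ruv /= -addrA lerDl addr_ge0 //.
      by apply: sumr_ge0 => v' _; rewrite ler0n.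
    by apply: sumr_ge0 => u' _; apply: sumr_ge0 => v' _; rewrite ler0n.
  apply: ler_sum => u _; apply: ler_sum => v _.
  rewrite /rel; case: (boolP (_ || _)) => uv; last first.
    rewrite big1 => [|B _]; last by rewrite big1.
    by rewrite /peel_cost; nonneg.
  exact: short_relation_count.
rewrite !sumr_const card_ord -mulrnA -[leLHS]mulr_natl.
set W := _ * N%:R ^+ _.
have W0 : 0 <= W by rewrite /W /peel_cost; nonneg.
apply: le_trans (_ : (9 * L ^ 2)%:R * W <= _).
  rewrite ler_wpM2r // ler_nat; nia.
by rewrite /W /short_relation_const natrM natrX /= le_eqVlt; apply/orP; left; apply/eqP; ring.
Qed.

(** * Real estimates *)

Lemma powRDgt0 (R : realType) (x a b : R) : 0 < x -> x `^ (a + b) = x `^ a * x `^ b.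
Proof. by move=> x0; rewrite powRD // (gt_eqF x0) implybT. Qed.

Lemma powR_ge1 (R : realType) (x a : R) : 1 <= x -> 0 <= a -> 1 <= x `^ a.
Proof. by move=> x1 a0; have := ler_powR x1 a0; rewrite powRr0. Qed.

(* [(x-1)^-s >= x^-s exp (s/x)] since [ln (1 - 1/x) <= -1/x]. *)
Lemma powR_telescope (R : realType) (s x : R) : 0 < s -> 1 < x ->
  x `^ (- (1 + s)) <= s^-1 * ((x - 1) `^ (- s) - x `^ (- s)).
Proof.
move=> s0 x1; have x0 : 0 < x by lra.
have xm0 : 0 < x - 1 by lra.
have E (y a : R) : 0 < y -> y `^ a = expR (a * ln y) by move=> y0; rewrite /powR gt_eqF.
have lnx : ln (x - 1) <= ln x - x^-1.
  have -> : x - 1 = x * (1 - x^-1) by rewrite mulrBr mulr1 divff // gt_eqF.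
  have xi : x^-1 < 1 by rewrite invf_lt1.
  rewrite lnM ?posrE ?subr_gt0 // lerD2l; apply: le_ln1Dx; lra.
have h : x `^ (- s) * (1 + s / x) <= (x - 1) `^ (- s).
  rewrite !E //; apply: le_trans (ler_wpM2l (expR_ge0 _) (expR_ge1Dx _)) _.
  rewrite -expRD ler_expR; have := ler_wpM2l (ltW s0) lnx; lra.
rewrite ler_pdivlMl // opprD powRDgt0 // powR_inv1 ?(ltW x0) //.
have -> : s * (x^-1 * x `^ (- s)) = x `^ (- s) * (s / x) by ring.
lra.
Qed.

(** The first term is at most d0^-s, and the remaining ones telescope by [powR_telescope] to at most
    d0^-s / s. *)
Lemma sum_powR_tail (R : realType) (s : R) d0 D : 0 < s -> (0 < d0)%N ->
  \sum_(d < D | (d0 <= d)%N) (d : nat)%:R `^ (- (1 + s)) <= (1 + s^-1) * d0%:R `^ (- s).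
Proof.
move=> s0 d00; have si : 0 <= s^-1 by rewrite invr_ge0 ltW.
have d1 : (1 : R) <= d0%:R by rewrite ler1n.
case: (leqP D d0) => [Dd|dD].
  rewrite big1 ?mulr_ge0 ?powR_ge0 ?addr_ge0 // => i id0.
  by have := leq_trans (ltn_ord i) Dd; rewrite ltnNge id0.
suff main e : \sum_(d < (d0 + e).+1 | (d0 <= d)%N) (d : nat)%:R `^ (- (1 + s))
    <= (1 + s^-1) * d0%:R `^ (- s) - s^-1 * (d0 + e)%:R `^ (- s) :> R.
  have -> : D = (d0 + (D - d0.+1)).+1 by lia.
  apply: le_trans (main _) _; rewrite lerBlDr lerDl mulr_ge0 ?powR_ge0 //.
elim: e => [|e IHe].
  rewrite addn0 big_mkcond big_ord_recr /= leqnn big1 => [|i _]; last first.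
    by rewrite leqNgt ltn_ord.
  rewrite add0r mulrDl mul1r addrK; apply: ler_powR => //; lra.
rewrite addnS big_mkcond big_ord_recr /= -big_mkcond /= ifT; last by lia.
apply: le_trans (lerD IHe (powR_telescope s0 (_ : 1 < (d0 + e).+1%:R))) _.
  by rewrite ltr1n; lia.
have e1 : (d0 + e).+1%:R - 1 = (d0 + e)%:R :> R by rewrite -natr1 addrK.
rewrite e1; lra.
Qed.

(** Primes p >= 3^(1/eps) satisfy 3 <= p^eps; the boundedly many smaller ones go into the constant.
    With [size_divisors_set] this bounds the number of divisors of d^2. *)
Lemma card_prime_set_bound (R : realType) (eps : R) : 0 < eps ->
  exists2 C : R, 1 <= C & forall P (J : {set 'I_P}), prime_set J ->
    (3 ^ #|J|)%:R <= C * (set_prod J)%:R `^ eps.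
Proof.
move=> e0; pose B := Num.Def.archi_bound (3 `^ eps^-1 : R).
have Bp p : (B <= p)%N -> 3 <= p%:R `^ eps :> R.
  move=> Bp; have h : 3 `^ eps^-1 <= p%:R :> R.
    apply: le_trans (_ : B%:R <= _); last by rewrite ler_nat.
    by rewrite ltW // archi_boundP // powR_ge0.
  have := ge0_ler_powR (ltW e0) (_ : 3 `^ eps^-1 \in Num.nneg) (_ : p%:R \in Num.nneg) h.
  rewrite !nnegrE powR_ge0 ler0n -powRrM mulVf ?gt_eqF // powRr1 ?ler0n //; exact.
exists (3 ^+ B) => [|P J pJ]; first by rewrite exprn_ege1 // ler1n.
have -> : (3 ^ #|J|)%:R = \prod_(p in J) 3 :> R by rewrite prodr_const natrX.
have -> : (set_prod J)%:R `^ eps = \prod_(p in J) (p : nat)%:R `^ eps.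
  rewrite /set_prod; elim/big_rec2: _ => [|p x y pJ' <-]; first by rewrite powR1.
  by rewrite natrM powRM.
apply: le_trans (_ : \prod_(p in J) ((if (p < B)%N then 3 else 1) * (p : nat)%:R `^ eps) <= _).
  apply: ler_prod => p pJ'; rewrite ler0n /=; case: ltnP => [_|/Bp]; last by rewrite mul1r.
  rewrite ler_peMr //; apply: powR_ge1; last exact: ltW.
  by rewrite ler1n prime_gt0 // (forall_inP pJ).
rewrite big_split /=; apply: ler_wpM2r; first by apply: prodr_ge0 => p _; apply: powR_ge0.
rewrite -big_mkcondr /= prodr_const ler_eXn2l ?ltr1n //.
apply: leq_trans (_ : #|'I_B| <= _)%N; last by rewrite card_ord.
case EB: B => [|B'].
  by rewrite eq_card0 // => p; rewrite !inE andbF.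
apply: (leq_card_in (fun p : 'I_P => inord p : 'I_B'.+1)) => p q.
move=> /andP[_ pB] /andP[_ qB] /(congr1 val) /=; rewrite !inordK // => e.
exact: val_inj.
Qed.

Lemma reciprocal_sum_le (R : realFieldType) Y :
  reciprocal_sum R Y <= 1 + 2 * \sum_(i < Y) (i.+1)%:R^-1.
Proof.
pose f (x : nat) : R := (maxn 1 (absz (x%:Z - Y%:Z)))%:R^-1.
rewrite /reciprocal_sum -(big_mkord xpredT f) (@big_cat_nat _ _ _ Y) //=; last by lia.
have -> : \sum_(0 <= i < Y) f i = \sum_(i < Y) (i.+1)%:R^-1.
  rewrite big_mkord (reindex_inj rev_ord_inj); apply: eq_bigr => i _.
  by rewrite /f /=; congr (_%:R^-1); have := ltn_ord i; lia.
have -> : \sum_(Y <= i < (2 * Y).+1) f i = 1 + \sum_(i < Y) (i.+1)%:R^-1.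
  rewrite -{1}[Y]add0n big_addn (_ : (2 * Y).+1 - Y = Y.+1)%N; last by lia.
  rewrite big_mkord big_ord_recl; congr (_ + _); last first.
    by apply: eq_bigr => i _; rewrite /f /=; congr (_%:R^-1); rewrite /bump; lia.
  by rewrite /f add0n subrr invr1.
lra.
Qed.

Lemma reciprocal_sum_bound (R : realType) (eps : R) : 0 < eps ->
  exists2 C : R, 0 < C & forall Y, (0 < Y)%N -> reciprocal_sum R Y <= C * Y%:R `^ eps.
Proof.
move=> e0; have ei : 0 < eps^-1 by rewrite invr_gt0.
exists (3 + 2 * eps^-1) => [|Y Y0]; first by lra.
have Y1 : (1 : R) <= Y%:R `^ eps.
  by apply: powR_ge1; [rewrite ler1n | apply: ltW].
apply: le_trans (reciprocal_sum_le R Y) _.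
(* Since i + 1 <= Y, one has 1/(i+1) <= Y^eps (i+1)^-(1+eps), and the latter powers have a bounded
   sum. *)
have h : \sum_(i < Y) (i.+1)%:R^-1 <= Y%:R `^ eps * (1 + eps^-1) :> R.
  have := sum_powR_tail Y.+1 e0 (ltn0Sn 0); rewrite powR1 mulr1 => hh.
  apply: le_trans (ler_wpM2l (powR_ge0 Y%:R eps) hh).
  rewrite mulr_sumr [leRHS]big_mkcond big_ord_recl /= add0r; apply: ler_sum => i _.
  rewrite /bump /= add1n opprD powRDgt0 ?ltr0n // powR_inv1 ?ler0n // mulrCA.
  rewrite ler_peMr ?invr_ge0 ?ler0n // powRN ler_pdivlMr ?powR_gt0 ?ltr0n // mul1r.
  by apply: ge0_ler_powR; rewrite ?nnegrE ?ler0n ?ler_nat ?(ltn_ord i) // ltW.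
lra.
Qed.

(** * Square-free determinants as a sum over sets of primes *)

Lemma mx_of_sym_box n H (A : 'M['I_(2 * H).+1]_n) : mx_of A = sym_box A.
Proof. by apply/matrixP => i j; rewrite sym_boxE mxE. Qed.

(** The factor [t != 0] restricts the later sum over d to nonzero determinants, whose multiples of
    d^2 become rare as d grows. *)
Lemma squarefree_int_prod (R : realFieldType) (t : int) P : (`|t| + 2 < P)%N ->
  (squarefree_int t : nat)%:R = (t != 0 : nat)%:R *
    \prod_(p < P | prime p) (1 - (p ^ 2 %| `|t| : nat)%N%:R) :> R.
Proof.
move=> tP; have [->|t0] := eqVneq t 0.
  rewrite mul0r; case: (boolP (squarefree_int 0)) => // /forallP/(_ (inord 2)).
  by rewrite inordK.
rewrite mul1r; case: (boolP (squarefree_int t)) => [/forallP sf|].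
  rewrite big1 // => p pp; case: (boolP (p ^ 2 %| `|t|)%N) => [pt|_]; last by rewrite subr0.
  have pt' : (p < `|t|.+3)%N.
    have h : (p ^ 2 <= `|t|)%N by rewrite dvdn_leq // absz_gt0.
    by have := leq_pmulr p (prime_gt0 pp); rewrite mulnn; lia.
  by have := sf (inord p); rewrite inordK // pp /= pt.
rewrite negb_forall => /existsP[p]; rewrite negb_imply negbK => /andP[pp pt].
have pP : (p < P)%N by apply: leq_trans (ltn_ord p) _; lia.
by rewrite (bigD1 (Ordinal pP)) //= pt subrr mul0r.
Qed.

Lemma S_count_expand (R : realFieldType) n H P : (n`! * H ^ n + 2 < P)%N ->
  (S_count n H)%:R = \sum_(J : {set 'I_P} | prime_set J) (-1) ^+ #|J| *
    \sum_(A : 'M['I_(2 * H).+1]_n)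
      ((\det (sym_box A) != 0) && ((set_prod J ^ 2)%N%:Z %| \det (sym_box A))%Z : nat)%:R :> R.
Proof.
move=> hP.
under eq_bigr => J _ do rewrite mulr_sumr.
rewrite exchange_big /= /S_count -sum1_card natr_sum big_mkcond /=; apply: eq_bigr => A _.
rewrite inE mx_of_sym_box; set t := \det _.
have tP : (`|t| + 2 < P)%N.
  apply: leq_ltn_trans hP; rewrite leq_add2r -lez_nat abszE.
  by apply: det_norm_le => i j; apply: sym_box_le.
transitivity ((squarefree_int t : nat)%:R : R); first by case: (squarefree_int t).
rewrite (squarefree_int_prod R tP).
rewrite (prod_one_sub P (fun p => (p ^ 2 %| `|t| : nat)%N%:R)) mulr_sumr.
apply: eq_bigr => J pJ; rewrite mulrCA; congr (_ * _).
rewrite dvdzE absz_nat set_prod_sqr_dvd //.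
case: (t != 0); rewrite ?mul0r //= mul1r.
case: (boolP [forall p in J, p ^ 2 %| `|t|]%N) => [/forall_inP h|].
  by rewrite big1 // => p pJ'; rewrite h.
rewrite negb_forall => /existsP[p]; rewrite negb_imply => /andP[pJ' np].
by rewrite (bigD1 p) //= (negPf np) mul0r.
Qed.

Lemma frakS_partial_expand (R : realType) n P :
  frakS_partial R n P = \sum_(J : {set 'I_P} | prime_set J) (-1) ^+ #|J| *
    local_density R n (set_prod J ^ 2).
Proof.
rewrite /frakS_partial.
transitivity (\prod_(p < P | prime p) (1 - local_density R n (p ^ 2))).
  apply: eq_bigr => p pp.
  by rewrite /local_density natrX residue_density_prime // subKr.
rewrite (prod_one_sub P (fun p => local_density R n (p ^ 2))).
by apply: eq_bigr => J pJ; rewrite local_density_set.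
Qed.

Definition singular_count (n H : nat) : nat :=
  (\sum_(A : 'M['I_(2 * H).+1]_n) (\det (sym_box A) == 0%R))%N.

Definition nonsingular_multiple_count (n H m : nat) : nat :=
  (\sum_(A : 'M['I_(2 * H).+1]_n)
     ((\det (sym_box A) != 0%R) && (m%:Z %| \det (sym_box A))%Z))%N.

Definition multiple_count (n H m : nat) : nat :=
  det_count (2 * H).+1 m (const_mx (- H%:Z) : 'M[int]_n).

Lemma multiple_count_split n H m :
  multiple_count n H m = (nonsingular_multiple_count n H m + singular_count n H)%N.
Proof.
rewrite /multiple_count /det_count -big_split /=; apply: eq_bigr => A _.
rewrite -/(sym_box A); case: eqP => [->|_] /=; first by rewrite dvdz0.
by rewrite addn0.
Qed.

(** Up to Q the singular matrices are added back, because it is the full count whose average over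
    translates is known. Beyond Q they stay out, since 0 is divisible by every d^2. *)
Lemma S_count_split (R : realType) n H P Q : (n`! * H ^ n + 2 < P)%N ->
  `|(S_count n H)%:R - (2 * H).+1%:R ^+ (n ^ 2) * frakS_partial R n P| <=
  \sum_(J : {set 'I_P} | prime_set J) (if (set_prod J <= Q)%N then
      `|(multiple_count n H (set_prod J ^ 2))%:R
         - local_density R n (set_prod J ^ 2) * (2 * H).+1%:R ^+ (n ^ 2)| + (singular_count n H)%:R
    else (nonsingular_multiple_count n H (set_prod J ^ 2))%:R
         + local_density R n (set_prod J ^ 2) * (2 * H).+1%:R ^+ (n ^ 2)).
Proof.
move=> hP; rewrite (S_count_expand R hP) frakS_partial_expand mulr_sumr -sumrB.
apply: le_trans (ler_norm_sum _ _ _) _; apply: ler_sum => J pJ.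
rewrite mulrCA -mulrBr normrM normrX normrN1 expr1n mul1r -natr_sum.
rewrite -/(nonsingular_multiple_count n H (set_prod J ^ 2)) mulrC.
set X := _ * _ ^+ _; have X0 : 0 <= X by rewrite mulr_ge0 ?local_density_ge0 ?exprn_ge0.
case: ifP => _; last first.
  by apply: le_trans (ler_normB _ _) _; rewrite normr_nat ger0_norm.
rewrite multiple_count_split natrD.
set a := _%:R; set b := _%:R.
have b0 : 0 <= b by rewrite ler0n.
have -> : a - X = (a + b - X) - b by ring.
by apply: le_trans (ler_normB _ _) _; rewrite (ger0_norm b0).
Qed.

(** The bound of [det_value_count], of order H^(n^2 - n) up to logarithms, where n = k + 1. *)
Definition value_bound (R : realFieldType) k H : R :=
  ((2 * k + 5)%:R ^+ k.+1 * H%:R ^+ k) ^+ k.+1 * reciprocal_sum R (k`! * H ^ k) ^+ k.+1.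

Lemma reciprocal_sum_ge0 (R : realFieldType) Y : 0 <= reciprocal_sum R Y.
Proof. by apply: sumr_ge0 => x _; rewrite invr_ge0. Qed.

Lemma value_bound_ge0 (R : realFieldType) k H : 0 <= value_bound R k H.
Proof. by have := reciprocal_sum_ge0 R (k`! * H ^ k); rewrite /value_bound => ?; nonneg. Qed.

Lemma sum_square_rows (S : nmodType) (T : finType) k (F : 'M[T]_k.+1 -> S) :
  \sum_A F A = \sum_(B : 'M[_]_(k, k.+1)) \sum_(a : 'rV_k.+1) F (col_mx a B).
Proof. by rewrite (@sum_col_mx _ _ 1 k k.+1) exchange_big. Qed.

Lemma sym_box_col_mx k H (a : 'rV['I_(2 * H).+1]_k.+1) (B : 'M[_]_(k, k.+1)) :
  sym_box (col_mx a B : 'M[_]_(k.+1)) = col_mx (sym_box a) (sym_box B).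
Proof.
by apply/matrixP => i j; rewrite sym_boxE !mxE; case: splitP => l _; rewrite sym_boxE.
Qed.

Lemma nonzero_value_count (R : realFieldType) k H (t : int) : (0 < H)%N -> t != 0 ->
  \sum_(A : 'M['I_(2 * H).+1]_k.+1) ((\det (sym_box A) == t) : nat)%:R <= value_bound R k H.
Proof.
move=> H0 t0; apply: le_trans (det_value_count R t H0 (leqnn _)).
rewrite sum_square_rows; apply: ler_sum => B _; apply: ler_sum => a _.
rewrite sym_box_col_mx ler_nat; case: (boolP [exists j, _]) => //=.
rewrite negb_exists => /forallP h; rewrite det_col_mx_minors big1 => [|j _].
  by rewrite eq_sym (negPf t0).
by have := h j; rewrite negbK => /eqP ->; rewrite mul0r.
Qed.

(** Either some minor of the lower rows is nonzero and [det_value_count] applies with t = 0, or all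
    of them vanish. *)
Lemma singular_count_le (R : realFieldType) k H : (0 < H)%N ->
  (singular_count k.+1 H)%:R <= value_bound R k H
    + k%:R * 4 ^+ k * (2 * H).+1%:R ^+ (k.+1 ^ 2) / (2 * H).+1%:R ^+ 2 :> R.
Proof.
move=> H0; rewrite /singular_count natr_sum sum_square_rows.
apply: le_trans (_ : \sum_(B : 'M['I_(2 * H).+1]_(k, k.+1)) \sum_(a : 'rV['I_(2 * H).+1]_k.+1)
   ((([exists j, minors (sym_box B) j != 0]
      && (\det (col_mx (sym_box a) (sym_box B) : 'M[_]_(k.+1)) == 0)) : nat)%:R
    + ([forall j, minors (sym_box B) j == 0] : nat)%:R) <= _).
  apply: ler_sum => B _; apply: ler_sum => a _; rewrite sym_box_col_mx.
  rewrite -natrD ler_nat; case: (\det _ == 0) => //; rewrite andbT.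
  by rewrite -negb_forall; case: [forall _, _].
under eq_bigr => B _ do rewrite big_split /=.
rewrite big_split /=; apply: lerD; first exact: det_value_count.
under eq_bigr => B _ do rewrite sumr_const card_mx card_ord mul1n -[_ *+ _]mulr_natl.
rewrite -mulr_sumr.
apply: le_trans (ler_wpM2l _ (zero_minors_count R _ (ltn0Sn _))) _; first exact: ler0n.
have -> : (k.+1 ^ 2 = k.+1 + k * k.+1)%N by ring.
by rewrite natrX exprD le_eqVlt; apply/orP; left; apply/eqP; ring.
Qed.

(** Excluding 0 leaves at most 2 M/m values in [-M, M], with no additive term, so the sum over
    arbitrarily large d converges. *)
Lemma nonsingular_multiple_count_le (R : realFieldType) k H m : (0 < H)%N -> (0 < m)%N ->
  (nonsingular_multiple_count k.+1 H m)%:R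
    <= 2 * ((k.+1)`! * H ^ k.+1)%:R * value_bound R k H / m%:R :> R.
Proof.
move=> H0 m0; set M := ((k.+1)`! * H ^ k.+1)%N.
rewrite /nonsingular_multiple_count natr_sum.
apply: le_trans (_ : \sum_(A : 'M['I_(2 * H).+1]_k.+1) \sum_(j < M %/ m)
   (((\det (sym_box A) == (j.+1 * m)%N%:Z) : nat)%:R
     + ((\det (sym_box A) == - (j.+1 * m)%N%:Z) : nat)%:R) <= _).
  apply: ler_sum => A _; set t := \det _.
  case: (boolP (_ && _)) => [/andP[t0 mt]|_]; last by apply: sumr_ge0 => j _; rewrite addr_ge0.
  have tM : (`|t| <= M)%N.
    by rewrite -lez_nat abszE; apply: det_norm_le => i j; apply: sym_box_le.
  move: mt; rewrite dvdzE absz_nat => /dvdnP[q tq].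
  have q0 : (0 < q)%N by move: t0; rewrite -absz_gt0 tq muln_gt0 => /andP[].
  have qM : (q.-1 < M %/ m)%N by rewrite prednK // leq_divRL // -tq.
  rewrite (bigD1 (Ordinal qM)) //= prednK // -[leLHS]addr0; apply: lerD.
    have [e|e] : t = `|t|%N%:Z \/ t = - `|t|%N%:Z by lia.
      by rewrite -natrD ler_nat -tq -e eqxx.
    by rewrite -natrD ler_nat -tq -e eqxx addn1.
  by apply: sumr_ge0 => j _; rewrite addr_ge0.
rewrite exchange_big /=.
apply: le_trans (_ : \sum_(j < M %/ m) (value_bound R k H + value_bound R k H) <= _).
  apply: ler_sum => j _; rewrite big_split /=; apply: lerD; apply: nonzero_value_count => //.
    by rewrite -lt0n muln_gt0.
  by rewrite oppr_eq0 -lt0n muln_gt0.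
rewrite sumr_const card_ord -[_ *+ (M %/ m)]mulr_natl.
have V0 := value_bound_ge0 R k H; set V := value_bound _ _ _ in V0 *.
have h : (M %/ m)%:R <= M%:R / m%:R :> R.
  by rewrite ler_pdivlMr ?ltr0n // -natrM ler_nat leq_divM.
have -> : 2 * M%:R * V / m%:R = M%:R / m%:R * (V + V) by ring.
by rewrite ler_wpM2r // addr_ge0.
Qed.

(** The subtracted power makes the induction close: x^(n+2) <= 2 x^(n+2) - 2 x^(n+3) when 2x <=
    1. *)
Lemma one_sub_prod_le (R : realFieldType) (x : R) n : 0 <= x -> 2 * x <= 1 ->
  1 - \prod_(2 <= j < n.+2) (1 - x ^+ j) <= 2 * x ^+ 2 - 2 * x ^+ n.+2
  /\ 0 <= \prod_(2 <= j < n.+2) (1 - x ^+ j) <= 1.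
Proof.
move=> x0 x2; elim: n => [|n [IH1 /andP[IH2 IH3]]].
  by rewrite big_geq // subrr subrr lexx ler01 lexx.
rewrite big_nat_recr //=; set p := \prod_(_ <= j < _) _ in IH1 IH2 IH3 *.
have y0 : 0 <= x ^+ n.+2 by apply: exprn_ge0.
have y1 : x ^+ n.+2 <= 1 by rewrite exprn_ile1 //; lra.
rewrite [x ^+ n.+3]exprS; move: (x ^+ n.+2) y0 y1 IH1 => y y0 y1 IH1.
have h1 := ler_wpM2r y0 x2.
have h2 := ler_wpM2r y0 IH3.
have h3 := mulr_ge0 IH2 y0.
have y1' : 0 <= 1 - y by lra.
have h4 := mulr_ge0 IH2 y1'.
split; first lra.
apply/andP; split; lra.
Qed.

(** With 3 in the numerator, the product over a set of primes has the same weight 3^#|J| as the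
    divisor bound, so [card_prime_set_bound] serves both. *)
Lemma local_density_prime_le (R : realFieldType) n p : prime p ->
  local_density R n (p ^ 2) <= 3 / p%:R ^+ 2.
Proof.
move=> pp; rewrite /local_density natrX residue_density_prime //.
have p2 : (2 : R) <= p%:R by rewrite ler_nat prime_gt1.
have p0 : (0 : R) < p%:R by lra.
under eq_bigr => j _ do rewrite -exprVn.
have [] := @one_sub_prod_le R p%:R^-1 n.
- by rewrite invr_ge0 ltW.
- by rewrite ler_pdivrMr // mul1r.
move=> h _; apply: le_trans h _; rewrite exprVn.
have a : 0 <= (p%:R ^+ 2)^-1 :> R by rewrite invr_ge0 exprn_ge0 // ltW.
have b : 0 <= p%:R^-1 ^+ n.+2 :> R by rewrite exprn_ge0 // invr_ge0 ltW.
lra.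
Qed.

Lemma local_density_set_le (R : realFieldType) n P (J : {set 'I_P}) : prime_set J ->
  local_density R n (set_prod J ^ 2) <= (3 ^ #|J|)%:R / (set_prod J)%:R ^+ 2.
Proof.
move=> pJ; rewrite local_density_set //.
have -> : (3 ^ #|J|)%:R / (set_prod J)%:R ^+ 2 = \prod_(p in J) (3 / (p : nat)%:R ^+ 2) :> R.
  rewrite big_split /= prodr_const natrX; congr (_ * _).
  rewrite /set_prod natr_prod -prodrXl -prodfV //.
apply: ler_prod => p pJ'; rewrite local_density_ge0 local_density_prime_le //.
exact: (forall_inP pJ).
Qed.

Lemma local_density_set1 (R : realFieldType) P (J : {set 'I_P}) : prime_set J ->
  local_density R 1 (set_prod J ^ 2) = ((set_prod J)%:R ^+ 2)^-1.
Proof.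
move=> pJ; rewrite local_density_set //.
rewrite /set_prod natr_prod -prodrXl -prodfV; apply: eq_bigr => p pJ'.
rewrite /local_density natrX residue_density_prime ?(forall_inP pJ) //.
by rewrite big_nat1 subKr.
Qed.

(** * Convergence of the Euler product *)

Section FrakS.
Import numFieldNormedType.Exports.
Variables (R : realType) (n : nat).

Let fac p : R := \prod_(2 <= j < n.+2) (1 - p%:R ^- j).

Let fac_bound p : prime p -> 0 <= fac p <= 1.
Proof.
move=> pp; have p2 : (2 : R) <= p%:R by rewrite ler_nat prime_gt1.
have p0 : (0 : R) < p%:R by lra.
rewrite /fac; under eq_bigr => j _ do rewrite -exprVn.
have [] := @one_sub_prod_le R p%:R^-1 n.
- by rewrite invr_ge0 ltW.
- by rewrite ler_pdivrMr // mul1r.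
by [].
Qed.

Lemma frakS_partial_bound P : 0 <= frakS_partial R n P <= 1.
Proof.
rewrite /frakS_partial; apply/andP; split.
  by apply: prodr_ge0 => p /fac_bound/andP[].
by apply: prodr_ile1 => p /fac_bound.
Qed.

Lemma frakS_cvg : cvgn (frakS_partial R n).
Proof.
apply: nonincreasing_is_cvgn.
  apply/nonincreasing_seqP => P; rewrite /frakS_partial big_mkcond big_ord_recr /= -big_mkcond /=.
  have /andP[h0 _] := frakS_partial_bound P.
  case: ifP => pP; last by rewrite mulr1.
  by rewrite ler_piMr //; have /andP[] := fac_bound pP.
by exists 0 => _ [P _ <-]; have /andP[] := frakS_partial_bound P.
Qed.

Lemma frakS_bound : 0 <= frakS R n <= 1.
Proof.
apply/andP; split.
  by apply: limr_ge; [exact: frakS_cvg | apply: nearW => P; have /andP[] := frakS_partial_bound P].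
by apply: limr_le; [exact: frakS_cvg | apply: nearW => P; have /andP[] := frakS_partial_bound P].
Qed.

(** The truncation P of the primes is only auxiliary: a bound uniform in P survives the limit
    defining [frakS]. *)
Lemma frakS_approx (S T B : R) P0 : (forall P, (P0 < P)%N -> `|S - T * frakS_partial R n P| <= B) ->
  `|S - T * frakS R n| <= B.
Proof.
move=> h.
have cv : ((fun P => `|S - T * frakS_partial R n P|%R) @ \oo --> `|S - T * frakS R n|%R)%classic.
  apply: cvg_norm; apply: cvgB; first exact: cvg_cst.
  by apply: cvgMr; exact: frakS_cvg.
have e := cvg_lim (@Rhausdorff R) cv.
rewrite -e; apply: limr_le; first by apply/cvg_ex; exists `|S - T * frakS R n|.
by near=> P; apply: h; near: P; exact: nbhs_infty_gt.
Unshelve. all: by end_near.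
Qed.
End FrakS.

Lemma S_count_error_le (R : realType) k H Q (g : nat -> R) (c s : R) : (0 < H)%N ->
  0 <= c -> 0 < s -> (forall d, 0 <= g d) ->
  (forall P (J : {set 'I_P}), prime_set J -> (set_prod J <= Q)%N ->
     `|(multiple_count k.+1 H (set_prod J ^ 2))%:R
         - local_density R k.+1 (set_prod J ^ 2) * (2 * H).+1%:R ^+ (k.+1 ^ 2)| <= g (set_prod J)) ->
  (forall P (J : {set 'I_P}), prime_set J ->
     local_density R k.+1 (set_prod J ^ 2) <= c * (set_prod J)%:R `^ (- (1 + s))) ->
  `|(S_count k.+1 H)%:R - (2 * H).+1%:R ^+ (k.+1 ^ 2) * frakS R k.+1|
   <= \sum_(d < Q.+1 | (0 < d)%N) g d + Q%:R * (singular_count k.+1 H)%:R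
     + (2 * H).+1%:R ^+ (k.+1 ^ 2) * c * (1 + s^-1) * Q.+1%:R `^ (- s)
     + 4 * ((k.+1)`! * H ^ k.+1)%:R * value_bound R k H / Q.+1%:R.
Proof.
move=> H0 c0 s0 g0 hdev hden.
apply: (@frakS_approx _ _ _ _ _ ((k.+1)`! * H ^ k.+1 + 2)%N) => P hP.
apply: le_trans (S_count_split R Q hP) _.
set T := _ ^+ (k.+1 ^ 2); have T0 : 0 <= T by apply: exprn_ge0.
set V := value_bound R k H; have V0 : 0 <= V := value_bound_ge0 R k H.
set M := ((k.+1)`! * H ^ k.+1)%N.
set N0 := (singular_count k.+1 H)%:R; have N00 : 0 <= N0 by rewrite ler0n.
pose w (d : nat) : R := if (d <= Q)%N then g d + N0
  else T * c * d%:R `^ (- (1 + s)) + 2 * M%:R * V * d%:R `^ (- (1 + 1)).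
have w0 d : 0 <= w d.
  rewrite /w; case: ifP => _; first by rewrite addr_ge0.
  by apply: addr_ge0; apply: mulr_ge0; rewrite ?powR_ge0 //; nonneg.
(* A common bound for Q and all products; the tail estimates below do not depend on it. *)
pose D := (Q.+1 + (\max_(J : {set 'I_P}) set_prod J).+1)%N.
apply: le_trans (_ : \sum_(J : {set 'I_P} | prime_set J) w (set_prod J) <= _).
  apply: ler_sum => J pJ; rewrite /w; case: ifP => dQ.
    by rewrite lerD2r; apply: hdev.
  have d0 : (0 < set_prod J)%N by apply: set_prod_gt0.
  rewrite addrC; apply: lerD; first by rewrite mulrC -mulrA ler_wpM2l // hden.
  apply: le_trans (nonsingular_multiple_count_le R k H0 (_ : 0 < set_prod J ^ 2)%N) _.
    by rewrite expn_gt0 d0.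
  rewrite -/V -/M; apply: ler_wpM2l; first by nonneg.
  rewrite natrX.
  by rewrite (_ : 1 + 1 = 2%:R) // powR_invn.
apply: le_trans (@sum_prime_sets_le P R w D w0 _) _.
  move=> J _; apply: leq_trans (_ : (\max_(J : {set 'I_P}) set_prod J).+1 <= _)%N; last exact: leq_addl.
  by rewrite ltnS (leq_bigmax J).
rewrite (bigID (fun d : 'I_D => (d <= Q)%N)) /=.
rewrite -[leRHS]addrA; apply: lerD.
  have QD : (Q.+1 <= D)%N by apply: leq_addr.
  rewrite (eq_bigr (fun d : 'I_D => g d + N0)); last by move=> d /andP[_ dQ]; rewrite /w dQ.
  rewrite (eq_bigl (fun d : 'I_D => (0 < d)%N && (d < Q.+1)%N)) //.
  rewrite -(big_ord_widen_cond D (fun d => 0 < d)%N (fun d => g d + N0)) //.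
  rewrite big_split /= lerD2l big_mkcond big_ord_recl /= add0r sumr_const card_ord.
  by rewrite -[_ *+ Q]mulr_natl.
apply: le_trans (_ : \sum_(d < D | (Q.+1 <= d)%N)
   (T * c * (d : nat)%:R `^ (- (1 + s)) + 2 * M%:R * V * (d : nat)%:R `^ (- (1 + 1))) <= _).
  rewrite le_eqVlt; apply/orP; left; apply/eqP; apply: eq_big => d.
    by rewrite -ltnNge; apply: andb_idl => /(leq_trans _); apply.
  by move=> /andP[_]; rewrite /w => /negPf ->.
rewrite big_split /= -!mulr_sumr; apply: lerD.
  by rewrite -!mulrA; do 2!apply: ler_wpM2l => //; apply: sum_powR_tail.
(* Taking s = 1 gives 1 + 1/s = 2, which turns the factor 2 into 4. *)
have := sum_powR_tail D (ltr01 : 0 < (1 : R)) (ltn0Sn Q); rewrite invr1 powR_inv1 // => h.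
have MV : 0 <= 2 * M%:R * V by nonneg.
by apply: le_trans (ler_wpM2l MV h) _; rewrite le_eqVlt; apply/orP; left; apply/eqP; ring.
Qed.

(** * Dimension one *)

Lemma multiple_count1 H m :
  multiple_count 1 H m = #|[pred x : 'I_(2 * H).+1 | (m%:Z %| (x : nat)%:Z - H%:Z)%Z]|.
Proof.
rewrite /multiple_count /det_count sum_mx11 -sum1_card [RHS]big_mkcond /=.
by apply: eq_bigr => x _; rewrite det_mx11 shift_mxE !mxE inE; case: (_ %| _)%Z.
Qed.

(** The multiples j m with |j| <= h, where h is the integer part of H/m, all lie in [-H, H]; [f]
    lists them shifted by H. *)
Lemma multiple_count1_ge H m : (0 < m)%N -> ((2 * H).+1 <= m * multiple_count 1 H m + m)%N.
Proof.
move=> m0; rewrite multiple_count1; set A := [pred x | _]; pose h := (H %/ m)%N.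
have hm : (h * m <= H)%N by apply: leq_divM.
have hm' : (H < h.+1 * m)%N by apply: ltn_ceil.
suff cA : ((2 * h).+1 <= #|A|)%N.
  have := leq_mul (leqnn m) cA; rewrite mulSn in hm'; rewrite mulnS mulnCA [(m * h)%N]mulnC; lia.
pose f (j : 'I_(2 * h).+1) : 'I_(2 * H).+1 := inord (j * m + H - h * m).
have jm (j : 'I_(2 * h).+1) : (j * m <= 2 * (h * m))%N.
  by rewrite mulnA leq_mul2r -ltnS ltn_ord orbT.
have fE j : (f j : nat) = (j * m + H - h * m)%N.
  by rewrite /f inordK //; have := jm j; lia.
have f_inj : injective f.
  move=> i j /(congr1 val) /=; rewrite !fE => e.
  have {}e : (i * m = j * m)%N by lia.
  by apply: ord_inj; apply/eqP; rewrite -(eqn_pmul2r m0) e.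
rewrite -[X in (X <= _)%N]card_ord -(fintype.card_image f_inj); apply: subset_leq_card.
apply/fintype.subsetP => _ /codomP[j ->]; rewrite inE fE.
have -> : (j * m + H - h * m)%N%:Z - H%:Z = (j%:Z - h%:Z) * m%:Z by lia.
by rewrite dvdz_mull.
Qed.

Lemma multiple_count1_dev (R : realFieldType) H m : (0 < m)%N ->
  `|(multiple_count 1 H m)%:R - (m%:R)^-1 * (2 * H).+1%:R| <= 1 :> R.
Proof.
move=> m0; have m0' : (0 : R) < m%:R by rewrite ltr0n.
have lo : (2 * H).+1%:R <= m%:R * (multiple_count 1 H m)%:R + m%:R :> R.
  by rewrite -natrM -natrD ler_nat multiple_count1_ge.
have up := congruence_count R (2 * H).+1 1 (- H%:Z) m0.
have e : \sum_(x < (2 * H).+1) ((m%:Z %| - H%:Z + 1 * (x : nat)%:Z)%Z : nat)%:R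
   = (multiple_count 1 H m)%:R :> R.
  rewrite multiple_count1 -sum1_card natr_sum [RHS]big_mkcond /=; apply: eq_bigr => x _.
  by rewrite inE mul1r addrC; case: (_ %| _)%Z.
rewrite e absz1 gcd1n in up.
have lo' : (m%:R)^-1 * (2 * H).+1%:R - 1 <= (multiple_count 1 H m)%:R :> R.
  by rewrite lerBlDr ler_pdivrMl // mulrDr mulr1.
rewrite ler_norml; apply/andP; split; first lra.
rewrite lerBlDr addrC mulrC -div1r; lra.
Qed.

Lemma box_volume_dev (R : realFieldType) H e : (0 < H)%N ->
  0 <= ((2 * H).+1%:R ^+ e - 2 ^+ e * H%:R ^+ e : R) <= e%:R * 3 ^+ e * H%:R ^+ e / H%:R.
Proof.
move=> H0; have h1 : (1 : R) <= H%:R by rewrite ler1n.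
have h0 : (0 : R) < H%:R by lra.
have -> : (2 * H).+1%:R = 2 * H%:R + 1 :> R by rewrite -natr1 natrM.
set h := H%:R in h0 h1 *; rewrite -exprMn.
have T3 j : (2 * h + 1) ^+ j <= (3 * h) ^+ j by rewrite lerXn2r // ?nnegrE; lra.
apply/andP; split; first by rewrite subr_ge0 lerXn2r // ?nnegrE; lra.
elim: e => [|e IHe]; first by rewrite !expr0 subrr !mul0r.
rewrite !exprS -[e.+1%:R]natr1.
have -> : (2 * h + 1) * (2 * h + 1) ^+ e - 2 * h * (2 * h) ^+ e
  = 2 * h * ((2 * h + 1) ^+ e - (2 * h) ^+ e) + (2 * h + 1) ^+ e by ring.
have hh : 0 <= 2 * h by lra.
apply: le_trans (lerD (ler_wpM2l hh IHe) (T3 e)) _.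
rewrite exprMn.
have -> : (e%:R + 1) * (3 * 3 ^+ e) * (h * h ^+ e) / h
  = 2 * h * (e%:R * 3 ^+ e * h ^+ e / h) + 3 ^+ e * h ^+ e + (e%:R + 2) * (3 ^+ e * h ^+ e).
  by field; rewrite gt_eqF.
by rewrite lerDl; nonneg.
Qed.

(** Replacing the side 2H + 1 by 2H costs one factor H, which is acceptable because g <= 1. *)
Lemma S_count_main_term (R : realType) n H (B C g : R) : (0 < H)%N -> g <= 1 ->
  `|(S_count n H)%:R - (2 * H).+1%:R ^+ (n ^ 2) * frakS R n| <= B ->
  B <= C * H%:R `^ ((n ^ 2)%:R - g) ->
  `|(S_count n H)%:R - 2 ^+ (n ^ 2) * frakS R n * H%:R ^+ (n ^ 2)|
    <= (C + (n ^ 2)%:R * 3 ^+ (n ^ 2)) * H%:R `^ ((n ^ 2)%:R - g).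
Proof.
move=> H0 g1; set e := (n ^ 2)%N; set S := (S_count n H)%:R; set F := frakS R n => h1 h2.
have /andP[F0 F1] : 0 <= F <= 1 := frakS_bound R n.
have /andP[v0 v1] := box_volume_dev R e H0.
set T := _ ^+ e in h1 v0 v1; set V := 2 ^+ e * _ in v0 v1.
have HR : (0 : R) < H%:R by rewrite ltr0n.
have v2 : e%:R * 3 ^+ e * H%:R ^+ e / H%:R <= e%:R * 3 ^+ e * H%:R `^ (e%:R - g).
  rewrite -mulrA; apply: ler_wpM2l; first by nonneg.
  rewrite -[X in _ / X](powRr1 (ltW HR)) -powR_mulrn ?(ltW HR) // -powRB ?(gt_eqF HR) ?implybT //.
  by apply: ler_powR; [rewrite ler1n | lra].
have -> : S - 2 ^+ e * F * H%:R ^+ e = (S - T * F) + (T - V) * F by rewrite /V; ring.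
apply: le_trans (ler_normD _ _) _; rewrite [leRHS]mulrDl; apply: lerD; first exact: le_trans h2.
rewrite normrM !ger0_norm //; apply: le_trans (_ : (T - V) * 1 <= _); first exact: ler_wpM2l.
by rewrite mulr1; apply: le_trans v2.
Qed.

Lemma truncn_bounds (R : realType) (x : R) : 0 <= x ->
  (Num.truncn x)%:R <= x /\ x < (Num.truncn x).+1%:R.
Proof. by move=> x0; have /andP[] := truncn_itv x0. Qed.

(** A 1 x 1 matrix has no second entry in its row, so no plane lattice is available; but multiples
    of d^2 in an interval are counted with error at most 1. *)
Lemma S_count_asymptotic_dim1 (R : realType) :
  exists C : R, forall H : nat, (1 <= H)%N ->
    `| (S_count 1 H)%:R - 2 ^+ (1 ^ 2) * frakS R 1 * (H%:R) ^+ (1 ^ 2) |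
      <= C * (H%:R) `^ ((1 ^ 2)%:R - gamma_n R 1).
Proof.
pose W := reciprocal_sum R 1; have W0 : 0 <= W := reciprocal_sum_ge0 R 1.
have g12 : gamma_n R 1 = 2^-1 by rewrite /gamma_n subrr mul0r addr0.
exists ((1 + 5 * W + 6 + 20 * W) + (1 ^ 2)%:R * 3 ^+ (1 ^ 2)) => H H0.
have HR : (0 : R) < H%:R by rewrite ltr0n.
(* Here gamma = 1/2, and Q near H^(1/2) balances Q errors of size 1 against a tail of size H/Q. *)
set r := H%:R `^ (2^-1) : R.
have r0 : 0 < r by apply: powR_gt0.
have rr : r * r = H%:R.
  by rewrite /r -powRDgt0 // (_ : 2^-1 + 2^-1 = 1) ?powRr1 ?ltW //; lra.
have [Q1 Q2] := truncn_bounds (ltW r0); set Q := Num.truncn r in Q1 Q2.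
have VE : value_bound R 0 H = 5 * W.
  by rewrite /value_bound /= fact0 expn0 muln1 !expr1 expr0 mulr1 muln0 add0n.
have rQ : (Q.+1%:R)^-1 <= r^-1 by rewrite lef_pV2 ?posrE ?ltr0n // ltW.
have NH : (2 * H).+1%:R <= 3 * H%:R :> R by rewrite -natrM ler_nat; lia.
apply: (S_count_main_term H0); first by rewrite g12; lra.
  apply: (@S_count_error_le R 0 H Q (fun=> 1) 1 1 H0) => //.
  - move=> P J pJ _; rewrite local_density_set1 // expr1 -natrX.
    by apply: multiple_count1_dev; rewrite expn_gt0 set_prod_gt0.
  - by move=> P J pJ; rewrite local_density_set1 // mul1r (_ : 1 + 1 = 2%:R) // powR_invn.
have -> : (1 ^ 2)%:R - gamma_n R 1 = 2^-1 by rewrite g12 exp1n; lra.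
rewrite -/r.
have t1 : \sum_(d < Q.+1 | (0 < d)%N) 1 <= r.
  rewrite big_mkcond big_ord_recl /= add0r sumr_const card_ord; exact: Q1.
have S1 : (singular_count 1 H)%:R <= 5 * W.
  by have := singular_count_le R 0 H0; rewrite VE !mul0r addr0.
have t2 : Q%:R * (singular_count 1 H)%:R <= r * (5 * W) by apply: ler_pM.
have t3 : (2 * H).+1%:R ^+ (1 ^ 2) * 1 * (1 + 1^-1) * Q.+1%:R `^ (-1) <= 6 * r.
  rewrite expr1 mulr1 invr1 powR_inv1 //.
  apply: le_trans (_ : 3 * H%:R * (1 + 1) * r^-1 <= _).
    by apply: ler_pM; rewrite ?mulr_ge0 ?invr_ge0 // ler_wpM2r.
  by rewrite -rr le_eqVlt; apply/orP; left; apply/eqP; field; rewrite gt_eqF.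
have t4 : 4 * (1`! * H ^ 1)%:R * value_bound R 0 H / Q.+1%:R <= 20 * W * r.
  rewrite VE (_ : (1`! * H ^ 1)%N = H); last by rewrite expn1 mul1n.
  apply: le_trans (_ : 4 * H%:R * (5 * W) * r^-1 <= _).
    by apply: ler_wpM2l => //; nonneg.
  by rewrite -rr le_eqVlt; apply/orP; left; apply/eqP; field; rewrite gt_eqF.
apply: le_trans (lerD (lerD (lerD t1 t2) t3) t4) _; lra.
Qed.

(** * Exponents and error terms *)

Lemma powR_exprn (R : realType) (x a : R) m : (x `^ a) ^+ m = x `^ (a * m%:R).
Proof. by rewrite -powR_mulrn ?powR_ge0 // -powRrM. Qed.

Lemma sum_threshold_le (R : realFieldType) (A D : R) Q : 0 <= A -> 0 <= D ->
  \sum_(d < Q.+1 | (0 < d)%N) (if (d : nat)%:R <= D then A else 0) <= A * D.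
Proof.
move=> A0 D0; rewrite big_mkcond big_ord_recl /= add0r.
(* The first bound is what the induction step needs: when Q + 1 <= D, all Q + 1 terms are estimated
   by A. *)
suff [] : \sum_(i < Q) (if (i.+1)%:R <= D then A else 0) <= A * Q%:R
  /\ \sum_(i < Q) (if (i.+1)%:R <= D then A else 0) <= A * D by [].
elim: Q => [|Q [IH1 IH2]]; first by rewrite big_ord0 mulr0 lexx mulr_ge0.
rewrite big_ord_recr /=; have e : A * Q.+1%:R = A * Q%:R + A by rewrite -natr1 mulrDr mulr1.
case: ifP => h; last by rewrite addr0; split => //; rewrite e; lra.
have s1 : \sum_(i < Q) (if (i.+1)%:R <= D then A else 0) + A <= A * Q.+1%:R by rewrite e lerD2r.
by split => //; apply: le_trans s1 _; apply: ler_wpM2l.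
Qed.

Section Exponents.
Variables (R : realType) (k : nat).
Let x : R := k.+2%:R.
(* [gamma_n = 1/2 + exp_gain]; moduli [d] are split at [H^(1/2 - exp_shift)] and
   [H^(1/2 + exp_shift)], and short vectors are those of size at most [H^exp_cut]. *)
Definition exp_gain : R := gamma_n R k.+2 - 2^-1.
(** Small even after multiplication by n, because peeling raises the divisor bound H^eps to the
    power n - 1. *)
Definition exp_eps : R := (100 * x)^-1.
(** The surplus 2 eps over the gain absorbs the divisor and logarithmic losses in the ranges d <=
    H^(1/2 - shift) and d > Q. *)
Definition exp_shift : R := exp_gain + 2 * exp_eps.
(** For m up to H^(1 + 2 shift), this makes m / L at most H^(1 - eps), shorter than the box. *)
Definition exp_cut : R := 2 * exp_shift + exp_eps.

Let x2 : 2 <= x. Proof. by rewrite ler_nat. Qed.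

Lemma exp_gain_bound : 0 <= exp_gain /\ (4 * x + 10) * exp_gain <= 2^-1.
Proof.
have x2' := x2.
rewrite /exp_gain /gamma_n addrC addKr !natrX -/x.
have D0 : 0 < x ^+ 3 + 3 * x ^+ 2 - x + 1.
  have h : 0 <= (x - 2) * x by apply: mulr_ge0; lra.
  have h3 : 0 <= x ^+ 3 by apply: exprn_ge0; lra.
  rewrite expr2; nra.
have D2 : 0 < 2 * (x ^+ 3 + 3 * x ^+ 2 - x + 1) by lra.
split; first by apply: divr_ge0; lra.
rewrite mulrA ler_pdivrMr // mulrA mulVf ?mul1r ?pnatr_eq0 //.
(* After this substitution the difference of the two sides is the polynomial 1 + y + 5 y^2 + y^3. *)
have [y y0 ->] : exists2 y, 0 <= y & x = 2 + y by exists (x - 2); lra.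
have h : 0 <= 1 + y + 5 * y ^+ 2 + y ^+ 3 by nonneg.
rewrite -subr_ge0; apply: le_trans h _; rewrite le_eqVlt; apply/orP; left; apply/eqP; ring.
Qed.

Lemma exp_eps_eq : x * exp_eps = 100^-1.
Proof. have x2' := x2. by rewrite /exp_eps invfM mulrCA divff ?mulr1 // gt_eqF //; lra. Qed.

Lemma exp_eps_bound : 0 < exp_eps /\ exp_eps <= 200^-1.
Proof.
have x2' := x2.
have e := exp_eps_eq.
have e0 : 0 < exp_eps by rewrite /exp_eps invr_gt0; lra.
split=> //; have := ler_wpM2r (ltW e0) x2; lra.
Qed.

Lemma exp_gain_small : exp_gain <= 36^-1.
Proof.
have x2' := x2.
have [g0 g1] := exp_gain_bound; have := ler_wpM2r g0 x2; lra.
Qed.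

(** The exponent of the exceptional matrices summed over d <= Q: L^3, 1 + m/N, n - 1 peelings, m^-2
    and the number of d. The claim amounts to (4n + 10) gain + (9n + 20) eps <= 1. *)
Lemma exp_bad_le :
  3 * exp_cut + 2 * exp_shift + (exp_eps + 4 * exp_shift) * k.+1%:R - 2 + 4 * exp_shift
    + (2^-1 + exp_shift) <= - (2^-1 + exp_gain).
Proof.
have x2' := x2.
have -> : k.+1%:R = x - 1 :> R by rewrite /x -[k.+2%:R]natr1 addrK.
have e := exp_eps_eq; have [e0 e1] := exp_eps_bound; have [g0 g1] := exp_gain_bound.
rewrite /exp_cut /exp_shift; lra.
Qed.
End Exponents.

Section Estimates.
Variables (R : realType) (k : nat) (H : nat) (C1 : R).
Hypothesis H0 : (0 < H)%N.
Hypothesis C11 : 1 <= C1.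
Hypothesis hC1 : forall P (J : {set 'I_P}), prime_set J ->
    (3 ^ #|J|)%:R <= C1 * (set_prod J)%:R `^ exp_eps R k.
Let h : R := H%:R.
Let eps := exp_eps R k.
Let del := exp_gain R k.
Let del' := exp_shift R k.
Let lam := exp_cut R k.
Let D0r : R := h `^ (2^-1 - del').
Let Qr : R := h `^ (2^-1 + del').
Let Q := Num.truncn Qr.
Let e := (k.+2 ^ 2)%N.
Let N := (2 * H).+1.
Let T : R := N%:R ^+ e.
Let Kn : R := dev_const R e.
(** Makes H^eps absorb the numerical factors in the requirement 4R <= N; smaller H are treated
    trivially at the end. *)
Hypothesis hbig : 16 <= h `^ eps.

Let h1 : 1 <= h. Proof. by rewrite ler1n. Qed.
Let h0 : 0 < h. Proof. by rewrite ltr0n. Qed.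
Let pw a b : h `^ a * h `^ b = h `^ (a + b). Proof. by rewrite powRDgt0. Qed.
Let pmono a b : a <= b -> h `^ a <= h `^ b. Proof. exact: ler_powR. Qed.
Let p0 a : 0 <= h `^ a. Proof. exact: powR_ge0. Qed.
Let p1 : h `^ 1 = h. Proof. by rewrite powRr1 // ltW. Qed.

Let eb : 0 < eps /\ eps <= 200^-1. Proof. exact: exp_eps_bound. Qed.
Let gb : 0 <= del. Proof. by have [] := exp_gain_bound R k. Qed.
Let gs : del <= 36^-1. Proof. exact: exp_gain_small. Qed.
Let dE : del' = del + 2 * eps. Proof. by []. Qed.
Let lE : lam = 2 * del' + eps. Proof. by []. Qed.

Let C10 : 0 <= C1. Proof. by apply: le_trans C11. Qed.
Let hN : h <= N%:R. Proof. by rewrite ler_nat /N; lia. Qed.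
Let N0' : (0 : R) < N%:R. Proof. by rewrite ltr0n. Qed.
Let QQ : Q%:R <= Qr. Proof. by have [] := truncn_bounds (p0 (2^-1 + del')). Qed.
Let QQ1 : Qr < Q.+1%:R. Proof. by have [] := truncn_bounds (p0 (2^-1 + del')). Qed.
Let Qh : Qr <= h. Proof. by rewrite -[leRHS]p1; apply: pmono; have gs' := gs; have [] := eb; rewrite dE; lra. Qed.
Let T0 : 0 <= T. Proof. by rewrite /T; nonneg. Qed.
Let Kn0 : 0 <= Kn. Proof. by rewrite /Kn /dev_const; nonneg. Qed.

Lemma divisor_weight_le P (J : {set 'I_P}) : prime_set J -> (set_prod J <= Q)%N ->
  (3 ^ #|J|)%:R <= C1 * h `^ eps.
Proof.
have gs' := gs; have gb' := gb; have h1' := h1; have h0' := h0.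
move=> pJ JQ; apply: le_trans (hC1 pJ) _; apply: ler_wpM2l => //.
apply: ge0_ler_powR; rewrite ?nnegrE ?ler0n //; first by have [] := eb; move=> /ltW.
by apply: le_trans Qh; apply: le_trans QQ; rewrite ler_nat.
Qed.

Let A : R := Kn * (C1 * h `^ eps) * T / h.

Lemma small_modulus_dev P (J : {set 'I_P}) : prime_set J -> (set_prod J <= Q)%N ->
  (set_prod J)%:R <= D0r ->
  `|(multiple_count k.+2 H (set_prod J ^ 2))%:R
         - local_density R k.+2 (set_prod J ^ 2) * T| <= A.
Proof.
have gs' := gs; have gb' := gb; have h1' := h1; have h0' := h0.
move=> pJ JQ JD; have d0 := set_prod_gt0 pJ; set d := set_prod J in JQ JD d0 *.
have [e0 e1] := eb.
have d2 : (d ^ 2)%:R <= h `^ (1 - 2 * del') :> R.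
  have -> : 1 - 2 * del' = (2^-1 - del') * 2%:R by lra.
  by rewrite natrX -powR_exprn lerXn2r // nnegrE.
have mN : (4 * d ^ 2 <= N)%N.
  rewrite -(ler_nat R) natrM; apply: le_trans hN.
  have : h `^ (1 - 2 * del') * h `^ eps <= h by rewrite pw -[leRHS]p1; apply: pmono; rewrite dE; lra.
  have := ler_wpM2l (p0 (1 - 2 * del')) hbig; lra.
have m0 : (0 < d ^ 2)%N by rewrite expn_gt0 d0.
apply: le_trans (det_count_small R _ m0 mN) _; rewrite -/e -/Kn -/T.
have w : (d ^ 2)%:R * local_density R k.+2 (d ^ 2) <= C1 * h `^ eps.
  rewrite -ler_pdivlMl ?ltr0n // [leRHS]mulrC; apply: le_trans (local_density_set_le R _ pJ) _.
  rewrite -/d [(d ^ 2)%:R]natrX; apply: ler_wpM2r; first by nonneg.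
  exact: divisor_weight_le.
rewrite /A.
have -> : Kn * ((d ^ 2)%:R / N%:R) * (local_density R k.+2 (d ^ 2) * T)
   = Kn * ((d ^ 2)%:R * local_density R k.+2 (d ^ 2)) * T * N%:R^-1 by ring.
have l0 := local_density_ge0 R k.+2 (d ^ 2).
apply: ler_pM; first by nonneg.
- by rewrite invr_ge0.
- by apply: ler_wpM2r => //; apply: ler_wpM2l.
- by rewrite lef_pV2 ?posrE.
Qed.

(** 144 = 9 * 8 * 2: the 9 of [short_relation_const], the cube of 2 h^lam, and the bound 2 h^(2
    del') for 1 + m/N. The square of the latter raises 4^(k+2) to 4^(k+3). *)
Let Kb : R := 144 * 2 ^+ k.+2 * (C1 * 4 ^+ k.+3) ^+ k.+1.
Let xb : R := 3 * lam + 2 * del' + (eps + 4 * del') * k.+1%:R - 2 + 4 * del'.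
Let B : R := Kn * (3 * h `^ (- lam)) * (C1 * h `^ eps) * T / h + Kn * (Kb * h `^ xb * T).

Lemma medium_modulus_dev P (J : {set 'I_P}) : prime_set J -> (set_prod J <= Q)%N ->
  D0r < (set_prod J)%:R ->
  `|(multiple_count k.+2 H (set_prod J ^ 2))%:R
         - local_density R k.+2 (set_prod J ^ 2) * T| <= B.
Proof.
have gs' := gs; have gb' := gb; have h1' := h1; have h0' := h0.
move=> pJ JQ JD; have d0 := set_prod_gt0 pJ.
have wJ := divisor_weight_le pJ JQ; have divJ := size_divisors_set pJ.
have rJ := local_density_set_le R k.+2 pJ.
set d := set_prod J in JQ JD d0 divJ rJ *.
have [e0 e1] := eb.
have d0' : (0 : R) < d%:R by rewrite ltr0n.
have D0p : 0 < D0r by rewrite powR_gt0.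
set m := (d ^ 2)%N in divJ rJ *.
have m0 : (0 < m)%N by rewrite expn_gt0 d0.
have m0' : (0 : R) < m%:R by rewrite ltr0n.
have mhi : m%:R <= h `^ (1 + 2 * del').
  have -> : 1 + 2 * del' = (2^-1 + del') * 2%:R by lra.
  rewrite /m natrX -powR_exprn lerXn2r // ?nnegrE //.
  by apply: le_trans QQ; rewrite ler_nat.
have mlo : m%:R^-1 <= h `^ (- (1 - 2 * del')).
  have -> : 1 - 2 * del' = (2^-1 - del') * 2%:R by lra.
  rewrite powRN -powR_exprn lef_pV2 ?posrE ?exprn_gt0 //.
  by rewrite /m natrX lerXn2r // ?nnegrE // ltW.
(* Rounding up ensures L >= h^lam, so that m / L is at most m h^-lam; L is still at most 2 h^lam. *)
pose L := (Num.truncn (h `^ lam)).+1.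
have [L1 L2] := truncn_bounds (p0 lam).
have lam0 : 0 <= lam by rewrite lE dE; lra.
have L2' : L%:R <= 2 * h `^ lam.
  have : 1 <= h `^ lam by apply: powR_ge1.
  by rewrite /L -natr1; lra.
have L0 : (0 : R) < L%:R by rewrite ltr0n.
(* The least M with m < (M + 1) L, as the pigeonhole principle requires. *)
pose M := (m %/ L)%N.
have M1 : M%:R <= m%:R / L%:R :> R by rewrite ler_pdivlMr // -natrM ler_nat leq_divM.
have Li : L%:R^-1 <= h `^ (- lam).
  by rewrite powRN lef_pV2 ?posrE ?powR_gt0 // ltW.
have M2 : M%:R <= h `^ (1 - eps).
  apply: le_trans M1 _; apply: le_trans (_ : h `^ (1 + 2 * del') * h `^ (- lam) <= _).
    by apply: ler_pM; rewrite ?invr_ge0.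
  by rewrite pw; apply: pmono; rewrite lE; lra.
have big16 : 16 * h `^ (1 - eps) <= h.
  have : h `^ eps * h `^ (1 - eps) <= h by rewrite pw -[leRHS]p1; apply: pmono; lra.
  by apply: le_trans; apply: ler_wpM2r.
have L3 : L%:R <= 2 * h `^ (1 - eps).
  apply: le_trans L2' _; apply: ler_wpM2l => //; apply: pmono; rewrite lE dE; lra.
have MLN : (4 * (M + L) <= N)%N.
  rewrite -(ler_nat R) natrM natrD; apply: le_trans hN; lra.
have mML : (m < M.+1 * L.+1)%N.
  by apply: leq_trans (ltn_ceil m (isT : (0 < L)%N)) _; rewrite leq_mul2l leqnSn orbT.
apply: le_trans (det_count_medium R _ m0 (isT : (0 < L)%N) mML (isT : (0 < N)%N) MLN) _.
rewrite -/e -/Kn -/T.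
have ld0 := local_density_ge0 R k.+2 m.
apply: lerD.
  have -> : Kn * ((M + L)%:R / N%:R) * (local_density R k.+2 m * T)
    = Kn * ((M + L)%:R * local_density R k.+2 m) * T * N%:R^-1 by ring.
  have -> : Kn * (3 * h `^ (- lam)) * (C1 * h `^ eps) * T / h
    = Kn * ((3 * h `^ (- lam)) * (C1 * h `^ eps)) * T / h by ring.
  apply: ler_pM; [by nonneg | by rewrite invr_ge0 | | by rewrite lef_pV2 ?posrE].
  apply: ler_wpM2r => //; apply: ler_wpM2l => //.
  apply: le_trans (_ : (M + L)%:R * (C1 * h `^ eps / m%:R) <= _).
    apply: ler_wpM2l; first exact: ler0n.
    by apply: le_trans rJ _; rewrite /m [(d ^ 2)%:R]natrX; apply: ler_wpM2r => //; nonneg.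
  have -> : (M + L)%:R * (C1 * h `^ eps / m%:R) = ((M + L)%:R / m%:R) * (C1 * h `^ eps) by ring.
  apply: ler_wpM2r; first by rewrite mulr_ge0.
  rewrite natrD mulrDl.
  have a1 : M%:R / m%:R <= h `^ (- lam).
    apply: le_trans Li; rewrite ler_pdivrMr // mulrC; exact: M1.
  have a2 : L%:R / m%:R <= 2 * h `^ (- lam).
    apply: le_trans (_ : 2 * h `^ lam * h `^ (- (1 - 2 * del')) <= _).
      by apply: ler_pM; rewrite ?invr_ge0.
    rewrite -mulrA pw; apply: ler_wpM2l => //; apply: pmono; rewrite lE dE; lra.
  lra.
apply: ler_wpM2l => //; apply: ler_wpM2r => //.
rewrite /short_relation_const /peel_cost /Kb.
have th : 1 + m%:R / N%:R <= 2 * h `^ (2 * del').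
  have a1 : 1 <= h `^ (2 * del') by apply: powR_ge1 => //; rewrite dE; lra.
  have a2 : m%:R / N%:R <= h `^ (2 * del').
    rewrite ler_pdivrMr //; apply: le_trans mhi _; rewrite -pw p1 mulrC; exact: ler_wpM2l.
  lra.
have th0 : 0 <= 1 + m%:R / N%:R :> R by nonneg.
set tau := (size (divisors m))%:R.
have tau1 : tau <= C1 * h `^ eps by apply: le_trans wJ; rewrite ler_nat.
have tau0 : 0 <= tau by rewrite ler0n.
have pe : tau * 4 ^+ k.+2 * (1 + m%:R / N%:R) ^+ 2 <= (C1 * 4 ^+ k.+3) * h `^ (eps + 4 * del').
  have -> : (C1 * 4 ^+ k.+3) * h `^ (eps + 4 * del')
     = (C1 * h `^ eps) * 4 ^+ k.+2 * (2 * h `^ (2 * del')) ^+ 2.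
    have -> : eps + 4 * del' = eps + 2 * del' + 2 * del' by ring.
    rewrite -!pw [4 ^+ k.+3]exprS; ring.
  apply: ler_pM; [by nonneg | by nonneg | by apply: ler_wpM2r; [nonneg |] | ].
  by rewrite lerXn2r // nnegrE mulr_ge0.
have pe0 : 0 <= tau * 4 ^+ k.+2 * (1 + m%:R / N%:R) ^+ 2 by nonneg.
have pe' : (tau * 4 ^+ k.+2 * (1 + m%:R / N%:R) ^+ 2) ^+ k.+1
    <= (C1 * 4 ^+ k.+3) ^+ k.+1 * h `^ ((eps + 4 * del') * k.+1%:R).
  rewrite -powR_exprn -exprMn lerXn2r // nnegrE //.
  exact: le_trans pe.
have Lc : L%:R ^+ 3 <= 8 * h `^ (3 * lam).
  have -> : 8 * h `^ (3 * lam) = (2 * h `^ lam) ^+ 3.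
    by rewrite exprMn powR_exprn [3 * lam]mulrC; congr (_ * _); ring.
  by rewrite lerXn2r // nnegrE // mulr_ge0.
have mm : (m%:R ^+ 2)^-1 <= h `^ (- 2 + 4 * del').
  have -> : - 2 + 4 * del' = (- (1 - 2 * del')) * 2%:R by ring.
  by rewrite -exprVn -powR_exprn lerXn2r // nnegrE // invr_ge0.
have -> : 144 * 2 ^+ k.+2 * (C1 * 4 ^+ k.+3) ^+ k.+1 * h `^ xb
   = 9 * (8 * h `^ (3 * lam)) * 2 ^+ k.+2 * (2 * h `^ (2 * del'))
     * ((C1 * 4 ^+ k.+3) ^+ k.+1 * h `^ ((eps + 4 * del') * k.+1%:R)) * h `^ (- 2 + 4 * del').
  have -> : xb = 3 * lam + 2 * del' + (eps + 4 * del') * k.+1%:R + (- 2 + 4 * del').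
    by rewrite /xb; ring.
  rewrite -!pw; ring.
apply: ler_pM; [by nonneg | by rewrite invr_ge0; nonneg | | exact: mm].
apply: ler_pM; [by nonneg | by apply: exprn_ge0 | | exact: pe'].
apply: ler_pM; [by nonneg | exact: th0 | | exact: th].
apply: ler_wpM2r; first by nonneg.
by apply: ler_wpM2l.
Qed.

Lemma S_count_explicit_error :
  `|(S_count k.+2 H)%:R - T * frakS R k.+2|
   <= (A * D0r + B * Qr) + Qr * (singular_count k.+2 H)%:R
     + T * C1 * 3 * Qr `^ (- (1 - eps))
     + 4 * ((k.+2)`! * H ^ k.+2)%:R * value_bound R k.+1 H / Qr.
Proof.
have gs' := gs; have gb' := gb; have h1' := h1; have h0' := h0.
have [e0 e1] := eb.
have Qr0 : 0 < Qr by apply: powR_gt0.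
have A0 : 0 <= A by rewrite /A; apply: mulr_ge0; [nonneg | rewrite invr_ge0 ltW].
have Kb0 : 0 <= Kb by rewrite /Kb; nonneg.
have B0 : 0 <= B.
  rewrite /B; apply: addr_ge0; last by nonneg.
  by apply: mulr_ge0; [nonneg | rewrite invr_ge0 ltW].
pose g (d : nat) : R := (if d%:R <= D0r then A else 0) + B.
have s0 : 0 < 1 - eps by lra.
have g0 d : 0 <= g d by rewrite /g; case: ifP => _; rewrite addr_ge0.
have hdev P (J : {set 'I_P}) : prime_set J -> (set_prod J <= Q)%N ->
     `|(multiple_count k.+2 H (set_prod J ^ 2))%:R
         - local_density R k.+2 (set_prod J ^ 2) * T| <= g (set_prod J).
  move=> pJ JQ; rewrite /g; case: (leP (set_prod J)%:R D0r) => JD.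
    by apply: le_trans (small_modulus_dev pJ JQ JD) _; rewrite lerDl.
  by rewrite add0r; apply: medium_modulus_dev.
have hden P (J : {set 'I_P}) : prime_set J ->
     local_density R k.+2 (set_prod J ^ 2) <= C1 * (set_prod J)%:R `^ (- (1 + (1 - eps))).
  move=> pJ; have d0 := set_prod_gt0 pJ.
  have d0' : (0 : R) < (set_prod J)%:R by rewrite ltr0n.
  apply: le_trans (local_density_set_le R _ pJ) _.
  have -> : - (1 + (1 - eps)) = eps + - 2%:R by lra.
  rewrite powRDgt0 // powR_invn ?(ltW d0') // mulrA; apply: ler_wpM2r; last exact: hC1.
  by rewrite invr_ge0; nonneg.
have asm := S_count_error_le H0 C10 s0 g0 hdev hden.
apply: le_trans asm _; rewrite -/N -/e -/T.
have V0 := value_bound_ge0 R k.+1 H.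
have QiQ : (Q.+1%:R)^-1 <= Qr^-1 by rewrite lef_pV2 ?posrE // ltW.
apply: lerD; last by apply: ler_wpM2l => //; nonneg.
apply: lerD; last first.
  apply: ler_pM; [apply: mulr_ge0; [by nonneg | by rewrite addr_ge0 ?invr_ge0 // ltW] | exact: powR_ge0 | |].
    apply: ler_wpM2l; first by nonneg.
    have : (1 - eps)^-1 <= 2 by rewrite invf_ple ?posrE; lra.
    lra.
  rewrite !powRN lef_pV2 ?posrE ?powR_gt0 //.
  by apply: ge0_ler_powR; rewrite ?nnegrE ?(ltW Qr0) ?ler0n ?(ltW QQ1) //; lra.
apply: lerD; last by apply: ler_wpM2r.
rewrite /g big_split /=; apply: lerD; first exact: (sum_threshold_le Q A0 (p0 _)).
rewrite big_mkcond big_ord_recl /= add0r sumr_const card_ord -[_ *+ Q]mulr_natr.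
exact: ler_wpM2l.
Qed.
End Estimates.

(** * Conclusion *)

Lemma value_bound_powR (R : realType) k (eps : R) : 0 < eps ->
  exists2 C : R, 0 <= C & forall H, (0 < H)%N ->
    value_bound R k H <= C * H%:R `^ ((k * k.+1)%:R + eps).
Proof.
move=> e0; pose n : R := k.+1%:R; have n1 : 1 <= n by rewrite ler1n.
(* The reciprocal sum runs up to k! H^k and is raised to the power k + 1; with this eta the exponent
   k (k+1) eta stays below eps. *)
pose eta : R := eps / (n * n).
have nn0 : 0 < n * n by apply: mulr_gt0; lra.
have eta0 : 0 < eta by apply: divr_gt0.
have [C2 C20 hC2] := reciprocal_sum_bound eta0.
pose F : R := (k`!)%:R `^ eta; have F0 : 0 <= F by apply: powR_ge0.
exists (((2 * k + 5)%:R ^+ k.+1) ^+ k.+1 * (C2 * F) ^+ k.+1).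
  by have C20' := ltW C20; nonneg.
move=> H H0; have h0 : (0 : R) < H%:R by rewrite ltr0n.
have h1 : (1 : R) <= H%:R by rewrite ler1n.
rewrite /value_bound powRDgt0 // powR_mulrn ?(ltW h0) // exprM.
have Y0 : (0 < k`! * H ^ k)%N by rewrite muln_gt0 fact_gt0 expn_gt0 H0.
have W1 : reciprocal_sum R (k`! * H ^ k) ^+ k.+1 <= (C2 * F) ^+ k.+1 * H%:R `^ eps.
  apply: le_trans (_ : (C2 * F * H%:R `^ (k%:R * eta)) ^+ k.+1 <= _).
    rewrite lerXn2r ?nnegrE ?reciprocal_sum_ge0 //.
      by rewrite !mulr_ge0 ?powR_ge0 // ltW.
    apply: le_trans (hC2 _ Y0) _.
    by rewrite natrM natrX powRM ?exprn_ge0 ?(ltW h0) // -powR_mulrn ?(ltW h0) // -powRrM mulrA.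
  rewrite exprMn; apply: ler_wpM2l; first by rewrite exprn_ge0 // mulr_ge0 // ltW.
  rewrite powR_exprn; apply: ler_powR => //.
  rewrite /eta -/n; have kn : k%:R <= n by rewrite ler_nat.
  have -> : k%:R * (eps / (n * n)) * n = eps * (k%:R / n) by field; rewrite gt_eqF //; lra.
  by rewrite ler_piMr ?(ltW e0) // ler_pdivrMr ?mul1r //; lra.
rewrite [(_ * H%:R ^+ k) ^+ k.+1]exprMn.
have -> : ((2 * k + 5)%:R ^+ k.+1) ^+ k.+1 * (C2 * F) ^+ k.+1 * ((H%:R ^+ k) ^+ k.+1 * H%:R `^ eps)
  = ((2 * k + 5)%:R ^+ k.+1) ^+ k.+1 * (H%:R ^+ k) ^+ k.+1 * ((C2 * F) ^+ k.+1 * H%:R `^ eps) by ring.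
by apply: ler_wpM2l; [nonneg | exact: W1].
Qed.

Lemma box_volume_le (R : realFieldType) H e : (0 < H)%N ->
  (2 * H).+1%:R ^+ e <= 3 ^+ e * H%:R ^+ e :> R.
Proof.
move=> H0; rewrite -exprMn lerXn2r ?nnegrE //.
by rewrite -natrM ler_nat; lia.
Qed.

Lemma S_count_le n H : (S_count n H <= (2 * H).+1 ^ (n ^ 2))%N.
Proof. by apply: leq_trans (max_card _) _; rewrite card_mx card_ord mulnn. Qed.

Lemma S_count_asymptotic_large (R : realType) k : exists C : R, forall H : nat, (1 <= H)%N ->
  16 <= H%:R `^ exp_eps R k ->
  `| (S_count k.+2 H)%:R - 2 ^+ (k.+2 ^ 2) * frakS R k.+2 * H%:R ^+ (k.+2 ^ 2) |
      <= C * H%:R `^ ((k.+2 ^ 2)%:R - gamma_n R k.+2).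
Proof.
have [e0 e1] := exp_eps_bound R k.
have [C1 C11 hC1] := card_prime_set_bound e0.
have [Cv Cv0 hCv] := value_bound_powR k.+1 e0.
set eps := exp_eps R k in e0 e1 hC1 hCv *.
have [gb gb2] := exp_gain_bound R k; have gs := exp_gain_small R k.
have gE : gamma_n R k.+2 = 2^-1 + exp_gain R k by rewrite /exp_gain addrC subrK.
have xbl := exp_bad_le R k.
set del := exp_gain R k in gb gb2 gs gE xbl.
pose del' := exp_shift R k; have dE : del' = del + 2 * eps by [].
pose lam := exp_cut R k; have lE : lam = 2 * del' + eps by [].
rewrite -/eps -/del' -/lam in xbl.
set e := (k.+2 ^ 2)%N; set E : R := e%:R.
pose Kn : R := dev_const R e; have Kn0 : 0 <= Kn by rewrite /Kn /dev_const; nonneg.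
have C10 : 0 <= C1 by apply: le_trans C11.
pose Kb : R := 144 * 2 ^+ k.+2 * (C1 * 4 ^+ k.+3) ^+ k.+1; have Kb0 : 0 <= Kb by rewrite /Kb; nonneg.
pose K0 : R := Cv + k.+1%:R * 4 ^+ k.+1 * 3 ^+ e; have K00 : 0 <= K0 by rewrite /K0; nonneg.
(* The constant is left open and is unified at the end with the sum of the constants of t1 to t5. *)
eexists => H H0 hbig.
have g1 : gamma_n R k.+2 <= 1 by rewrite gE; lra.
apply: (S_count_main_term H0 g1 (S_count_explicit_error H0 C11 hC1 hbig)).
rewrite -/e -/eps -/del' -/lam -/Kn -/Kb -/E.
set T := _ ^+ e; set h := H%:R.
have h0 : 0 < h by rewrite ltr0n.
have h1 : 1 <= h by rewrite ler1n.
have T0 : 0 <= T by rewrite /T; nonneg.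
have T3 : T <= 3 ^+ e * h `^ E by rewrite powR_mulrn ?(ltW h0) // box_volume_le.
have p0 a : 0 <= h `^ a by apply: powR_ge0.
have pmono a b : a <= b -> h `^ a <= h `^ b by exact: ler_powR.
have pw a b : h `^ a * h `^ b = h `^ (a + b) by rewrite powRDgt0.
have hinv : h^-1 = h `^ (- 1) by rewrite powR_inv1 // ltW.
set X := h `^ (E - gamma_n R k.+2).
have Tp a : a <= - gamma_n R k.+2 -> T * h `^ a <= 3 ^+ e * X.
  move=> ha; apply: le_trans (ler_wpM2r (p0 a) T3) _; rewrite -mulrA pw.
  by apply: ler_wpM2l; [nonneg | apply: pmono; lra].
have t1 : Kn * (C1 * h `^ eps) * T / h * h `^ (2^-1 - del') <= (Kn * C1 * 3 ^+ e) * X.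
  have -> : Kn * (C1 * h `^ eps) * T / h * h `^ (2^-1 - del')
     = (Kn * C1) * (T * h `^ (eps + - 1 + (2^-1 - del'))) by rewrite hinv -!pw; ring.
  rewrite -[X in _ <= X]mulrA; apply: ler_wpM2l; first by nonneg.
  by apply: Tp; rewrite gE dE; lra.
have t2 : (Kn * (3 * h `^ (- lam)) * (C1 * h `^ eps) * T / h
    + Kn * (Kb * h `^ (3 * lam + 2 * del' + (eps + 4 * del') * k.+1%:R - 2 + 4 * del') * T)) * h `^ (2^-1 + del')
    <= (3 * Kn * C1 * 3 ^+ e) * X + (Kn * Kb * 3 ^+ e) * X.
  rewrite mulrDl; apply: lerD.
    have -> : Kn * (3 * h `^ (- lam)) * (C1 * h `^ eps) * T / h * h `^ (2^-1 + del')
      = (3 * Kn * C1) * (T * h `^ (- lam + eps + - 1 + (2^-1 + del'))) by rewrite hinv -!pw; ring.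
    rewrite -[X in _ <= X]mulrA; apply: ler_wpM2l; first by nonneg.
    by apply: Tp; rewrite gE lE dE; lra.
  set xb := 3 * lam + _ + _ - 2 + _ in xbl *.
  have -> : Kn * (Kb * h `^ xb * T) * h `^ (2^-1 + del')
     = (Kn * Kb) * (T * h `^ (xb + (2^-1 + del'))) by rewrite -!pw; ring.
  rewrite -[X in _ <= X]mulrA; apply: ler_wpM2l; first by nonneg.
  by apply: Tp; rewrite gE.
have En : (k.+1 * k.+2)%:R + k.+2%:R = E.
  by rewrite -natrD /E /e; congr (_%:R); ring.
have k2 : 2 <= k.+2%:R :> R by rewrite ler_nat.
have V1 := hCv H H0; rewrite -/h in V1.
have V0 := value_bound_ge0 R k.+1 H.
have N1 : (singular_count k.+2 H)%:R <= K0 * h `^ (E - 2 + eps).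
  apply: le_trans (singular_count_le R k.+1 H0) _; rewrite -/e -/T /K0 mulrDl; apply: lerD.
    apply: le_trans V1 _; apply: ler_wpM2l => //; apply: pmono; lra.
  apply: le_trans (_ : k.+1%:R * 4 ^+ k.+1 * (3 ^+ e * h `^ E) / h ^+ 2 <= _).
    apply: ler_pM; [by nonneg | by rewrite invr_ge0; nonneg | by apply: ler_wpM2l; [nonneg|] |].
    have hN : h <= (2 * H).+1%:R by rewrite ler_nat; apply: leqW; exact: leq_pmull.
    have N0 : (0 : R) < (2 * H).+1%:R by rewrite ltr0n.
    by rewrite lef_pV2 ?posrE ?exprn_gt0 // lerXn2r ?nnegrE // ltW.
  have -> : (h ^+ 2)^-1 = h `^ (- 2%:R) by rewrite powR_invn // ltW.
  have -> : k.+1%:R * 4 ^+ k.+1 * (3 ^+ e * h `^ E) * h `^ (- 2%:R)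
     = (k.+1%:R * 4 ^+ k.+1 * 3 ^+ e) * h `^ (E + - 2%:R) by rewrite -pw; ring.
  by apply: ler_wpM2l; [nonneg | apply: pmono; lra].
have t3 : h `^ (2^-1 + del') * (singular_count k.+2 H)%:R <= K0 * X.
  apply: le_trans (ler_wpM2l (p0 _) N1) _; rewrite mulrCA pw.
  by apply: ler_wpM2l => //; apply: pmono; rewrite gE dE; lra.
have t4 : T * C1 * 3 * (h `^ (2^-1 + del')) `^ (- (1 - eps)) <= (3 * C1 * 3 ^+ e) * X.
  rewrite -powRrM.
  have -> : T * C1 * 3 * h `^ ((2^-1 + del') * (- (1 - eps)))
    = (3 * C1) * (T * h `^ ((2^-1 + del') * (- (1 - eps)))) by ring.
  rewrite -[X in _ <= X]mulrA; apply: ler_wpM2l; first by nonneg.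
  apply: Tp; rewrite gE.
  have : eps * del' <= eps * 1 by apply: ler_wpM2l; [exact: ltW | rewrite dE; lra].
  by rewrite dE; lra.
have t5 : 4 * ((k.+2)`! * H ^ k.+2)%:R * value_bound R k.+1 H / h `^ (2^-1 + del')
    <= (4 * ((k.+2)`!)%:R * Cv) * X.
  rewrite -powRN natrM natrX -/h -powR_mulrn ?(ltW h0) //.
  apply: le_trans (_ : 4 * (((k.+2)`!)%:R * h `^ k.+2%:R) * (Cv * h `^ ((k.+1 * k.+2)%:R + eps))
      * h `^ (- (2^-1 + del')) <= _).
    by apply: ler_wpM2r => //; apply: ler_wpM2l => //; nonneg.
  have -> : 4 * (((k.+2)`!)%:R * h `^ k.+2%:R) * (Cv * h `^ ((k.+1 * k.+2)%:R + eps))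
      * h `^ (- (2^-1 + del'))
    = (4 * ((k.+2)`!)%:R * Cv) * h `^ (k.+2%:R + ((k.+1 * k.+2)%:R + eps) + - (2^-1 + del')).
    by rewrite -!pw; ring.
  by apply: ler_wpM2l; [nonneg | apply: pmono; rewrite gE dE; lra].
apply: le_trans (lerD (lerD (lerD (lerD t1 t2) t3) t4) t5) _.
rewrite -!mulrDl; exact: lexx.
Qed.

Lemma S_count_asymptotic_dim_ge2 (R : realType) k :
  exists C : R, forall H : nat, (1 <= H)%N ->
    `| (S_count k.+2 H)%:R - 2 ^+ (k.+2 ^ 2) * frakS R k.+2 * (H%:R) ^+ (k.+2 ^ 2) |
      <= C * (H%:R) `^ ((k.+2 ^ 2)%:R - gamma_n R k.+2).
Proof.
have [C hC] := S_count_asymptotic_large R k.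
have [e0 e1] := exp_eps_bound R k; set eps := exp_eps R k in e0 e1 hC.
have [gb gb2] := exp_gain_bound R k; have gs := exp_gain_small R k.
have gE : gamma_n R k.+2 = 2^-1 + exp_gain R k by rewrite /exp_gain addrC subrK.
set e := (k.+2 ^ 2)%N in hC *.
pose b : R := 16 `^ eps^-1; have b0 : 0 <= b by apply: powR_ge0.
pose K : R := (3 ^+ e + 2 ^+ e) * b; have K0 : 0 <= K by rewrite /K; nonneg.
exists (`|C| + K) => H H0.
have h0 : (0 : R) < H%:R by rewrite ltr0n.
have h1 : (1 : R) <= H%:R by rewrite ler1n.
set X := _ `^ _; have X0 : 0 <= X by apply: powR_ge0.
case: (leP 16 (H%:R `^ eps)) => hb.
  apply: le_trans (hC H H0 hb) _; apply: ler_wpM2r => //.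
  by have := ler_norm C; lra.
(* For H^eps < 16 the side is bounded, and the trivial estimate (2H + 1)^(n^2) loses at most one
   factor H <= b, because gamma <= 1. *)
have hb' : H%:R <= b.
  have -> : H%:R = (H%:R `^ eps) `^ eps^-1 :> R.
    by rewrite -powRrM divff ?gt_eqF // powRr1 // ltW.
  by apply: ge0_ler_powR; rewrite ?nnegrE ?powR_ge0 ?invr_ge0 ?(ltW e0) ?(ltW hb).
have /andP[F0 F1] := frakS_bound R k.+2.
have S3 : (S_count k.+2 H)%:R <= 3 ^+ e * H%:R ^+ e :> R.
  apply: le_trans (box_volume_le R e H0); rewrite -natrX ler_nat; exact: S_count_le.
have hX : H%:R ^+ e <= b * X.
  rewrite -powR_mulrn ?(ltW h0) //; apply: le_trans (_ : H%:R * X <= _); last exact: ler_wpM2r.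
  rewrite -[X in _ <= X * _](powRr1 (ltW h0)) /X -powRDgt0 //.
  by apply: ler_powR => //; rewrite gE; lra.
apply: le_trans (ler_normB _ _) _.
rewrite normr_nat ger0_norm; last by nonneg.
have s2 : 2 ^+ e * frakS R k.+2 * H%:R ^+ e <= 2 ^+ e * H%:R ^+ e.
  by apply: ler_wpM2r; [nonneg | rewrite ler_piMr //; nonneg].
apply: le_trans (lerD S3 s2) _; rewrite -mulrDl.
apply: le_trans (_ : (3 ^+ e + 2 ^+ e) * (b * X) <= _); first by apply: ler_wpM2l; [nonneg|].
rewrite mulrA -/K; apply: ler_wpM2r => //; have := normr_ge0 C; lra.
Qed.

Theorem theorem1p1 (R : realType) (n : nat) (hn : (1 <= n)%N) :
  exists C : R, forall H : nat, (1 <= H)%N ->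
    `| (S_count n H)%:R - 2 ^+ (n ^ 2) * frakS R n * (H%:R) ^+ (n ^ 2) |
      <= C * (H%:R) `^ ((n ^ 2)%:R - gamma_n R n).
Proof.
by case: n hn => [|[|k]] // _; [exact: S_count_asymptotic_dim1 | exact: S_count_asymptotic_dim_ge2].
Qed.
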